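(* For every integer $d\ge 4$, every integer $k$ with $1\le k\le d+1$ and every $\varepsilon>0$, \[\mathrm{C}(d,k,n)=O_{d,\varepsilon}\left(n^{\frac{5}{8}d+\frac{1}{8}k+\varepsilon}\right).\] In particular, $\mathrm{C}(d,k,n)=O_{d,\varepsilon}\left(n^{\frac34 d+\varepsilon}\right)$ for $k\le d$.
   Context: For positive integers $d,k,n$ with $k\le d+1$, $\mathrm{C}(d,k,n)$ denotes the maximum, over all $k$-element sets $S\subset\mathbb{R}^d$ of affinely independent points (vertex sets of $k$-vertex simplices) and all $n$-element sets $P\subset\mathbb{R}^d$, of the number of $k$-element subsets of $P$ that are congruent to $S$ (i.e. are the image of $S$ under an isometry of $\mathbb{R}^d$). *)

(* Defs.v *)
From HB Require Import structures.
From mathcomp Require Import all_boot all_order all_algebra.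
From mathcomp Require Import boolp reals exp.
Set Implicit Arguments. Unset Strict Implicit. Unset Printing Implicit Defensive.
Import Order.TTheory GRing.Theory Num.Theory.
Local Open Scope ring_scope.

Definition sqdist (R : realType) (d : nat) (x y : 'rV[R]_d) : R :=
  \sum_(i < d) (x ord0 i - y ord0 i) ^+ 2.

Definition isometry (R : realType) (d : nat) (f : 'rV[R]_d -> 'rV[R]_d) : Prop :=
  forall x y, sqdist (f x) (f y) = sqdist x y.

Definition aff_indep (R : realType) (d k : nat) (S : 'I_k -> 'rV[R]_d) : Prop :=
  forall a : 'I_k -> R,
    \sum_(i < k) a i = 0 -> \sum_(i < k) a i *: S i = 0 -> forall i, a i = 0.

Definition congruent_to (R : realType) (d k n : nat)
  (S : 'I_k -> 'rV[R]_d) (P : 'I_n -> 'rV[R]_d) (A : {set 'I_n}) : Prop :=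
  exists f : 'rV[R]_d -> 'rV[R]_d, isometry f /\
    (forall j, j \in A -> exists i, P j = f (S i)) /\
    (forall i, exists2 j, j \in A & f (S i) = P j).

(* number of k-element subsets of the n-point set P (given by an injective
   enumeration P : 'I_n -> R^d) that are congruent to {S i | i < k} *)
Definition num_congruent (R : realType) (d k n : nat)
  (S : 'I_k -> 'rV[R]_d) (P : 'I_n -> 'rV[R]_d) : nat :=
  #|[set A : {set 'I_n} | (#|A| == k) && `[< congruent_to S P A >] ]|.

(* Main.v *)
(* Copies of the simplex are counted as tuples of points with prescribed mutual distances, by
   induction on the number of vertices, all bounds being polynomial in the sizes of the sets from
   which the vertices are taken. Remove a vertex i. For a tuple x of the remaining vertices the
   possible positions of vertex i form a set, inside which a canonical subset Y of comparable size is
   chosen, no large part of which has smaller rank. Let X_Y be the tuples with the same Y. All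
   distances between Y and X_Y depend on the label only, so their affine hulls are orthogonal and
   their dimensions add up: the inductive bound for X_Y applies in a smaller dimension. The number of
   sets Y is bounded in two ways, because Y is determined by affinely independent points spanning it,
   and also by points spanning X_Y, taken greedily from its projections (after regularizing X_Y). The
   better of the two bounds is always good enough; this is a linear programming argument for the
   logarithms. It is first run with vertex sets of different sizes, in ambient dimension as small as
   the hull, and the result is fed into a last run with equal vertex sets. There the bound for X_Y is
   improved by adding the circumcenter of Y, which is at constant distance from each vertex of the
   tuples in X_Y, as a further vertex. *)
Require Import Defs.
From HB Require Import structures.
From mathcomp Require Import all_boot all_order all_algebra.
From mathcomp Require Import boolp reals sequences exp.
From mathcomp Require Import ring lra zify.
Set Implicit Arguments. Unset Strict Implicit. Unset Printing Implicit Defensive.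
Import Order.TTheory GRing.Theory Num.Theory.
Local Open Scope ring_scope.

(** * Affine rank *)

(** The two counts of the sets Y are complementary. If X_Y stays far below its inductive bound,
    there is room to pay for rk Y free points of P_i; if it comes close, its projections nearly fill
    the label sets, and points spanning them determine Y cheaply. Sets Y of different sizes are not
    separated dyadically: each Y carries a weight, and the sum of the weights over all Y is bounded.
    Up to constants only the regularization loses anything, a power |I|/(q+1), hence the epsilon. In
    the exponent a vertex is worth 3/4 and a free dimension 5/8; the difference 1/8 is the exponent
    of the number of positions that vertex i may have without any argument about Y. For equal label
    sets in full rank d+1 the unbalanced bound exceeds the target by 1/4. The circumcenter makes
    good for this: as a vertex with a single position it costs nothing but uses up one dimension,
    worth 5/8. It fails only if it depends affinely on the other vertices. Then one of these is
    redundant, provided that the center is not itself a vertex; the vertex i is chosen so as to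
    exclude that. *)

Section Dot.
Context {R : realType} {d : nat}.
Implicit Types x y z u v : 'rV[R]_d.

Definition dot x y : R := \sum_(i < d) x ord0 i * y ord0 i.

Lemma dotC x y : dot x y = dot y x.
Proof. by apply: eq_bigr => i _; rewrite mulrC. Qed.

Lemma dotDl x y z : dot (x + y) z = dot x z + dot y z.
Proof. by rewrite -big_split; apply: eq_bigr => i _; rewrite mxE mulrDl. Qed.

Lemma dotZl c x y : dot (c *: x) y = c * dot x y.
Proof. by rewrite mulr_sumr; apply: eq_bigr => i _; rewrite mxE mulrA. Qed.

Lemma dotNl x y : dot (- x) y = - dot x y.
Proof. by rewrite -scaleN1r dotZl mulN1r. Qed.

Lemma dotDr x y z : dot x (y + z) = dot x y + dot x z.
Proof. by rewrite dotC dotDl !(dotC x). Qed.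

Lemma dotZr c x y : dot x (c *: y) = c * dot x y.
Proof. by rewrite dotC dotZl (dotC x). Qed.

Lemma dotNr x y : dot x (- y) = - dot x y.
Proof. by rewrite dotC dotNl (dotC x). Qed.

Definition dotE := (dotDl, dotDr, dotNl, dotNr, dotZl, dotZr).

Lemma dot0l y : dot 0 y = 0.
Proof. by rewrite -(scale0r 0) dotZl mul0r. Qed.

Lemma dotxx_eq0 x : dot x x = 0 -> x = 0.
Proof.
move=> /eqP; rewrite psumr_eq0 => [/allP h|i _]; last by rewrite -expr2 sqr_ge0.
apply/rowP => i; rewrite mxE.
by have := h i (mem_index_enum i); rewrite /= mulf_eq0 orbb => /eqP.
Qed.

Lemma sqdistE x y : sqdist x y = dot (x - y) (x - y).
Proof. by apply: eq_bigr => i _; rewrite !mxE expr2. Qed.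

Lemma sqdistC x y : sqdist x y = sqdist y x.
Proof. by rewrite !sqdistE !dotE (dotC x y); ring. Qed.

Lemma sqdist_eq0 x y : sqdist x y = 0 -> x = y.
Proof. by rewrite sqdistE => /dotxx_eq0/eqP; rewrite subr_eq0 => /eqP. Qed.

Lemma sqdistxx x : sqdist x x = 0.
Proof. by rewrite sqdistE subrr dot0l. Qed.

Lemma dot_suml (I : finType) (F : I -> 'rV[R]_d) y :
  dot (\sum_i F i) y = \sum_i dot (F i) y.
Proof.
rewrite exchange_big /=; apply: eq_bigr => c _.
by rewrite summxE mulr_suml.
Qed.

Lemma dot_sumr (I : finType) (F : I -> 'rV[R]_d) y :
  dot y (\sum_i F i) = \sum_i dot y (F i).
Proof. by rewrite dotC dot_suml; apply: eq_bigr => i _; rewrite dotC. Qed.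

(** Schoenberg's identity: after expansion the terms with a single squared norm carry the factor
    \sum_i a i = 0. It makes affine dependence readable from mutual distances alone. *)
Lemma sum_sqdist (I : finType) (a : I -> R) (x : I -> 'rV[R]_d) :
  \sum_i a i = 0 ->
  \sum_i \sum_j a i * a j * sqdist (x i) (x j)
  = - 2 * dot (\sum_i a i *: x i) (\sum_i a i *: x i).
Proof.
move=> a0.
transitivity (\sum_i \sum_j (a i * dot (x i) (x i) * a j
   + a i * (a j * dot (x j) (x j)) - 2 * (a i * a j * dot (x i) (x j)))).
  apply: eq_bigr => i _; apply: eq_bigr => j _.
  by rewrite sqdistE !dotE (dotC (x j) (x i)); ring.
under eq_bigr do rewrite big_split big_split /= -mulr_sumr a0 mulr0 add0r -mulr_sumr.
rewrite big_split /= -mulr_suml a0 mul0r add0r dot_suml mulr_sumr.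
apply: eq_bigr => i _; rewrite dotZl dot_sumr sumrN mulNr; congr (- _).
by rewrite !mulr_sumr; apply: eq_bigr => j _; rewrite dotZr; ring.
Qed.

(** Orthogonal projection to the span of [vs] by Gram-Schmidt. That u lies in the span is expressed
    dually: whatever is orthogonal to [vs] is orthogonal to u. *)
Lemma proj_exists (vs : seq 'rV[R]_d) x :
  exists2 u, (forall v, v \in vs -> dot (x - u) v = 0) &
    forall z, (forall v, v \in vs -> dot z v = 0) -> dot z u = 0.
Proof.
elim: vs x => [|v vs IH] x; first by exists 0 => // z _; rewrite dotC dot0l.
have [p p1 p2] := IH v; have [u u1 u2] := IH x.
have uv : forall z, z \in vs -> dot (v - p) z = 0 by [].
have [v0|v0] := eqVneq (v - p) 0.
  have vp : v = p by apply/eqP; rewrite -subr_eq0 v0.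
  exists u => [z|z hz]; last by apply: u2 => w hw; apply: hz; rewrite inE hw orbT.
  by rewrite inE => /orP[/eqP->|/u1//]; rewrite vp; apply: p2.
have vv : dot (v - p) (v - p) != 0.
  by apply: contra_neq v0 => /dotxx_eq0.
have vvE : dot (v - p) (v - p) = dot (v - p) v.
  by rewrite dotDr dotNr (p2 (v - p)) // subr0.
pose c := dot (x - u) (v - p) / dot (v - p) (v - p).
exists (u + c *: (v - p)).
  move=> z; rewrite opprD addrA (dotDl (x - u)) dotNl dotZl inE => /orP[/eqP->|hz].
    rewrite -vvE mulfVK // -dotNr -dotDr subKr.
    exact: p2.
  by rewrite uv // mulr0 subr0 u1.
move=> z hz; rewrite dotDr dotZr dotDr dotNr u2; last first.
  by move=> w hw; apply: hz; rewrite inE hw orbT.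
rewrite p2; last by move=> w hw; apply: hz; rewrite inE hw orbT.
by rewrite hz ?mem_head // subrr mulr0 addr0.
Qed.

(** Stewart's theorem: the squared distance from x to a point dividing y y' is the weighted mean
    minus this product, which therefore vanishes. *)
Lemma sqdist_mid (x y y' : 'rV[R]_d) s c :
  sqdist y x = c -> sqdist y' x = c ->
  sqdist (s *: y + (1 - s) *: y') x = c -> s * (1 - s) * sqdist y y' = 0.
Proof.
move=> h1 h2.
have -> : sqdist (s *: y + (1 - s) *: y') x =
   s * sqdist y x + (1 - s) * sqdist y' x - s * (1 - s) * sqdist y y'.
  by rewrite !sqdistE !dotE (dotC y' y) (dotC x y) (dotC x y'); ring.
rewrite h1 h2; lra.
Qed.

End Dot.

Section Rank.
Context {R : realType} {d : nat} {T : finType} (pt : T -> 'rV[R]_d).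
Implicit Types (Y Z : {set T}) (t : T).

Definition dd t t' := sqdist (pt t) (pt t').

(** Homogeneous coordinates: affine hulls become row spaces, and [rk] is the affine dimension plus
    one, with value 0 for the empty set. *)
Definition aug (x : 'rV[R]_d) : 'rV[R]_(1 + d) := row_mx 1 x.

Definition aff Y : 'M[R]_(1 + d) := (\sum_(t in Y) <<aug (pt t)>>)%MS.

Definition rk Y : nat := \rank (aff Y).

Lemma aff_sub Y m (W : 'M[R]_(m, 1 + d)) :
  (forall t, t \in Y -> (aug (pt t) <= W)%MS) -> (aff Y <= W)%MS.
Proof. by move=> h; apply/sumsmx_subP => t /h; rewrite genmxE. Qed.

Lemma mem_aff Y t : t \in Y -> (aug (pt t) <= aff Y)%MS.
Proof. by move=> tY; apply: (sumsmx_sup t) => //; rewrite genmxE. Qed.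

Lemma aff_mono Y Z : Y \subset Z -> (aff Y <= aff Z)%MS.
Proof. by move=> /subsetP s; apply: aff_sub => t /s /mem_aff. Qed.

Lemma rk_mono Y Z : Y \subset Z -> (rk Y <= rk Z)%N.
Proof. by move=> /aff_mono/mxrankS. Qed.

Lemma rk_max Y : (rk Y <= d.+1)%N.
Proof. exact: rank_leq_col. Qed.

Lemma rk0 : rk set0 = 0%N.
Proof. by rewrite /rk /aff big_set0 mxrank0. Qed.

Lemma rk_aff_le Y Z :
  (forall t, t \in Y -> (aug (pt t) <= aff Z)%MS) -> (rk Y <= rk Z)%N.
Proof. by move=> h; apply/mxrankS/aff_sub. Qed.

Lemma aff_full Y Z t : Z \subset Y -> (rk Y <= rk Z)%N -> t \in Y ->
  (aug (pt t) <= aff Z)%MS.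
Proof.
move=> s r tY; apply: (submx_trans (mem_aff tY)).
have := mxrank_leqif_sup (aff_mono s); rewrite -[\rank (aff Z)]/(rk Z) => -[h <-].
by rewrite eqn_leq r h.
Qed.

Lemma aff_U1 t Y : (aff (t |: Y) :=: aug (pt t) + aff Y)%MS.
Proof.
apply/eqmxP/andP; split.
  apply: aff_sub => u /setU1P[->|uY]; first exact: addsmxSl.
  exact: submx_trans (mem_aff uY) (addsmxSr _ _).
rewrite addsmx_sub mem_aff ?setU11 //=.
exact/aff_mono/subsetUr.
Qed.

Lemma rk_U1 t Y : (rk (t |: Y) <= (rk Y).+1)%N.
Proof.
rewrite /rk aff_U1.
have := mxrank_adds_leqif (aug (pt t)) (aff Y) => -[h _].
exact: leq_trans h (leq_add (rank_leq_row (aug (pt t))) (leqnn _)).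
Qed.

Lemma rk_U1_notin t Y : ~~ (aug (pt t) <= aff Y)%MS -> rk (t |: Y) = (rk Y).+1.
Proof.
move=> h; apply/eqP; rewrite eqn_leq rk_U1 /= ltnNge; apply: contra h => h.
by apply: (@aff_full (t |: Y)) => //; rewrite ?setU11 ?subsetUr.
Qed.

Lemma rk_U1_in t Y : (aug (pt t) <= aff Y)%MS -> rk (t |: Y) = rk Y.
Proof.
move=> h; apply/eqP; rewrite eqn_leq andbC rk_mono ?subsetUr //=.
by apply: rk_aff_le => u /setU1P[->//|/mem_aff].
Qed.

Lemma rk1 t : rk [set t] = 1%N.
Proof.
rewrite -(setU0 [set t]) rk_U1_notin ?rk0 //.
rewrite /aff big_set0 submx0; apply/eqP => /matrixP/(_ ord0 (lshift d ord0)).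
by rewrite row_mxEl !mxE => /eqP; rewrite oner_eq0.
Qed.

Lemma functional_aff Y (c : 'cV[R]_(1 + d)) :
  (forall y, y \in Y -> aug (pt y) *m c = 0) ->
  forall u : 'rV[R]_(1 + d), (u <= aff Y)%MS -> u *m c = 0.
Proof.
move=> h u hu; apply/sub_kermxP; apply: (submx_trans hu).
by apply: aff_sub => y /h /sub_kermxP.
Qed.

Definition fn (s : R) (v : 'rV[R]_d) : 'cV[R]_(1 + d) := col_mx s%:M v^T.

Lemma mul_fn u0 x s v : row_mx u0%:M x *m fn s v = (u0 * s + dot x v)%:M :> 'M_1.
Proof.
rewrite mul_row_col -scalar_mxM; apply/matrixP => i j.
rewrite !ord1 !mxE eqxx !mulr1n; congr (_ + _).
by apply: eq_bigr => c _; rewrite !mxE.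
Qed.

Lemma aug_fn x s v : aug x *m fn s v = (s + dot x v)%:M.
Proof. by rewrite -[s in RHS]mul1r -mul_fn /aug. Qed.

Lemma scalar_mx1_eq0 (a : R) : (a%:M : 'M_1) = 0 -> a = 0.
Proof. by move=> /matrixP/(_ 0 0); rewrite !mxE eqxx mulr1n. Qed.

Lemma aff_affine Y p s v : (forall y, y \in Y -> s + dot (pt y) v = 0) ->
  (aug p <= aff Y)%MS -> s + dot p v = 0.
Proof.
move=> h hp; have := @functional_aff Y (fn s v) _ _ hp.
rewrite aug_fn => h2; apply/scalar_mx1_eq0/h2 => // y /h e.
by rewrite aug_fn e raddf0.
Qed.

(** The quadratic terms cancel, so the difference of squared distances to two fixed points is
    affine. This is what lets spanning points decide membership in a link. *)
Lemma aff_sqdist_diff Y p a b c :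
  (forall y, y \in Y -> sqdist (pt y) a - sqdist (pt y) b = c) ->
  (aug p <= aff Y)%MS -> sqdist p a - sqdist p b = c.
Proof.
have e z : sqdist z a - sqdist z b = dot a a - dot b b + dot z (- 2 *: (a - b)).
  by rewrite !sqdistE !dotE (dotC a z) (dotC b z); ring.
move=> h hp; apply/eqP; rewrite -subr_eq0 e addrAC; apply/eqP.
by apply: aff_affine hp => y /h; rewrite e => <-; ring.
Qed.

(* A vector of [aff Y :&: aff Z] with vanishing first coordinate is a direction
   of both hulls, hence orthogonal to itself. *)
Lemma rk_orthogonal Y Z y0 z0 : y0 \in Y -> z0 \in Z ->
  (forall y y' z, y \in Y -> y' \in Y -> z \in Z -> dd y z = dd y' z) ->
  (rk Y + rk Z <= (rk (Y :|: Z)).+1)%N.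
Proof.
move=> hy0 hz0 H.
have orth y z : y \in Y -> z \in Z -> dot (pt y - pt y0) (pt z - pt z0) = 0.
  move=> hy hz; have := H _ _ _ hy hy0 hz; have := H _ _ _ hy hy0 hz0.
  rewrite /dd !sqdistE !dotE (dotC (pt z)) (dotC (pt z0)) .
  rewrite (dotC (pt z) (pt y0)) (dotC (pt z0) (pt y0)); lra.
rewrite /rk -mxrank_sum_cap.
have h1 : (\rank (aff Y + aff Z)%MS <= \rank (aff (Y :|: Z)))%N.
  apply: mxrankS; rewrite addsmx_sub !aff_mono ?subsetUl ?subsetUr //.
suff h2 : (\rank (aff Y :&: aff Z)%MS <= 1)%N.
  by have := leq_add h1 h2; rewrite (addn1 (\rank _)).
set K := (aff Y :&: aff Z)%MS.
have := mxrank_mul_ker K (fn 1 0).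
suff -> : (K :&: kermx (fn 1 0))%MS = 0.
  by rewrite mxrank0 addn0 => <-; apply: rank_leq_col.
apply/eqP/rowV0P => u; rewrite !sub_capmx -(hsubmxK u).
set u0 := lsubmx u; set v := rsubmx u; rewrite (mx11_scalar u0).
move=> /andP[/andP[uY uZ] /sub_kermxP]; rewrite mul_fn mulr1 => /scalar_mx1_eq0.
rewrite -[X in _ + X]/(dot v 0) dotC dot0l addr0 => u00.
rewrite u00 in uY uZ *.
have vz z : z \in Z -> dot v (pt z - pt z0) = 0.
  move=> hz.
  have := @functional_aff Y (fn (- dot (pt y0) (pt z - pt z0)) (pt z - pt z0)) _ _ uY.
  rewrite mul_fn mul0r add0r => h; apply: scalar_mx1_eq0; apply: h => y hy.
  by rewrite aug_fn addrC -dotNl -dotDl orth // raddf0.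
have : dot v v = 0.
  have := @functional_aff Z (fn (- dot (pt z0) v) v) _ _ uZ.
  rewrite mul_fn mul0r add0r => h; apply: scalar_mx1_eq0; apply: h => z hz.
  by rewrite aug_fn addrC -dotNl -dotDl dotC vz // raddf0.
move=> /dotxx_eq0 ->; apply/rowP => i; rewrite !mxE.
by case: split => j; rewrite !mxE ?mul0rn.
Qed.

Lemma rk2 y y' : pt y != pt y' -> rk [set y; y'] = 2%N.
Proof.
move=> ne; rewrite rk_U1_notin ?rk1 //; apply: contraNN ne => h.
apply/eqP/sqdist_eq0; rewrite sqdistE.
set v := pt y - pt y'; rewrite /v dotDl dotNl addrC -/v.
by apply: (@aff_affine [set y']) h => u /set1P ->; rewrite addNr.
Qed.

Lemma sphere_line Y x c : {in Y &, injective pt} ->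
  (forall y, y \in Y -> sqdist (pt y) x = c) -> (rk Y <= 2)%N -> (#|Y| <= 2)%N.
Proof.
move=> inj hc r2; case: leqP => // /card_gt2P[y1 [y2 [y3 [[h1 h2 h3] [n12 n23 n31]]]]].
have r12 : rk [set y1; y2] = 2%N.
  by apply: rk2; apply: contraNN n12 => /eqP/inj ->.
have s12 : [set y1; y2] \subset Y by apply/subsetP => y /set2P[]->.
have := aff_full s12 _ h3; rewrite r12 => /(_ r2).
rewrite aff_U1 /aff big_set1 => /sub_addsmxP[[A B]] /=.
have : (B *m <<aug (pt y2)>>%MS <= aug (pt y2))%MS.
  by apply: (submx_trans (submxMl _ _)); rewrite genmxE.
move=> /submxP[B' ->]; rewrite (mx11_scalar A) (mx11_scalar B') !mul_scalar_mx.
rewrite !scale_row_mx add_row_mx => /eq_row_mx[/matrixP/(_ 0 0)].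
rewrite !mxE !mulr1 => es e3.
have {}es : B' 0 0 = 1 - A 0 0 by rewrite -[1]/(true%:R) es; ring.
have := hc _ h3; rewrite e3 es => /(sqdist_mid (hc _ h1) (hc _ h2))/eqP.
rewrite !mulf_eq0 => /orP[/orP[]|] /eqP e.
- rewrite e subr0 in es; rewrite es e scale0r add0r scale1r in e3.
  by move: n23; rewrite (inj _ _ h3 h2 e3) eqxx.
- rewrite e in es; have e1 : A 0 0 = 1 by lra.
  rewrite es e1 scale0r addr0 scale1r in e3.
  by move: n31; rewrite (inj _ _ h3 h1 e3) eqxx.
- by move: n12; rewrite (inj _ _ h1 h2 (sqdist_eq0 e)) eqxx.
Qed.

End Rank.

(** * Nondegenerate distance patterns *)

Section Nondeg.
Context {R : realType} {d : nat} {T I : finType} (pt : T -> 'rV[R]_d).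

(** Anisotropy of the Cayley-Menger form on zero-sum vectors supported on J. By [sum_sqdist] points
    realizing D are then affinely independent; the condition concerns D alone and so is shared by
    all tuples of a family. *)
Definition nondeg (J : {set I}) (D : I -> I -> R) :=
  forall a : I -> R, (forall j, j \notin J -> a j = 0) -> \sum_j a j = 0 ->
    \sum_j \sum_l a j * a l * D j l = 0 -> forall j, a j = 0.

Lemma nondeg_sub (J J' : {set I}) D : J' \subset J -> nondeg J D -> nondeg J' D.
Proof.
move=> /subsetP s h a a0; apply: h => j hj; apply: a0; apply: contraNN hj; exact: s.
Qed.

Lemma nondeg_rk (J : {set I}) D (x : I -> T) : nondeg J D ->
  (forall j l, j \in J -> l \in J -> dd pt (x j) (x l) = D j l) ->
  (#|J| <= rk pt (x @: J))%N.
Proof.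
move=> nd hD.
pose M := \matrix_(i < #|J|) aug (pt (x (enum_val i))).
have hM : (M <= aff pt (x @: J))%MS.
  by apply/row_subP => i; rewrite rowK mem_aff // imset_f // enum_valP.
suff rM : row_free M by rewrite -(eqP rM); apply: mxrankS.
rewrite -kermx_eq0; apply/eqP/row_matrixP => r; rewrite row0.
have : row r (kermx M) *m M = 0 by rewrite -row_mul mulmx_ker row0.
move: (row r (kermx M)) => u; rewrite mulmx_sum_row.
under eq_bigr do rewrite rowK scale_row_mx.
move=> hu.
pose a j := \sum_(i | enum_val i == j) u 0 i.
have asum (V : lmodType R) (F : I -> V) :
    \sum_j a j *: F j = \sum_i u 0 i *: F (enum_val i).
  rewrite (partition_big (fun i => enum_val i) predT) //=; apply: eq_bigr => j _.
  by rewrite scaler_suml; apply: eq_bigr => i /eqP ->.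
have aJ j : j \notin J -> a j = 0.
  move=> hj; rewrite /a big1 // => i /eqP e; by rewrite -e enum_valP in hj.
have a0 : \sum_j a j = 0.
  have := asum R^o (fun=> 1); under eq_bigr do rewrite /GRing.scale /= mulr1.
  move=> ->; under eq_bigr do rewrite /GRing.scale /= mulr1.
  have := congr1 (fun v : 'rV[R]_(1 + d) => v 0 (lshift d ord0)) hu; rewrite summxE mxE => e.
  by rewrite -[RHS]e; apply: eq_bigr => i _; rewrite row_mxEl !mxE mulr1.
have a1 : \sum_j a j *: pt (x j) = 0.
  rewrite asum; apply/rowP => c.
  have := congr1 (fun v : 'rV[R]_(1 + d) => v 0 (rshift 1 c)) hu; rewrite summxE !mxE => e.
  by rewrite summxE -[RHS]e; apply: eq_bigr => i _; rewrite row_mxEr.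
apply/rowP => i; rewrite mxE.
have /nd : forall j, j \notin J -> a j = 0 by [].
move=> /(_ a0) => h.
suff /h/(_ (enum_val i)) : \sum_j \sum_l a j * a l * D j l = 0.
  rewrite /a (big_pred1 i) // => i' /=; exact: (inj_eq enum_val_inj).
have := sum_sqdist (fun j => pt (x j)) a0; rewrite a1 dot0l mulr0 => e.
rewrite -[RHS]e; apply: eq_bigr => j _; apply: eq_bigr => l _.
have [jJ|/aJ ->] := boolP (j \in J); last by rewrite !mul0r.
have [lJ|/aJ ->] := boolP (l \in J); last by rewrite mulr0 !mul0r.
by rewrite -hD.
Qed.

(* Coordinates outside [J] are irrelevant, so they must be determined by those in [J]. *)
Definition family_on (J : {set I}) (P : I -> {set T}) (D : I -> I -> R)
    (X : {set {ffun I -> T}}) :=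
  [/\ forall x j, x \in X -> j \in J -> x j \in P j,
      forall x j l, x \in X -> j \in J -> l \in J -> dd pt (x j) (x l) = D j l
    & forall x y, x \in X -> y \in X -> {in J, x =1 y} -> x = y].

End Nondeg.

(** * The core of a set *)

Section Canon.
Context {R : realType} {d : nat} {T : finType} (pt : T -> 'rV[R]_d).
Implicit Types Y Z L G : {set T}.
Local Notation rk := (rk pt).

(* Passing to a subset of smaller rank pays only if it keeps more than half of the points;
   the ranks of the sets themselves break ties, so that [core] is stable under [core_between]. *)
Definition weight Y := (#|Y| * 2 ^ (d.+1 - rk Y))%N.

Definition score Y := (weight Y * #|{set T}| + enum_rank Y)%N.

(** [enum_rank] stays below the factor [#|{set T}|], so [score] orders lexicographically, by weight
    first. *)
Lemma score_weight Y Z : (score Y <= score Z -> weight Y <= weight Z)%N.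
Proof.
rewrite /score => h; rewrite -ltnS -(ltn_pmul2r (m := #|{set T}|)); last first.
  by apply/card_gt0P; exists Y.
rewrite mulSn addnC; apply: leq_ltn_trans (leq_addr _ _) (leq_ltn_trans h _).
by rewrite ltn_add2l ltn_ord.
Qed.

Lemma score_inj : injective score.
Proof.
move=> Y Z h; apply/enum_rank_inj/val_inj => /=.
have : weight Y = weight Z by apply/eqP; rewrite eqn_leq !score_weight ?h.
by move: h; rewrite /score => /[swap] -> /addnI.
Qed.

Definition core L := [arg max_(Y > L | Y \subset L) score Y]%N.

Lemma coreP L : (core L \subset L) /\
  forall Y, Y \subset L -> (score Y <= score (core L))%N.
Proof. by rewrite /core; case: arg_maxnP => // Y h1 h2; split=> // Z /h2. Qed.

Lemma core_card L : (#|L| <= #|core L| * 2 ^ d.+1)%N.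
Proof.
have [_ /(_ L (subxx L)) /score_weight] := coreP L; rewrite /weight => h.
apply: leq_trans (leq_pmulr #|L| (expn_gt0 2 (d.+1 - rk L))) (leq_trans h _).
by rewrite leq_mul2l leq_pexp2l ?orbT // leq_subr.
Qed.

(** Losing rank multiplies the second factor of [weight] by at least 2, so a subset that keeps more
    than half of the points would beat the core. *)
Lemma core_half L Z : Z \subset core L -> (rk Z < rk (core L))%N ->
  (2 * #|Z| <= #|core L|)%N.
Proof.
have [s1 h] := coreP L => s2 r; have := h Z (subset_trans s2 s1).
move=> /score_weight; rewrite /weight.
have rm := rk_max pt (core L).
have -> : (d.+1 - rk Z = (rk (core L) - rk Z).-1 + (d.+1 - rk (core L)).+1)%N by lia.
rewrite expnD expnSr mulnA [(2 ^ (d.+1 - _) * 2)%N]mulnC mulnA leq_pmul2r ?expn_gt0 //.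
apply: leq_trans; rewrite -mulnA mulnC leq_mul2l leq_pmull ?expn_gt0 //.
by rewrite orbT.
Qed.

(** Adding a point of the hull keeps the rank and raises the cardinality, so the maximizer already
    contains it. *)
Lemma core_closed L p : p \in L -> (aug (pt p) <= aff pt (core L))%MS ->
  p \in core L.
Proof.
move=> pL hp; have [s h] := coreP L; apply: contraT => n.
have /h/score_weight : p |: core L \subset L by rewrite subUset sub1set pL.
rewrite /weight rk_U1_in // cardsU1 n leq_pmul2r ?expn_gt0 //.
by rewrite ltnn.
Qed.

(** A maximizer over the subsets of L that lies in G is one over the subsets of G. Thus a core can
    be recovered from any set squeezed between it and the link. *)
Lemma core_between L G : core L \subset G -> G \subset L -> core G = core L.
Proof.
move=> s1 s2; apply: score_inj; apply/eqP.
have [h1 h2] := coreP L; have [h3 h4] := coreP G.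
by rewrite eqn_leq h4 // h2 // (subset_trans h3).
Qed.

End Canon.

(** * Spanning sequences *)

Section Prods.
Context {T : finType}.
Implicit Types (W : {set T}) (Ws : seq {set T}).

Fixpoint prods Ws : seq (seq T) :=
  if Ws is W :: Ws' then [seq y :: z | y <- enum W, z <- prods Ws'] else [:: [::]].

Lemma size_prods Ws : size (prods Ws) = (\prod_(W <- Ws) #|W|)%N.
Proof.
elim: Ws => [|W Ws IH] /=; first by rewrite big_nil.
by rewrite size_allpairs -cardE IH big_cons.
Qed.

Lemma prods_uniq Ws : uniq (prods Ws).
Proof.
elim: Ws => [|W Ws IH] //=; apply: allpairs_uniq => //; first exact: enum_uniq.
by move=> [y z] [y' z'] _ _ /= [-> ->].
Qed.

Lemma mem_prods Ws z :
  (z \in prods Ws) = all2 (fun (y : T) (W : {set T}) => y \in W) z Ws.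
Proof.
elim: Ws z => [|W Ws IH] [|y z] //=.
  by apply/negbTE/allpairsP => -[[y z] [_ _]].
rewrite -IH; apply/allpairsP/andP => [[[y' z'] [/= h1 h2 [-> ->]]]|[h1 h2]].
  by rewrite mem_enum in h1.
by exists (y, z); rewrite mem_enum.
Qed.

Lemma prods_sub Ws W z : (forall W', W' \in Ws -> W' \subset W) -> z \in prods Ws ->
  {subset z <= W}.
Proof.
rewrite mem_prods; elim: Ws z => [|W1 Ws IH] [|y z] //= h /andP[h1 /IH {}IH] t.
rewrite inE => /orP[/eqP->|]; first by move/subsetP: (h W1 (mem_head _ _)); apply.
by apply: IH => W' h'; apply: h; rewrite inE h' orbT.
Qed.

Lemma prods_mono (I : Type) (s : seq I) (F G : I -> {set T}) z :
  all (fun l => F l \subset G l) s -> z \in prods (map F s) -> z \in prods (map G s).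
Proof.
rewrite !mem_prods; elim: s z => [|l s IH] [|y z] //= /andP[/subsetP h1 h2].
by move=> /andP[/h1-> /IH->].
Qed.

Lemma size_mem_prods Ws z : z \in prods Ws -> size z = size Ws.
Proof. by rewrite mem_prods all2E => /andP[/eqP]. Qed.

Lemma drop_prods Ws Ws' z : z \in prods (Ws ++ Ws') -> drop (size Ws) z \in prods Ws'.
Proof.
rewrite !mem_prods; elim: Ws z => [|W Ws IH] z /=; first by rewrite drop0.
by case: z => [|y z] //= /andP[_ /IH].
Qed.

Lemma count_prods_cons (a : pred (seq T)) W Ws :
  count a (prods (W :: Ws)) =
  (\sum_(z <- prods Ws) #|[set y in W | a (y :: z)]|)%N.
Proof.
rewrite -sum1_count big_mkcond big_allpairs_dep /= exchange_big /=.
apply: eq_bigr => z _; rewrite -big_mkcond /= big_enum_cond -sum1_card /=.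
by apply: eq_bigl => y; rewrite inE.
Qed.

(* The good sequences of distinct types are distinct elements of [prods]. *)
Lemma count_types (YT : finType) (I : eqType) (YY : {set YT}) (s : seq I)
    (P : I -> {set T}) (Q : YT -> I -> {set T}) (good : YT -> pred (seq T)) (K : nat) :
  (forall Y l, Y \in YY -> l \in s -> Q Y l \subset P l) ->
  (forall Y Y' z, Y \in YY -> Y' \in YY ->
     z \in prods (map (Q Y) s) -> z \in prods (map (Q Y') s) ->
     good Y z -> good Y' z -> Y = Y') ->
  (forall Y, Y \in YY -> (\prod_(l <- s) #|Q Y l| <=
     K * count (good Y) (prods (map (Q Y) s)))%N) ->
  (\sum_(Y in YY) \prod_(l <- s) #|Q Y l| <= K * \prod_(l <- s) #|P l|)%N.
Proof.
move=> sub dis cnt.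
apply: (@leq_trans (\sum_(Y in YY) K * count (good Y) (prods (map (Q Y) s)))%N).
  exact: leq_sum.
rewrite -big_distrr leq_mul2l; apply/orP; right.
pose fl := flatten [seq filter (good Y) (prods (map (Q Y) s)) | Y <- enum YY].
have -> : (\sum_(Y in YY) count (good Y) (prods (map (Q Y) s)) = size fl)%N.
  rewrite size_flatten /shape -map_comp sumnE big_map -big_enum /=.
  by apply: eq_bigr => Y _; rewrite /= size_filter.
have -> : (\prod_(l <- s) #|P l| = size (prods (map P s)))%N.
  by rewrite size_prods big_map.
have mfl Y z : Y \in YY -> z \in filter (good Y) (prods (map (Q Y) s)) ->
    z \in prods (map P s).
  move=> hY; rewrite mem_filter => /andP[_]; apply: prods_mono.
  by apply/allP => l hl; apply: sub.
apply: uniq_leq_size; last first.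
  by move=> z /flatten_mapP[Y]; rewrite mem_enum => /mfl h /h.
rewrite {}/fl.
have : uniq (enum YY) by apply: enum_uniq.
have : {subset enum YY <= YY} by move=> Y; rewrite mem_enum.
elim: (enum YY) => [|Y e IH] //= hs /andP[nY ue]; rewrite cat_uniq.
rewrite filter_uniq ?prods_uniq //= IH //; last first.
  by move=> Y' hY'; apply: hs; rewrite inE hY' orbT.
rewrite andbT; apply/hasPn => z /flatten_mapP[Y' hY'].
rewrite mem_filter => /andP[g' m']; apply/negP; rewrite /= mem_filter => /andP[g m].
have e1 : Y = Y'.
  by apply: dis m m' g g'; apply: hs; rewrite ?mem_head // inE hY' orbT.
by rewrite e1 hY' in nY.
Qed.

End Prods.

Section Independent.
Context {R : realType} {d : nat} {T I : finType} (pt : T -> 'rV[R]_d).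
Local Notation rk := (rk pt).
Local Notation aff := (aff pt).

Definition indep (z : seq T) := rk [set t in z] == size z.

Lemma set_of_cons (y : T) z : [set t in y :: z] = y |: [set t in z].
Proof. by apply/setP => t; rewrite !inE. Qed.

Lemma indep_cons y z : indep z -> indep (y :: z) = ~~ (aug (pt y) <= aff [set t in z])%MS.
Proof.
rewrite /indep set_of_cons => /eqP h.
have [s|s] := boolP (aug (pt y) <= _)%MS; last by rewrite rk_U1_notin // h eqxx.
by rewrite rk_U1_in // h /= (ltn_eqF (ltnSn _)).
Qed.

(** Half of W lies outside the hull of any independent z and extends it, so each further factor
    costs only 2. *)
Lemma count_indep_cons (W : {set T}) (Ws : seq {set T}) (K : nat) :
  (forall z, z \in prods Ws -> indep z ->
    2 * #|[set y in W | (aug (pt y) <= aff [set t in z])%MS]| <= #|W|)%N ->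
  (\prod_(W <- Ws) #|W| <= K * count indep (prods Ws))%N ->
  (\prod_(W <- W :: Ws) #|W| <= 2 * K * count indep (prods (W :: Ws)))%N.
Proof.
move=> half h; rewrite big_cons.
suff h2 : (#|W| * count indep (prods Ws) <= 2 * count indep (prods (W :: Ws)))%N.
  apply: leq_trans (leq_mul (leqnn #|W|) h) _.
  by rewrite mulnCA [(2 * K)%N]mulnC -mulnA leq_mul2l h2 orbT.
rewrite count_prods_cons -sum1_count !big_distrr /= big_mkcond /= big_seq [leqRHS]big_seq.
apply: leq_sum => z hz; rewrite muln1; case: ifPn => // iz.
have := half z hz iz.
set A := [set y in W | _]; set B := [set y in W | _].
suff -> : #|W| = (#|A| + #|B|)%N by lia.
rewrite -(cardsID [set y | (aug (pt y) <= aff [set t in z])%MS] W); congr (_ + _)%N.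
  by apply: eq_card => y; rewrite !inE.
apply: eq_card => y; rewrite !inE indep_cons // andbC; congr (_ && _).
Qed.

Lemma rk_size z : (rk [set t in z] <= size z)%N.
Proof.
elim: z => [|y z IH] /=; first by rewrite set_nil rk0.
by rewrite set_of_cons; apply: leq_trans (rk_U1 pt y _) _.
Qed.

Lemma indep_catr z1 z2 : indep (z1 ++ z2) -> indep z2.
Proof.
elim: z1 => [|y z1 IH] //= h; apply: IH; move: h; rewrite /indep set_of_cons /=.
have := rk_U1 pt y [set t in z1 ++ z2]; have := rk_size (z1 ++ z2).
move=> h1 h2 /eqP h3; apply/eqP; move: h1 h2 h3.
set a := rk _; set b := rk _; set c := size _. lia.
Qed.

Lemma indep_spans z (W : {set T}) : {subset z <= W} -> indep z -> size z = rk W ->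
  forall t, t \in W -> (aug (pt t) <= aff [set t in z])%MS.
Proof.
move=> s /eqP iz hz t; apply: aff_full; last by rewrite iz hz.
by apply/subsetP => u; rewrite inE => /s.
Qed.

Context (Q : I -> {set T}).

Definition hull (B : seq I) := \bigcup_(l in B) Q l.

Lemma hull_sub B B' : {subset B <= B'} -> hull B \subset hull B'.
Proof. by move=> h; apply/bigcupsP => l /h hl; apply: bigcup_sup. Qed.

(* [labels o] lists which set supplies each vector of a basis of the hull that is
   built greedily along [o], last set first. *)
Fixpoint labels (o : seq I) : seq I :=
  if o is l :: o' then nseq (rk (hull o) - rk (hull o')) l ++ labels o' else [::].

Lemma size_labels o : size (labels o) = rk (hull o).
Proof.
elim: o => [|l o IH] /=; first by rewrite /hull big_pred0 ?rk0.
rewrite size_cat size_nseq IH subnK //.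
by apply/rk_mono/hull_sub => j hj; rewrite inE hj orbT.
Qed.

Lemma labels_sub o : {subset labels o <= o}.
Proof.
elim: o => [|l o IH] //= j; rewrite mem_cat => /orP[|/IH]; last first.
  by rewrite inE orbC => ->.
by rewrite mem_nseq => /andP[_ /eqP->]; rewrite mem_head.
Qed.

(** z is a partial basis: it spans the hull of the later sets o' and may contain points of the
    current set. As long as it does not span the hull of [l :: o'], half of [Q l] has to avoid its
    hull. *)
Definition halving o :=
  forall (l : I) (o' : seq I) (z : seq T), suffix (l :: o') o ->
    {subset z <= hull (l :: o')} ->
    (forall t, t \in hull o' -> (aug (pt t) <= aff [set t in z])%MS) ->
    (rk [set t in z] < rk (hull (l :: o')))%N ->
    (2 * #|[set y in Q l | (aug (pt y) <= aff [set t in z])%MS]| <= #|Q l|)%N.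

Lemma count_labels o : halving o ->
  (\prod_(l <- labels o) #|Q l| <=
     2 ^ rk (hull o) * count indep (prods (map Q (labels o))))%N.
Proof.
elim: o => [|l o IH] hv /=.
  by rewrite big_nil /hull big_pred0 // rk0 expn0 /= /indep /= set_nil rk0.
have {}IH : (\prod_(l <- labels o) #|Q l| <=
     2 ^ rk (hull o) * count indep (prods (map Q (labels o))))%N.
  apply: IH => l' o' z h; apply: hv.
  by apply: suffix_trans h _; apply: (suffix_suffix [:: l]).
have le : (rk (hull o) <= rk (hull (l :: o)))%N.
  by apply/rk_mono/hull_sub => j hj; rewrite inE hj orbT.
(* t counts the vectors already drawn from [Q l]. *)
suff H t : (t <= rk (hull (l :: o)) - rk (hull o))%N ->
    (\prod_(W <- map Q (nseq t l ++ labels o)) #|W| <=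
     2 ^ (t + rk (hull o)) * count indep (prods (map Q (nseq t l ++ labels o))))%N.
  by have := H _ (leqnn _); rewrite subnK // big_map.
elim: t => [|t IHt] ht; first by rewrite big_map.
rewrite addSn expnS map_cat map_nseq /= -map_nseq -map_cat.
apply: count_indep_cons (IHt (ltnW ht)) => z hz iz.
apply: (hv l o z) => //.
- exact: suffix_refl.
- apply: prods_sub hz => W /mapP[j]; rewrite mem_cat => /orP[hj|/labels_sub hj] ->.
    by move: hj; rewrite mem_nseq => /andP[_ /eqP->]; apply: (bigcup_sup l); rewrite mem_head.
  by apply: (bigcup_sup j); rewrite inE hj orbT.
(* The tail of z is independent of length [rk (hull o)], hence spans that hull. *)
- rewrite map_cat in hz; move/drop_prods: hz; rewrite size_map size_nseq => hz.
  move=> u hu; apply: (@submx_trans _ _ _ _ _ _ (aff [set t' in drop t z])).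
    apply: (@indep_spans _ (hull o)) => //.
    - apply: prods_sub hz => W /mapP[j /labels_sub hj] ->.
      exact: (bigcup_sup j).
    - by apply: (@indep_catr (take t z)); rewrite cat_take_drop.
    - by rewrite (size_mem_prods hz) size_map size_labels.
  by apply: aff_mono; apply/subsetP => t'; rewrite !inE; apply: mem_drop.
- rewrite (eqP iz) (size_mem_prods hz) size_map size_cat size_nseq size_labels.
  by rewrite ltn_subRL addnC in ht.
Qed.

End Independent.

(** * Regular families *)

(** The mean value estimate for t^(q+1); it measures what the deletion of b tuples costs in
    [regular]. *)
Lemma nat_bernoulli (a b q : nat) : ((a + b) ^ q.+1 <= a ^ q.+1 + q.+1 * b * (a + b) ^ q)%N.
Proof.
elim: q => [|q IH]; first by rewrite !expn1 mul1n muln1.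
rewrite [leqLHS]expnS mulnDl.
have h1 : (a * (a + b) ^ q.+1 <= a * a ^ q.+1 + q.+1 * b * (a + b) ^ q.+1)%N.
  apply: leq_trans (leq_mul (leqnn a) IH) _; rewrite mulnDr leq_add2l.
  rewrite mulnCA leq_mul2l; apply/orP; right.
  by rewrite [leqRHS]expnS leq_mul2r leq_addr orbT.
rewrite [(a ^ q.+2)%N]expnS [(q.+2 * b)%N]mulSn; nia.
Qed.

Section Regular.
Context {R : realType} {d : nat} {T I : finType} (pt : T -> 'rV[R]_d).
Local Notation rk := (rk pt).
Local Notation aff := (aff pt).
Context (A : {set I}) (q : nat).
Implicit Types X Y : {set {ffun I -> T}}.

Definition proj X (j : I) : {set T} := [set x j | x : {ffun I -> T} in X].

Definition slots X := (\prod_(j in A) #|proj X j|)%N.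

(** All unions of projections are summed, so that a rank drop of any one of them lowers [rkpot]. The
    bound [potmax] only turns the negative exponent of [kap] into a natural number. *)
Definition rkpot X := (\sum_(B : {set I} | B \subset A) rk (\bigcup_(j in B) proj X j))%N.

Definition potmax := (#|{set I}| * d.+1)%N.

Definition kap := ((2 * q.+1) ^ q.+1)%N.

(* A maximizer of |X|^(q+1) kap^(-rkpot X) / slots X: dividing by the projections forces large
   degrees, and [kap] makes any rank drop of the projections unprofitable. *)
Definition regular X := forall Y, Y \subset X ->
  (#|Y| ^ q.+1 * kap ^ (potmax - rkpot Y) * slots X
    <= #|X| ^ q.+1 * kap ^ (potmax - rkpot X) * slots Y)%N.

Lemma kap_gt0 : (0 < kap)%N. Proof. by rewrite expn_gt0. Qed.

Lemma proj_mono Y X j : Y \subset X -> proj Y j \subset proj X j.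
Proof. exact: imsetS. Qed.

Lemma slots_gt0 X : X != set0 -> (0 < slots X)%N.
Proof.
move=> /set0Pn[x hx]; rewrite prodn_gt0 // => j.
by apply/card_gt0P; exists (x j); apply: imset_f.
Qed.

Lemma rkpot_max X : (rkpot X <= potmax)%N.
Proof.
rewrite /rkpot /potmax -sum_nat_const [leqLHS]big_mkcond /=.
by apply: leq_sum => B _; case: ifP => // _; apply: rk_max.
Qed.

Lemma rkpot_mono Y X : Y \subset X -> (rkpot Y <= rkpot X)%N.
Proof.
move=> h; apply: leq_sum => B _; apply: rk_mono; apply/bigcupsP => j jB.
exact/(bigcup_max j)/proj_mono.
Qed.

Lemma slots_mono Y X : Y \subset X -> (slots Y <= slots X)%N.
Proof. by move=> h; apply: leq_prod => j _; apply/subset_leq_card/proj_mono. Qed.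

(** The maximizer is compared with X itself. After a (q+1)-th root the loss is a constant times a
    small power of [slots X]. *)
Lemma regular_exists X : X != set0 ->
  exists X', [/\ X' \subset X, X' != set0, regular X' &
    (#|X| ^ q.+1 <= #|X'| ^ q.+1 * (kap ^ potmax * slots X))%N].
Proof.
move=> X0.
pose sc Y : R := (#|Y| ^ q.+1 * kap ^ (potmax - rkpot Y))%:R / (slots Y)%:R.
pose X' := [arg max_(Y > X | (Y \subset X) && (Y != set0)) sc Y]%O.
have [sX' X'0 hX'] : [/\ X' \subset X, X' != set0 &
    forall Y, Y \subset X -> Y != set0 -> sc Y <= sc X'].
  rewrite /X'; case: Order.TotalTheory.arg_maxP; first by rewrite subxx.
  by move=> Y /andP[h1 h2] h3; split=> // Z h4 h5; apply: h3; rewrite h4.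
have cmp Y : Y \subset X ->
    (#|Y| ^ q.+1 * kap ^ (potmax - rkpot Y) * slots X'
    <= #|X'| ^ q.+1 * kap ^ (potmax - rkpot X') * slots Y)%N.
  have [-> _|Y0 sY] := eqVneq Y set0; first by rewrite cards0 exp0n.
  have := hX' Y sY Y0; rewrite /sc.
  rewrite ler_pdivrMr ?ltr0n ?slots_gt0 // mulrAC.
  by rewrite ler_pdivlMr ?ltr0n ?slots_gt0 // -!natrM ler_nat.
exists X'; split=> //; first by move=> Y hY; apply/cmp/(subset_trans hY).
have := cmp X (subxx _).
have h1 : (1 <= kap ^ (potmax - rkpot X))%N by rewrite expn_gt0 kap_gt0.
have h2 := slots_gt0 X'0.
have h3 : (kap ^ (potmax - rkpot X') <= kap ^ potmax)%N.
  by rewrite leq_pexp2l ?kap_gt0 // leq_subr.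
move=> h; rewrite mulnA.
have : (#|X| ^ q.+1 <= #|X| ^ q.+1 * kap ^ (potmax - rkpot X) * slots X')%N.
  by rewrite -mulnA leq_pmulr // muln_gt0 h2 h1.
move=> /leq_trans /(_ h) /leq_trans; apply.
by rewrite leq_mul2r leq_mul2l h3 !orbT.
Qed.

Context (X : {set {ffun I -> T}}) (X0 : X != set0) (rX : regular X).

(** Deleting all tuples through z removes a point from the projection, so [slots] shrinks by a
    factor of at most 1 - 1/#|proj X j|; regularity demands that the tuples lost outweigh this. *)
Lemma regular_degree j z : j \in A -> z \in proj X j ->
  (#|X| <= q.+1 * #|proj X j| * #|[set x in X | x j == z]|)%N.
Proof.
move=> jA zj; set D := [set x in X | _].
pose Y := X :\: D.
have DX : D \subset X by apply/subsetP => x; rewrite inE => /andP[].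
have cY : (#|X| = #|Y| + #|D|)%N by rewrite -(cardsID D X) (setIidPr DX) addnC.
have YX : Y \subset X by apply: subsetDl.
have sYj : (#|proj Y j| < #|proj X j|)%N.
  apply: proper_card; apply/properP; split; first exact: proj_mono.
  exists z => //; apply/negP => /imsetP[x].
  by rewrite !inE => /andP[h1 h2] e; rewrite h2 e eqxx in h1.
have := rX YX.
rewrite /slots (bigD1 j) //= [X in (_ <= _ * X)%N](bigD1 j) //=.
set s1 := #|proj X j|; set s2 := #|proj Y j|.
set p1 := (\prod_(_ in _ | _) _)%N; set p2 := (\prod_(_ in _ | _) _)%N.
have p21 : (p2 <= p1)%N.
  by apply: leq_prod => l _; apply/subset_leq_card/proj_mono.
have p10 : (0 < p1)%N.
  move/set0Pn: X0 => [x hx]; rewrite prodn_gt0 // => l.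
  by apply/card_gt0P; exists (x l); apply: imset_f.
have hk : (kap ^ (potmax - rkpot X) <= kap ^ (potmax - rkpot Y))%N.
  by rewrite leq_pexp2l ?kap_gt0 // leq_sub2l // rkpot_mono.
have k0 : (0 < kap ^ (potmax - rkpot X))%N by rewrite expn_gt0 kap_gt0.
move: hk k0; set k1 := (kap ^ (_ - rkpot X))%N; set k2 := (kap ^ _)%N => hk k0 h.
have {h} h : (#|Y| ^ q.+1 * s1 <= #|X| ^ q.+1 * s2)%N.
  rewrite -(leq_pmul2r p10) -(leq_pmul2r k0).
  apply: (@leq_trans (#|Y| ^ q.+1 * k2 * (s1 * p1))%N).
    rewrite [leqLHS](_ : _ = #|Y| ^ q.+1 * k1 * (s1 * p1))%N; last by ring.
    by rewrite leq_mul2r leq_mul2l hk !orbT.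
  apply: leq_trans h _.
  rewrite [leqRHS](_ : _ = #|X| ^ q.+1 * k1 * (s2 * p1))%N; last by ring.
  by rewrite !leq_mul2l p21 !orbT.
have := nat_bernoulli #|Y| #|D| q; rewrite -cY => hb.
have {h} h : (#|Y| ^ q.+1 * s1 <= #|X| ^ q.+1 * s1 - #|X| ^ q.+1)%N.
  apply: leq_trans h _; rewrite -[Z in (_ - Z)%N]muln1 -mulnBr leq_mul2l subn1 -ltnS.
  by rewrite prednK ?sYj ?orbT //; apply: leq_ltn_trans sYj.
have Xq : (0 < #|X| ^ q)%N by rewrite expn_gt0 card_gt0 X0.
have h2 : (#|X| ^ q.+1 <= q.+1 * #|D| * #|X| ^ q * s1)%N by nia.
rewrite -(leq_pmul2r Xq) -expnS; apply: leq_trans h2 _; apply: eq_leq; ring.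
Qed.

(** If more than half of the projection to l lay in the hull of z, the tuples through these points
    would be a 1/(2(q+1)) share of X by [regular_degree], while the hull of [l :: o'] drops in rank.
    The factor [kap] gained contradicts regularity. *)
Lemma regular_halving o : {subset o <= A} -> halving pt (proj X) o.
Proof.
move=> oA l o' z /suffixP[o1 eo] hz ho' hrk.
have oA' : {subset l :: o' <= A} by move=> j hj; apply: oA; rewrite eo mem_cat hj orbT.
have lA : l \in A by apply/oA'/mem_head.
set C := [set y in _ | _].
rewrite leqNgt; apply/negP => hC.
pose Y := [set x in X | x l \in C].
have YX : Y \subset X by apply/subsetP => x; rewrite inE => /andP[].
have s0 : (0 < #|proj X l|)%N.
  by move/set0Pn: X0 => [x hx]; apply/card_gt0P; exists (x l); apply: imset_f.
have cY : (#|C| * #|X| <= q.+1 * #|proj X l| * #|Y|)%N.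
  have -> : (#|Y| = \sum_(y in C) #|[set x in X | x l == y]|)%N.
    rewrite -sum1_card (partition_big (fun x : {ffun I -> T} => x l) (mem C)) /=; last first.
      by move=> x; rewrite !inE => /andP[].
    apply: eq_bigr => y yC; rewrite -sum1_card; apply: eq_bigl => x.
    rewrite !inE; case: eqP => [->|]; rewrite ?andbF //.
    by move: yC; rewrite !inE => ->; rewrite !andbT.
  rewrite big_distrr /= -sum_nat_const; apply: leq_sum => y yC.
  by apply: regular_degree => //; move: yC; rewrite inE => /andP[].
have {cY} cY : (#|X| < 2 * q.+1 * #|Y|)%N.
  rewrite -(ltn_pmul2l s0); have Xp : (0 < #|X|)%N by rewrite card_gt0.
  apply: (@leq_trans (2 * #|C| * #|X|)%N); first by rewrite ltn_pmul2r.
  rewrite -mulnA; apply: leq_trans (leq_mul (leqnn 2) cY) _; apply: eq_leq; ring.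
have hpot : (rkpot Y < rkpot X)%N.
  have bA : [set j in l :: o'] \subset A by apply/subsetP => j; rewrite inE => /oA'.
  rewrite /rkpot (bigD1 [set j in l :: o']) //= [X in (_ < X)%N](bigD1 [set j in l :: o']) //=.
  rewrite -addSn leq_add //; last first.
    apply: leq_sum => B _; apply: rk_mono; apply/bigcupsP => j jB.
    exact/(bigcup_max j)/proj_mono.
  have -> : \bigcup_(j in [set j in l :: o']) proj X j = hull (proj X) (l :: o').
    by apply: eq_bigl => j; rewrite inE.
  apply: leq_ltn_trans hrk; apply: rk_aff_le => t /bigcupP[j].
  rewrite in_set inE => /orP[/eqP->|jo].
    by move=> /imsetP[x]; rewrite !inE => /and3P[_ _ h] ->.
  by move/(subsetP (proj_mono j YX)) => h; apply: ho'; apply/bigcupP; exists j.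
have := rX YX; have hs := slots_mono YX.
have := slots_gt0 X0; have := rkpot_max X.
set s1 := slots X in hs *; set s2 := slots Y in hs * => hm s10 h.
have k1 : (kap * kap ^ (potmax - rkpot X) <= kap ^ (potmax - rkpot Y))%N.
  by rewrite -expnS leq_pexp2l ?kap_gt0 //; lia.
have k0 : (0 < kap ^ (potmax - rkpot X))%N by rewrite expn_gt0 kap_gt0.
have {h} h : (#|Y| ^ q.+1 * kap <= #|X| ^ q.+1)%N.
  rewrite -(leq_pmul2r k0) -(leq_pmul2r s10).
  apply: (@leq_trans (#|Y| ^ q.+1 * kap ^ (potmax - rkpot Y) * s1)%N).
    by rewrite leq_mul2r -mulnA leq_mul2l k1 !orbT.
  by apply: leq_trans h _; rewrite leq_mul2l hs orbT.
by move: h; rewrite mulnC /kap -expnMn leq_exp2r // leqNgt cY.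
Qed.

End Regular.

(** * Peeling a vertex *)

Section Lnc.
Context {R : realType}.

(** Since [ln] is 0 at 0, [lnc] is nonnegative even for the empty set; only the equality of
    [expR (lnc Y)] with the cardinality needs Y nonempty. *)
Definition lnc (T : finType) (Y : {set T}) : R := ln (#|Y|%:R).

Lemma ln_nat_ge0 n : 0 <= ln (n%:R : R).
Proof. by case: n => [|n]; [rewrite ln0 | rewrite ln_ge0 // ler1n]. Qed.

Lemma lnc_ge0 (T : finType) (Y : {set T}) : 0 <= lnc Y.
Proof. exact: ln_nat_ge0. Qed.

Lemma expR_ln_nat n : (0 < n)%N -> expR (ln n%:R) = n%:R :> R.
Proof. by move=> h; rewrite lnK // posrE ltr0n. Qed.

Lemma expR_lnc (T : finType) (Y : {set T}) : Y != set0 -> expR (lnc Y) = #|Y|%:R.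
Proof. by move=> h; rewrite expR_ln_nat // card_gt0. Qed.

Lemma nat_le_expR n : n%:R <= expR (ln n%:R) :> R.
Proof.
case: n => [|n]; last by rewrite expR_ln_nat.
by rewrite ln0 // expR0 ler01.
Qed.

Lemma ln_nat_mono m n : (m <= n)%N -> ln (m%:R : R) <= ln n%:R.
Proof.
case: m => [|m] h; first by rewrite ln0 // ln_nat_ge0.
by rewrite ler_ln ?posrE ?ltr0n ?ler_nat // (leq_trans _ h).
Qed.

Lemma lnc_mono (T : finType) (Y Z : {set T}) : Y \subset Z -> lnc Y <= lnc Z.
Proof. by move=> /subset_leq_card/ln_nat_mono. Qed.

Lemma ln_natM m n : (0 < m)%N -> (0 < n)%N -> ln ((m * n)%:R : R) = ln m%:R + ln n%:R.
Proof. by move=> h1 h2; rewrite natrM lnM // posrE ltr0n. Qed.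

Lemma ln_natX m n : (0 < m)%N -> ln ((m ^ n)%:R : R) = n%:R * ln m%:R.
Proof. by move=> h; rewrite natrX lnXn ?ltr0n // mulr_natl. Qed.

Lemma ln_nat_prod (I : finType) (A : {set I}) (F : I -> nat) :
  (forall j, j \in A -> 0 < F j)%N ->
  ln ((\prod_(j in A) F j)%:R : R) = \sum_(j in A) ln (F j)%:R.
Proof.
move=> h; apply: (@proj2 (0 < \prod_(j in A) F j)%N).
apply: (big_ind2 (fun (a : nat) (b : R) => (0 < a)%N /\ ln (a%:R : R) = b)).
- by rewrite ln1.
- move=> a b a' b' [h1 <-] [h2 <-]; by rewrite muln_gt0 h1 h2 ln_natM.
- by move=> j /h.
Qed.

End Lnc.

Section Peel.
Context {R : realType} {d : nat} {I : finType}.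

(** The first factor pays for passing to cores, the summand 2 for poor cores, the power of [kap] for
    regularization. In the sum over ranks p, 2^p comes from counting by points of Y, and 2^p for
    each of the |I|^p label words from counting by projections. *)
Definition peel_const (q : nat) : R :=
  (2 ^ d.+1)%:R * (2 + (kap q ^ @potmax d I)%:R *
    \sum_(p < d.+2) (2 ^ p + 2 ^ p * #|I| ^ p)%:R).

Context {T : finType} (pt : T -> 'rV[R]_d).
Local Notation rk := (rk pt).
Local Notation aff := (aff pt).
Local Notation dd := (dd pt).
Local Notation core := (core pt).
Context (A : {set I}) (i : I) (P : I -> {set T}) (D : I -> I -> R).
Implicit Types X Y : {set {ffun I -> T}}.

Definition link (x : {ffun I -> T}) : {set T} :=
  [set p in P i | [forall (j | j \in A), dd p (x j) == D i j]].

Lemma linkP (x : {ffun I -> T}) p :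
  reflect (p \in P i /\ forall j, j \in A -> dd p (x j) = D i j) (p \in link x).
Proof.
rewrite inE; apply: (iffP andP) => -[h1 h2]; split=> //.
  by move=> j jA; move/forall_inP: h2 => /(_ j jA)/eqP.
by apply/forall_inP => j /h2 ->.
Qed.

(** The squared distances to [x j] and [x' j] differ by an affine function vanishing on z, hence on
    its hull. So the points of one core lie in the other link, and [core_closed] puts them into the
    other core. *)
Lemma core_link_sub x x' (z : seq T) :
  {subset z <= core (link x')} -> {subset z <= core (link x)} ->
  (forall y, y \in core (link x) -> (aug (pt y) <= aff [set t in z])%MS) ->
  core (link x) \subset core (link x').
Proof.
move=> z1 z2 sp; apply/subsetP => y hy.
have [/subsetP s1 _] := coreP pt (link x); have [/subsetP s2 _] := coreP pt (link x').
have ay := sp _ hy; apply: core_closed; last first.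
  by apply: (submx_trans ay); apply: aff_mono; apply/subsetP => t; rewrite inE => /z1.
have /s1/linkP[yP yD] := hy; apply/linkP; split=> // j jA.
apply/eqP; rewrite -(yD j jA) -subr_eq0 /dd; apply/eqP.
apply: (@aff_sqdist_diff _ _ _ pt [set t in z]) => // t; rewrite inE => tz.
have /s1/linkP[_ e1] := z2 _ tz; have /s2/linkP[_ e2] := z1 _ tz.
have := e1 j jA; have := e2 j jA; rewrite /dd => -> ->; exact: subrr.
Qed.

Lemma core_link_spanned x x' (z : seq T) :
  {subset z <= core (link x)} -> {subset z <= core (link x')} ->
  indep pt z -> size z = rk (core (link x)) -> size z = rk (core (link x')) ->
  core (link x) = core (link x').
Proof.
move=> h1 h2 iz s1 s2; apply/eqP; rewrite eqEsubset.
apply/andP; split; apply: (@core_link_sub _ _ z) => //; exact: indep_spans.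
Qed.

Lemma mem_zip_labels (lab : seq I) (z : seq T) t : size lab = size z -> t \in z ->
  exists l, (l, t) \in zip lab z.
Proof.
elim: lab z => [|l lab IH] [|y z] //= [/IH {}IH]; rewrite inE => /orP[/eqP->|/IH[l' h]].
  by exists l; rewrite mem_head.
by exists l'; rewrite inE h orbT.
Qed.

Lemma zip_prods (Q : I -> {set T}) (lab : seq I) z l t :
  z \in prods (map Q lab) -> (l, t) \in zip lab z -> l \in lab /\ t \in Q l.
Proof.
rewrite mem_prods; elim: lab z => [|l' lab IH] [|y z] //= /andP[hy /IH {}IH].
rewrite !inE => /orP[/eqP[-> ->]|/IH[-> ->]]; rewrite ?eqxx ?orbT //; split=> //.
Qed.

(** The set of points at the prescribed distances from z depends on z and its labels only. It lies
    between Y and the link of a tuple of X, because z spans all vertices [x j]; so [core_between]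
    applies. *)
Lemma core_of_labels (X : {set {ffun I -> T}}) (Y : {set T}) (lab : seq I) (z : seq T) :
  X != set0 -> Y != set0 -> (forall x, x \in X -> core (link x) = Y) ->
  {subset lab <= A} -> z \in prods (map (proj X) lab) ->
  (forall j x, j \in A -> x \in X -> (aug (pt (x j)) <= aff [set t in z])%MS) ->
  core [set p in P i | all (fun lt => dd p lt.2 == D i lt.1) (zip lab z)] = Y.
Proof.
move=> /set0Pn[x0 hx0] /set0Pn[y0 hy0] hX labA hz sp.
have YD y x : y \in Y -> x \in X -> y \in link x.
  by move=> hy hx; apply: (subsetP (coreP pt (link x)).1); rewrite hX.
set G := [set p in P i | _].
have D1 y l t : y \in Y -> (l, t) \in zip lab z -> dd y t = D i l.
  move=> hy /(zip_prods hz)[hl /imsetP[x hx ->]].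
  by have /linkP[_ ->//] := YD y x hy hx; apply: labA.
rewrite -(hX x0 hx0); apply: core_between.
  rewrite hX //; apply/subsetP => y hy; rewrite inE; apply/andP; split.
    by have /linkP[] := YD y x0 hy hx0.
  by apply/allP => -[l t] /= /(D1 y l t hy) ->.
apply/subsetP => p; rewrite inE => /andP[hp /allP hall]; apply/linkP; split=> // j jA.
have /linkP[_ /(_ j jA) <-] := YD y0 x0 hy0 hx0.
apply/eqP; rewrite -subr_eq0 /dd !(sqdistC _ (pt (x0 j))); apply/eqP.
apply: (@aff_sqdist_diff _ _ _ pt [set t in z]); last exact: sp.
move=> t; rewrite inE => tz.
have sz : size lab = size z by rewrite (size_mem_prods hz) size_map.
have [l hl] := mem_zip_labels sz tz.
have /= /eqP := hall _ hl; have := D1 y0 l t hy0 hl.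
rewrite /dd !(sqdistC _ (pt t)) => -> ->; exact: subrr.
Qed.

Lemma core_half_count (L : {set T}) (p : nat) : rk (core L) = p ->
  (#|core L| ^ p <= 2 ^ p * count (indep pt) (prods (nseq p (core L))))%N.
Proof.
move=> rY.
suff H t : (t <= p)%N -> (\prod_(W <- nseq t (core L)) #|W| <=
    2 ^ t * count (indep pt) (prods (nseq t (core L))))%N.
  by have := H p (leqnn p); rewrite big_nseq iter_muln muln1.
elim: t => [|t IH] ht.
  by rewrite big_nil /= /indep /= set_nil rk0.
rewrite expnS; apply: count_indep_cons (IH (ltnW ht)) => z hz iz.
apply: core_half; first by apply/subsetP => y; rewrite inE => /andP[].
rewrite rY; apply: leq_ltn_trans ht.
rewrite -[t](size_nseq t (core L)) -(size_mem_prods hz) -(eqP iz).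
by apply: rk_aff_le => y; rewrite inE => /andP[].
Qed.

End Peel.

(** Dividing by the number of all sequences turns [count_types] into a bound for a sum of weights,
    in which the Y need not be sorted by size. *)
Lemma count_types_ratio (R : realType) (T YT : finType) (I : eqType) (YY : {set YT})
    (s : seq I) (P : I -> {set T}) (Q : YT -> I -> {set T}) (good : YT -> pred (seq T))
    (K : nat) :
  (forall Y l, Y \in YY -> l \in s -> Q Y l \subset P l) ->
  (forall Y Y' z, Y \in YY -> Y' \in YY ->
     z \in prods (map (Q Y) s) -> z \in prods (map (Q Y') s) ->
     good Y z -> good Y' z -> Y = Y') ->
  (forall Y, Y \in YY -> (\prod_(l <- s) #|Q Y l| <=
     K * count (good Y) (prods (map (Q Y) s)))%N) ->
  \sum_(Y in YY) \prod_(l <- s) (#|Q Y l|%:R / #|P l|%:R) <= K%:R :> R.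
Proof.
move=> h1 h2 h3; have h := count_types h1 h2 h3.
under eq_bigr do rewrite big_split /= prodfV -natr_prod.
rewrite -mulr_suml -natr_prod -natr_sum.
have [->|n0] := eqVneq (\prod_(l <- s) #|P l|)%N 0%N; first by rewrite invr0 mulr0.
by rewrite ler_pdivrMr ?ltr0n ?lt0n // -natrM ler_nat.
Qed.

(** * Summation over the cores of links *)

Section PeelBound.
Context {R : realType} {d : nat} {T I : finType} (pt : T -> 'rV[R]_d).
Local Notation rk := (rk pt).
Local Notation aff := (aff pt).
Local Notation dd := (dd pt).
Local Notation core := (core pt).
Context (A : {set I}) (i : I) (P : I -> {set T}) (D : I -> I -> R).
Local Notation link := (link pt A i P D).
Context (q : nat) (XA : {set {ffun I -> T}}) (U t0 Lam : R).

(* The two alternatives come from the two ways of counting the cores [Y]: by independent points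
   of [Y] itself, or by a greedy basis of the projections of [X']. *)
Definition rich_bound (Y : {set T}) (X' : {set {ffun I -> T}}) :=
  lnc X' + lnc Y + (rk Y)%:R * (lnc (P i) - lnc Y) <= U \/
  exists o, [/\ uniq o, o =i A &
    lnc X' + lnc Y +
      \sum_(l <- labels pt (proj X') o) (lnc (P l) - lnc (proj X' l)) <= U].

Hypotheses (inj_i : {in P i &, injective pt}) (A0 : A != set0) (t00 : 0 <= t0)
  (Lam0 : 0 <= Lam) (PLam : forall j, j \in A -> lnc (P j) <= Lam)
  (famA : family_on pt A P D XA) (poor : lnc XA + t0 <= U).
Hypothesis rich : forall (Y : {set T}) (X' : {set {ffun I -> T}}),
  Y \subset P i -> X' \subset XA -> X' != set0 ->
  (forall y x j, y \in Y -> x \in X' -> j \in A -> dd y (x j) = D i j) ->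
  (3 <= rk Y)%N -> t0 < lnc Y -> rich_bound Y X'.

Local Notation E := (expR (U + #|I|%:R / q.+1%:R * Lam)).

Let isrich (x : {ffun I -> T}) := (2 < #|core (link x)|)%N && (t0 < lnc (core (link x))).
Let YY := [set core (link x) | x : {ffun I -> T} in XA & isrich x].
Let XY (Y : {set T}) := [set x in XA | core (link x) == Y].

Let expU : expR U <= E.
Proof. by rewrite ler_expR lerDl mulr_ge0 // divr_ge0. Qed.

Let poor_sum : (\sum_(x in XA | ~~ isrich x) #|core (link x)|)%:R <= 2 * E.
Proof.
have h x : ~~ isrich x -> #|core (link x)|%:R <= 2 * expR t0.
  have e1 : 1 <= expR t0 by rewrite -[1]expR0 ler_expR.
  rewrite negb_and -leqNgt -leNgt => /orP[h|h].
    have : #|core (link x)|%:R <= 2 :> R by rewrite (ler_nat R _ 2).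
    by move=> h'; apply: (le_trans h'); lra.
  have : #|core (link x)|%:R <= expR t0.
    by apply: (le_trans (nat_le_expR _)); rewrite ler_expR.
  by move=> h'; apply: (le_trans h'); lra.
rewrite natr_sum; apply: (@le_trans _ _ (\sum_(x in XA) 2 * expR t0)).
  rewrite [leRHS](bigID isrich) /= ler_wpDl //; last by apply: ler_sum => x /andP[_ /h].
  by apply: sumr_ge0 => x _; rewrite mulr_ge0 // expR_ge0.
rewrite sumr_const -[leLHS]mulr_natr -mulrA ler_pM2l //.
apply: le_trans expU; apply: (@le_trans _ _ (expR (lnc XA + t0))); last by rewrite ler_expR.
by rewrite expRD mulrC ler_pM2r ?expR_gt0 // nat_le_expR.
Qed.

(** More than two points on a sphere about a vertex [x j] are not collinear, whence rank at least
    3. *)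
Let YY_rich Y : Y \in YY -> [/\ XY Y != set0, (2 < #|Y|)%N, t0 < lnc Y,
  Y \subset P i & (3 <= rk Y)%N].
Proof.
move=> /imsetP[x]; rewrite inE => /andP[hx /andP[h1 h2]] eY; rewrite eY.
have s : core (link x) \subset P i.
  by apply: (subset_trans (coreP pt (link x)).1); apply/subsetP => p /linkP[].
split=> //.
  by apply/set0Pn; exists x; rewrite inE hx eqxx.
rewrite ltnNge; apply: contraTN h1 => h1; rewrite -leqNgt.
have /set0Pn[j jA] := A0.
apply: (sphere_line (x := pt (x j)) (c := D i j) (pt := pt)) => //.
  by move=> y y' /(subsetP s) hy /(subsetP s) hy'; apply: inj_i.
by move=> y /(subsetP (coreP pt (link x)).1) /linkP[_]; apply.
Qed.

Let reg_ex (Y : {set T}) : exists X' : {set {ffun I -> T}}, Y \in YY ->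
  [/\ X' \subset XY Y, X' != set0, regular pt A q X' &
    (#|XY Y| ^ q.+1 <= #|X'| ^ q.+1 * (kap q ^ @potmax d I * slots A (XY Y)))%N].
Proof.
have [hY|hY] := boolP (Y \in YY); last by exists set0.
have [h0 _ _ _ _] := YY_rich hY.
have [X' h] := regular_exists pt A q h0.
by exists X'.
Qed.

Let proj_P (X' : {set {ffun I -> T}}) j : X' \subset XA -> j \in A -> proj X' j \subset P j.
Proof.
move=> /subsetP s jA; apply/subsetP => t /imsetP[x /s hx ->].
by case: famA => + _ _; apply.
Qed.

(** The (q+1)-th root of the regularization bound: the logarithm of [slots] is at most |I| Lam, and
    its root is the factor that becomes the epsilon. *)
Let card_XY (Y : {set T}) (X' : {set {ffun I -> T}}) : Y \in YY ->
  [/\ X' \subset XY Y, X' != set0, regular pt A q X' &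
    (#|XY Y| ^ q.+1 <= #|X'| ^ q.+1 * (kap q ^ @potmax d I * slots A (XY Y)))%N] ->
  #|XY Y|%:R <= (kap q ^ @potmax d I)%:R * expR (lnc X' + #|I|%:R / q.+1%:R * Lam).
Proof.
move=> /YY_rich[XY0 _ _ _ _] [_ X'0 _].
have : (0 < kap q ^ @potmax d I)%N by rewrite expn_gt0 kap_gt0.
move: (kap q ^ _)%N => K K0 /(ln_nat_mono (R := R)).
have c1 : (0 < #|XY Y|)%N by rewrite card_gt0.
have c2 : (0 < #|X'|)%N by rewrite card_gt0.
have s0 := slots_gt0 A XY0.
rewrite ln_natM ?expn_gt0 ?c2 // ?muln_gt0 ?K0 ?s0 // ln_natM // !ln_natX //.
have : ln (slots A (XY Y))%:R <= #|I|%:R * Lam :> R.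
  rewrite /slots ln_nat_prod; last first.
    move=> j _; have /set0Pn[x hx] := XY0.
    by apply/card_gt0P; exists (x j); apply: imset_f.
  apply: (@le_trans _ _ (\sum_(j in A) Lam)).
    apply: ler_sum => j jA; apply: le_trans (PLam jA).
    apply: (lnc_mono (Y := proj (XY Y) j)); apply: proj_P => //.
    by apply/subsetP => x; rewrite inE => /andP[].
  by rewrite sumr_const -[leLHS]mulr_natl ler_wpM2r // ler_nat max_card.
move=> hs h.
have qp : 0 < q.+1%:R :> R by rewrite ltr0n.
have {h} h : lnc (XY Y) <= lnc X' + ln K%:R / q.+1%:R + #|I|%:R / q.+1%:R * Lam.
  have e a : q.+1%:R * (a / q.+1%:R) = a :> R by rewrite mulrC divfK ?lt0r_neq0.
  rewrite -(ler_pM2l qp) !mulrDr e mulrAC e.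
  by apply: (le_trans h); rewrite -addrA !lerD2l.
rewrite -(expR_lnc XY0).
have -> : K%:R = expR (ln K%:R) :> R by rewrite expR_ln_nat.
rewrite -expRD ler_expR; apply: (le_trans h).
have : ln K%:R / q.+1%:R <= ln K%:R :> R.
  by rewrite ler_pdivrMr // ler_peMr ?ln_nat_ge0 // ler1n.
by rewrite addrCA -addrA lerD2l lerD2r.
Qed.

(** The share of sequences of rk Y points of P_i that stay in Y. [V2] is the analogue for sequences
    in the projections; as the order of the labels depends on Y, it sums over all words that some
    order yields. *)
Let V1 (Y : {set T}) : R := (#|Y|%:R / #|P i|%:R) ^+ rk Y.

Let okl (X' : {set {ffun I -> T}}) (lab : seq I) :=
  `[< exists o, [/\ uniq o, o =i A & labels pt (proj X') o = lab] >].

Let V2 (X' : {set {ffun I -> T}}) : R := \sum_(p < d.+2) \sum_(lab : p.-tuple I | okl X' lab)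
   \prod_(l <- lab) (#|proj X' l|%:R / #|P l|%:R).

Let V1_ge0 Y : 0 <= V1 Y.
Proof. by rewrite exprn_ge0 // divr_ge0. Qed.

Let prod_ge0 (X' : {set {ffun I -> T}}) (lab : seq I) :
  0 <= \prod_(l <- lab) (#|proj X' l|%:R / #|P l|%:R) :> R.
Proof. by apply: prodr_ge0 => l _; rewrite divr_ge0. Qed.

Let V2_ge0 (X' : {set {ffun I -> T}}) : 0 <= V2 X'.
Proof. by apply: sumr_ge0 => p _; apply: sumr_ge0. Qed.

Let ratio_exp (Y Z : {set T}) : Y != set0 -> Y \subset Z ->
  #|Y|%:R / #|Z|%:R = expR (lnc Y - lnc Z) :> R.
Proof.
move=> Y0 s; rewrite expRB !expR_lnc //.
by apply: contraNN Y0 => /eqP e; rewrite e subset0 in s.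
Qed.

Let rich_term (Y : {set T}) (X' : {set {ffun I -> T}}) :
  Y \in YY -> X' \subset XY Y -> X' != set0 ->
  expR (lnc X') * #|Y|%:R <= expR U * (V1 Y + V2 X').
Proof.
move=> hY sX' X'0; have [_ c3 tY sY rY] := YY_rich hY.
have Y0 : Y != set0 by rewrite -card_gt0 (ltn_trans _ c3).
have sXA : X' \subset XA.
  by apply: (subset_trans sX'); apply/subsetP => x; rewrite inE => /andP[].
have cpl : forall y x j, y \in Y -> x \in X' -> j \in A -> dd y (x j) = D i j.
  move=> y x j hy /(subsetP sX'); rewrite inE => /andP[hx /eqP e] jA.
  move: hy; rewrite -e => /(subsetP (coreP pt (link x)).1) /linkP[_]; exact.
rewrite -(expR_lnc Y0) -expRD mulrDr.
case: (rich sY sXA X'0 cpl rY tY) => [h|[o [uo oA h]]].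
  apply: ler_wpDr; first by rewrite mulr_ge0 ?expR_ge0 ?V2_ge0.
  rewrite /V1 ratio_exp // -expRM_natl -expRD ler_expR; lra.
apply: ler_wpDl; first by rewrite mulr_ge0 ?expR_ge0 ?V1_ge0.
have sz := size_labels pt (proj X') o.
have lt : (size (labels pt (proj X') o) < d.+2)%N by rewrite sz ltnS rk_max.
rewrite /V2 (bigD1 (Ordinal lt)) //= (bigD1 (in_tuple (labels pt (proj X') o))) /=; last first.
  by apply/asboolP; exists o.
rewrite -addrA mulrDr ler_wpDr //.
  rewrite mulr_ge0 ?expR_ge0 // addr_ge0 //; first exact: sumr_ge0.
  by apply: sumr_ge0 => p _; apply: sumr_ge0.
rewrite (_ : \prod_(l <- _) _ =
    expR (- \sum_(l <- labels pt (proj X') o) (lnc (P l) - lnc (proj X' l)))).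
  rewrite -expRD ler_expR; lra.
rewrite -sumrN expR_sum big_seq [RHS]big_seq; apply: eq_bigr => l /labels_sub.
rewrite oA => lA; rewrite ratio_exp ?opprB //; last exact: proj_P.
by have /set0Pn[x hx] := X'0; apply/set0Pn; exists (x l); apply: imset_f.
Qed.

(** Ranks are separated. Within one rank, an independent sequence in Y spans Y, so by
    [core_link_spanned] it belongs to no other core. *)
Let sum_V1 : \sum_(Y in YY) V1 Y <= \sum_(p < d.+2) (2 ^ p)%:R.
Proof.
rewrite (partition_big (fun Y => inord (rk Y) : 'I_d.+2) predT) //=.
apply: ler_sum => p _.
pose YP := [set Y in YY | rk Y == p].
suff h : \sum_(Y in YP) (#|Y|%:R / #|P i|%:R) ^+ p <= (2 ^ p)%:R :> R.
  rewrite (eq_bigl (fun Y => Y \in YP)); last first.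
    move=> Y; rewrite in_set; congr (_ && _); apply/eqP/eqP => [<-|->]; last by rewrite inord_val.
    by rewrite inordK // ltnS rk_max.
  by rewrite (eq_bigr (fun Y : {set T} => (#|Y|%:R / #|P i|%:R) ^+ p)) // => Y;
    rewrite in_set => /andP[_ /eqP <-].
have e (Y : {set T}) : (#|Y|%:R / #|P i|%:R) ^+ p =
    \prod_(l <- nseq p i) (#|Y|%:R / #|P l|%:R) :> R.
  by rewrite big_nseq iter_mulr_1.
under eq_bigr do rewrite e.
apply: (@count_types_ratio R T {set T} I YP (nseq p i) P (fun Y _ => Y)
   (fun _ => indep pt) (2 ^ p)).
- move=> Y l; rewrite in_set mem_nseq => /andP[/YY_rich[_ _ _ s _] _] /andP[_ /eqP ->//].
- move=> Y Y' z; rewrite !in_set => /andP[/imsetP[x _ ->] /eqP rx] /andP[/imsetP[x' _ ->] /eqP rx'].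
  move=> h1 h2 iz _.
  have sz := size_mem_prods h1; rewrite size_map size_nseq in sz.
  apply: (@core_link_spanned _ _ _ _ _ _ _ _ _ _ _ z) => //; rewrite ?rx ?rx' //.
  + by apply: prods_sub h1 => W; rewrite map_nseq mem_nseq => /andP[_ /eqP->].
  + by apply: prods_sub h2 => W; rewrite map_nseq mem_nseq => /andP[_ /eqP->].
- move=> Y; rewrite in_set => /andP[/imsetP[x _ ->] /eqP rx].
  by rewrite map_nseq big_nseq iter_muln_1; apply: core_half_count.
Qed.

(** For a fixed label word, independent sequences in the projections span them and determine Y by
    [core_of_labels]; regularity makes a fraction 2^-p of all sequences independent. *)
Let sum_V2 (reg : {set T} -> {set {ffun I -> T}}) :
  (forall Y, Y \in YY -> [/\ reg Y \subset XY Y, reg Y != set0 & regular pt A q (reg Y)]) ->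
  \sum_(Y in YY) V2 (reg Y) <= \sum_(p < d.+2) (2 ^ p * #|I| ^ p)%:R.
Proof.
move=> hreg; rewrite exchange_big /=; apply: ler_sum => p _.
rewrite (exchange_big_dep predT) //=.
apply: (@le_trans _ _ (\sum_(lab : p.-tuple I) (2 ^ p)%:R)); last first.
  by rewrite sumr_const card_tuple -[leLHS]mulr_natr natrM.
apply: ler_sum => lab _.
pose YL := [set Y in YY | okl (reg Y) lab].
rewrite (eq_bigl (fun Y => Y \in YL)); last by move=> Y; rewrite in_set.
have hYL Y : Y \in YL -> exists o, [/\ reg Y \subset XY Y, reg Y != set0, o =i A,
    halving pt (proj (reg Y)) o & labels pt (proj (reg Y)) o = lab].
  rewrite in_set => /andP[hY /asboolP[o [uo oA e]]]; exists o.
  have [h1 h2 h3] := hreg _ hY.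
  split=> //; by apply: (regular_halving h2 h3) => j; rewrite oA.
apply: (@count_types_ratio R T {set T} I YL lab P (fun Y => proj (reg Y))
   (fun _ => indep pt) (2 ^ p)).
- move=> Y l /hYL[o [s1 _ oA _ <-]] /labels_sub; rewrite oA; apply: proj_P.
  by apply: (subset_trans s1); apply/subsetP => x; rewrite inE => /andP[].
- have key Y z : Y \in YL -> z \in prods (map (proj (reg Y)) lab) -> indep pt z ->
      core [set p in P i | all (fun lt => dd p lt.2 == D i lt.1) (zip lab z)] = Y.
    move=> hY hz iz; have [o [s1 n0 oA _ eo]] := hYL _ hY.
    have [_ c3 _ _ _] : [/\ XY Y != set0, (2 < #|Y|)%N, t0 < lnc Y, Y \subset P i & (3 <= rk Y)%N].
      by apply: YY_rich; move: hY; rewrite in_set => /andP[].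
    apply: (@core_of_labels _ _ _ _ pt A i P D _ _ _ _ n0) => //.
    + by rewrite -card_gt0 (ltn_trans _ c3).
    + by move=> x /(subsetP s1); rewrite inE => /andP[_ /eqP].
    + by move=> l; rewrite -eo => /labels_sub; rewrite oA.
    + move=> j x; rewrite -oA => jo hx.
      apply: (@indep_spans _ _ _ pt z (hull (proj (reg Y)) o)) => //.
      * apply: prods_sub hz => W /mapP[l]; rewrite -eo => /labels_sub lo ->.
        exact: (bigcup_sup l).
      * by rewrite (size_mem_prods hz) size_map -eo size_labels.
      * by apply/bigcupP; exists j => //; apply: imset_f.
  move=> Y Y' z h1 h2 h3 h4 iz _.
  by rewrite -(key _ _ h1 h3 iz) -(key _ _ h2 h4 iz).
- move=> Y /hYL[o [_ _ _ hv eo]].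
  have := count_labels hv; rewrite eo.
  by rewrite -(size_labels pt (proj (reg Y)) o) eo size_tuple.
Qed.

Lemma peel : (\sum_(x in XA) #|link x|)%:R <= @peel_const R d I q * E.
Proof.
have [reg hreg] := choice reg_ex.
have E0 : 0 < E by apply: expR_gt0.
set K := (kap q ^ @potmax d I)%N.
have h1 : (\sum_(x in XA) #|link x| <= 2 ^ d.+1 * \sum_(x in XA) #|core (link x)|)%N.
  rewrite big_distrr /=; apply: leq_sum => x _; rewrite mulnC; exact: core_card.
rewrite /peel_const -mulrA -/K; 
apply: (@le_trans _ _ (2 ^ d.+1 * \sum_(x in XA) #|core (link x)|)%N%:R).
  by rewrite ler_nat.
rewrite natrM ler_wpM2l // (bigID isrich) /= natrD addrC mulrDl lerD //.
rewrite (partition_big (fun x => core (link x)) (mem YY)) /=; last first.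
  by move=> x hx; apply: imset_f; rewrite inE.
apply: (@le_trans _ _ (\sum_(Y in YY) K%:R * (E * (V1 Y + V2 (reg Y))))).
  rewrite natr_sum; apply: ler_sum => Y hY.
  have [s1 n0 _ _] := hreg _ hY.
  apply: (@le_trans _ _ (#|XY Y| * #|Y|)%N%:R).
    rewrite ler_nat -sum_nat_const [leqRHS](bigID isrich) /=.
    apply: leq_trans (leq_addr _ _).
    rewrite (eq_bigr (fun=> #|Y|)); last by move=> x /andP[_ /eqP ->].
    apply: eq_leq; apply: eq_bigl => x; rewrite !inE.
    by rewrite andbAC.
  rewrite natrM; apply: le_trans (ler_wpM2r _ (card_XY hY (hreg _ hY))) _ => //.
  rewrite -[leLHS]mulrA ler_wpM2l // expRD mulrAC.
  apply: le_trans (ler_wpM2r _ (rich_term hY s1 n0)) _; first exact: expR_ge0.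
  by rewrite expRD mulrAC.
rewrite -!mulr_sumr -[leRHS]mulrA ler_wpM2l // [leLHS]mulrC ler_pM2r // big_split /=.
under [leRHS]eq_bigr do rewrite natrD.
rewrite big_split /= lerD // sum_V2 // => Y /hreg[h2 h3 h4 _]; split=> //.
Qed.

End PeelBound.

(** * Restricting families *)

Section Forget.
Context {R : realType} {d : nat} {T I : finType} (pt : T -> 'rV[R]_d).
Implicit Types (X Y : {set {ffun I -> T}}) (x : {ffun I -> T}) (A J : {set I}).

(** Coordinates outside A are frozen at those of a fixed tuple, so that tuples stay total functions
    and are determined on A. *)
Definition restr (A : {set I}) (x0 : {ffun I -> T}) (x : {ffun I -> T}) : {ffun I -> T} :=
  [ffun l => if l \in A then x l else x0 l].

Lemma restrE A x0 x l : l \in A -> restr A x0 x l = x l.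
Proof. by rewrite ffunE => ->. Qed.

Lemma family_restr J A P D X x0 : A \subset J ->
  family_on pt J P D X -> family_on pt A P D (restr A x0 @: X).
Proof.
move=> /subsetP AJ [h1 h2 h3]; split.
- by move=> _ l /imsetP[x hx ->] lA; rewrite restrE // h1 ?AJ.
- by move=> _ l l' /imsetP[x hx ->] lA lA'; rewrite !restrE // h2 ?AJ.
- move=> _ _ /imsetP[x hx ->] /imsetP[y hy ->] e; apply/ffunP => l.
  by rewrite !ffunE; case: ifP => // lA; have := e l lA; rewrite !restrE.
Qed.

(** Tuples with the same restriction differ at j only, so the fibre over y injects into [F y]. *)
Lemma card_restr J P D X x0 j (F : {ffun I -> T} -> {set T}) :
  family_on pt J P D X -> (forall x, x \in X -> x j \in F (restr (J :\ j) x0 x)) ->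
  (#|X| <= \sum_(y in restr (J :\ j) x0 @: X) #|F y|)%N.
Proof.
move=> [_ _ h3] hF.
rewrite -sum1_card (partition_big_imset (restr (J :\ j) x0)) /=.
apply: leq_sum => y _; rewrite sum1dep_card.
set Z := [set x | _]; rewrite -(card_in_imset (f := fun x : {ffun I -> T} => x j) (D := Z)).
  apply/subset_leq_card/subsetP => _ /imsetP[x + ->].
  by rewrite inE => /andP[hx /eqP <-]; apply: hF.
move=> x x'; rewrite !inE => /andP[hx /eqP <-] /andP[hx' /eqP e] ej.
apply: h3 => // l lJ; have [->//|lj] := eqVneq l j.
by have := congr1 (fun f : {ffun I -> T} => f l) e; rewrite !restrE // !inE lj.
Qed.

Lemma family_sub J P D X Y : Y \subset X -> family_on pt J P D X -> family_on pt J P D Y.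
Proof.
move=> /subsetP s [h1 h2 h3]; split.
- by move=> x j /s; apply: h1.
- by move=> x j l /s; apply: h2.
- by move=> x y /s hx /s hy; apply: h3.
Qed.

Lemma family_proj J P D X : family_on pt J P D X -> family_on pt J (proj X) D X.
Proof. by move=> [h1 h2 h3]; split=> // x j hx _; apply: imset_f. Qed.

Lemma proj_sub J P D X j : family_on pt J P D X -> j \in J -> proj X j \subset P j.
Proof. by move=> [h _ _] jJ; apply/subsetP => _ /imsetP[x hx ->]; apply: h. Qed.

Lemma lnc_card_mul (S1 S2 : finType) (U : {set S1}) (V : {set S2}) (m : nat) :
  (#|U| <= #|V| * m)%N -> lnc U <= lnc V + ln m%:R :> R.
Proof.
have [e|hU] := posnP #|U|.
  by move=> _; rewrite {1}/lnc e ln0 // addr_ge0 ?lnc_ge0 ?ln_nat_ge0.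
have [->|hV] := posnP #|V|; first by rewrite mul0n leqNgt hU.
have [->|hm] := posnP m; first by rewrite muln0 leqNgt hU.
by move=> /(ln_nat_mono (R := R)); rewrite ln_natM.
Qed.

Lemma family_drop J P D X j : j \in J -> X != set0 -> family_on pt J P D X ->
  exists Y, [/\ Y != set0, family_on pt (J :\ j) P D Y & lnc X <= lnc Y + lnc (P j) :> R].
Proof.
move=> jJ /set0Pn[x0 hx0] fX; exists (restr (J :\ j) x0 @: X); split.
- by apply/set0Pn; exists (restr (J :\ j) x0 x0); apply: imset_f.
- by apply: family_restr fX; apply: subD1set.
- apply: lnc_card_mul; rewrite -sum_nat_const.
  by apply: (card_restr (F := fun=> P j) fX) => x hx; case: fX => + _ _; apply.
Qed.

Lemma family_drops (J A : {set I}) P D X : A \subset J -> X != set0 -> family_on pt J P D X ->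
  exists Y, [/\ Y != set0, family_on pt A P D Y &
    lnc X <= lnc Y + \sum_(j in J :\: A) lnc (P j) :> R].
Proof.
move=> AJ; move: {2}#|J :\: A| (erefl #|J :\: A|) => n.
elim: n J AJ X => [|n IH] J AJ X.
  move=> /eqP; rewrite cards_eq0 setD_eq0 => JA X0 fX.
  have -> : A = J by apply/eqP; rewrite eqEsubset AJ.
  by exists X; rewrite setDv big_set0 addr0.
move=> hn X0 fX; have /card_gt0P[j] : (0 < #|J :\: A|)%N by rewrite hn.
move=> jJA; have /setDP[jJ jA] := jJA.
have [Y [Y0 fY hY]] := family_drop jJ X0 fX.
have AJ' : A \subset J :\ j by rewrite subsetD1 AJ.
have e : (J :\ j) :\: A = (J :\: A) :\ j.
  by apply/setP => l; rewrite !inE andbCA.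
have [|Z [Z0 fZ hZ]] := IH _ AJ' Y _ Y0 fY.
  by rewrite e; have := cardsD1 j (J :\: A); rewrite jJA hn => -[].
exists Z; split=> //; rewrite (big_setD1 j) //=; apply: (le_trans hY).
by rewrite addrCA [leLHS]addrC lerD2l -e.
Qed.

Lemma family_trivial J P D X : X != set0 -> family_on pt J P D X ->
  lnc X <= \sum_(j in J) lnc (P j) :> R.
Proof.
move=> X0 fX; have [Y [Y0 fY hY]] := family_drops (sub0set J) X0 fX.
rewrite setD0 in hY; suff e : #|Y| = 1%N by rewrite {2}/lnc e ln1 add0r in hY.
apply/eqP; rewrite eqn_leq card_gt0 Y0 andbT; apply/card_le1_eqP => x y hx hy.
by case: fY => _ _; apply=> // j; rewrite inE.
Qed.

End Forget.

(** * Numerical inequalities *)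

Section Abel.
Context {R : realFieldType} {I : eqType} (b : I -> R) (f : seq I -> R).

(** The logarithm of what is lost by confining a greedy basis to the projections: each vector
    supplied by l costs [b l]. *)
Fixpoint cost (o : seq I) : R :=
  if o is l :: o' then (f o - f o') * b l + cost o' else 0.

Definition top (o : seq I) : R := if o is l :: _ then b l else 0.

Definition bot (o : seq I) : R := if o is l :: o' then b (last l o') else 0.

Hypothesis f0 : f [::] = 0.

(* Abel summation along the greedy basis; [v] collects what every label of a
   prefix contributes to the bound for that prefix. *)
Lemma abel_cost (v : I -> R) (al W c : R) (o : seq I) :
  o != [::] -> sorted (fun x y => b y <= b x) o ->
  (forall l p, suffix (l :: p) o -> p != [::] ->
     al * (W - f p) <= c + \sum_(j <- p) v j) ->
  al * ((W - f o) * top o + cost o) <=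
    al * W * bot o + c * (top o - bot o) + \sum_(j <- o) v j * (top o - b j).
Proof.
elim: o => [//|l p IH] _ so hp; rewrite big_cons [top _]/= subrr mulr0 add0r.
case: p IH so hp => [|l' p] IH so hp.
  by rewrite big_nil /= f0 subrr; lra.
have /andP[hl {}so] : (b l' <= b l) && path (fun x y => b y <= b x) l' p := so.
have {}IH : al * ((W - f (l' :: p)) * b l' + cost (l' :: p)) <=
    al * W * b (last l' p) + c * (b l' - b (last l' p)) +
    \sum_(j <- l' :: p) v j * (b l' - b j).
  apply: IH => // l1 p1 h; apply: hp; apply: suffix_trans h _.
  exact: (suffix_suffix [:: l]).
have := hp l (l' :: p) (suffix_refl _) isT.
move: IH; set F := f (l' :: p); set C := cost (l' :: p); set F1 := f (l :: _).
have -> : \sum_(j <- l' :: p) v j * (b l - b j) =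
    (b l - b l') * (\sum_(j <- l' :: p) v j) + \sum_(j <- l' :: p) v j * (b l' - b j).
  by rewrite mulr_sumr -big_split; apply: eq_bigr => j _ /=; ring.
set V := \sum_(j <- _) v j; set V2 := \sum_(j <- _) _ => h1 h2.
have -> : cost (l :: l' :: p) = (F1 - F) * b l + C by [].
have -> : bot (l :: l' :: p) = b (last l' p) by [].
have hd : 0 <= b l - b l' by rewrite subr_ge0.
have := ler_wpM2r hd h2; lra.
Qed.

(** Summation by parts leaves the values [f p] of proper suffixes with nonpositive coefficients, so
    the lower bounds [size p] may replace them. *)
Lemma abel_cost_full (o : seq I) : sorted (fun x y => b y <= b x) o ->
  (forall l p, suffix (l :: p) o -> (size p)%:R <= f p) ->
  cost o - f o * top o <= \sum_(j <- o) b j - (size o)%:R * top o.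
Proof.
elim: o => [|l p IH] so hp; first by rewrite /= f0 big_nil; lra.
have h0 := hp l p (suffix_refl _).
have {}IH : cost p - f p * top p <= \sum_(j <- p) b j - (size p)%:R * top p.
  apply: IH; first exact: path_sorted so.
  by move=> l1 p1 h; apply: (hp l1); apply: suffix_trans h (suffix_suffix [:: l] p).
have hd : p != [::] -> 0 <= b l - top p.
  by case: p so {hp h0 IH} => //= l' p /andP[h _] _; rewrite subr_ge0.
rewrite big_cons [size _]/= -addn1 natrD; set F1 := f (l :: p).
have -> : cost (l :: p) = (F1 - f p) * b l + cost p by [].
have -> : top (l :: p) = b l by [].
have [e|/hd {}hd] := eqVneq p [::]; first by rewrite e /= big_nil f0 in IH *; lra.
have := ler_wpM2r hd h0; lra.
Qed.

End Abel.

Section InnerNumeric.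
Context {R : realFieldType}.
Implicit Types B S M Z : R.

(** Here def tells how far the height stays below the inductive bound for the whole label sets; B
    and S are the largest and the total deficit, M is the largest spread, bs the deficit of its
    label, Z the sum of deficit times spread. A large def pays for free points of Y; a small one
    bounds S and hence the cost. *)
Lemma inner_numeric (e rho def cst B S M bs Z : R) (full : bool) :
  2 <= e -> 1 / 8 <= rho -> rho <= 1 ->
  0 <= bs -> bs <= B -> bs <= 1 - M -> B <= 1 -> B <= S -> 0 <= M -> M <= 1 ->
  Z <= M * S -> Z <= M * (S - B) + B * (1 - B) ->
  (full -> 3 / 4 * S - 3 / 8 * (1 - M) <= def /\ cst <= S) ->
  (~~ full -> 3 / 4 * S <= def /\
     5 / 8 * cst <= B * (def - 3 / 4 * S) + 5 / 8 * S + 1 / 4 * Z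
        + 3 / 8 * (M * bs + (1 - M) * B)) ->
  e * (3 / 8 - rho) + 7 / 8 <= def \/ cst - def + rho - 5 / 8 * e - 1 / 8 <= 0.
Proof.
move=> e2 r8 r1 bs0 bsB bsM B1 BS M0 M1 Z1 Z2 hf hn.
case: (leP (e * (3 / 8 - rho) + 7 / 8) def) => hd; [by left | right].
have er : 0 <= (e - 2) * (rho - 1 / 8) by apply: mulr_ge0; lra.
have er1 : 0 <= (e - 2) * (1 - rho) by apply: mulr_ge0; lra.
case: full hf hn => [/(_ isT)[h1 h2] _|_ /(_ isT)[h1 h2]]; first by lra.
set X := M * bs + (1 - M) * B in h2.
have X_le : X <= B by have := mulr_ge0 M0 (_ : 0 <= B - bs); rewrite /X; lra.
have X_le2 : X <= 1 - M ^+ 2.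
  have h3 : 0 <= M * (1 - M - bs) by apply: mulr_ge0; lra.
  have h4 : 0 <= (1 - M) * (1 - B) by apply: mulr_ge0; lra.
  by rewrite /X; lra.
(* [Z1] suffices while B <= 1 - M, because X <= B; beyond that [Z2] is used, with a square as
   remainder. *)
have ZX : Z + X <= M * S + 1 - M.
  have [hB|hB] := leP B (1 - M); first by lra.
  have h3 : 0 <= M * (1 - M - bs) by apply: mulr_ge0; lra.
  have := sqr_ge0 (B - (1 - M)); rewrite /X; lra.
have h5 : 0 <= (1 - B) * (def - 3 / 4 * S) by apply: mulr_ge0; lra.
have h6 : 5 / 8 * cst <= def - 1 / 8 * S + 1 / 4 * (M * S + 1 - M) + 1 / 8 * X by lra.
have [S2|S2] := leP S 2.
  have : 5 / 8 * cst <= def + 1 / 4.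
    have [S1|S1] := leP S 1.
      have : 0 <= M * (1 - S) by apply: mulr_ge0; lra.
      by lra.
    have h7 : 0 <= M * (2 - S) by apply: mulr_ge0; lra.
    have h8 : 0 <= (2 - S) * (1 - M) by apply: mulr_ge0; lra.
    have h9 : 0 <= (S - 1) * (1 - M) ^+ 2 by apply: mulr_ge0; [lra | exact: sqr_ge0].
    have h10 : 0 <= (2 - S) * (1 - X) by apply: mulr_ge0; lra.
    have h11 : 0 <= (S - 1) * (1 - M ^+ 2 - X) by apply: mulr_ge0; lra.
    lra.
  by lra.
have : 5 / 8 * cst <= def + 1 / 8 * S.
  have h7 : 0 <= (S - 2) * (1 - M) by apply: mulr_ge0; lra.
  have := sqr_ge0 (1 - M); lra.
lra.
Qed.

End InnerNumeric.

Section ListNumeric.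
Context {R : realFieldType} {I : eqType} (b sg : I -> R) (f : seq I -> R) (o : seq I).
Hypotheses (f0 : f [::] = 0) (o0 : o != [::]) (uo : uniq o)
  (so : sorted (fun x y => b y <= b x) o)
  (b0 : forall j, j \in o -> 0 <= b j) (sg0 : forall j, j \in o -> 0 <= sg j)
  (bs1 : forall j, j \in o -> b j + sg j <= 1).

Lemma top_in : exists2 l, l \in o & top b o = b l.
Proof. by case: o o0 => [//|l p] _; exists l; rewrite ?mem_head. Qed.

Lemma le_top j : j \in o -> b j <= top b o.
Proof.
case: o so => [//|l p] /= sp; rewrite inE => /orP[/eqP->//|jp].
have tr : transitive (fun x y => b y <= b x) by move=> x y z h1 h2; apply: le_trans h1.
by have /allP := order_path_min tr sp; apply.
Qed.

Lemma ge_bot j : j \in o -> bot b o <= b j.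
Proof.
elim: o so => [//|l p IH] sp; rewrite inE => /orP[/eqP->|jp].
  rewrite /=; have tr : transitive (fun x y => b y <= b x).
    by move=> x y z h1 h2; apply: le_trans h1.
  have /allP h := order_path_min tr sp.
  by case: p {IH sp} h => [//|l' p] h /=; apply: h; apply: mem_last.
by have := IH (path_sorted sp) jp; case: p jp {IH sp}.
Qed.

Lemma sum_rem (F : I -> R) l : l \in o -> \sum_(j <- o) F j = F l + \sum_(j <- rem l o) F j.
Proof. by move=> lo; rewrite (perm_big _ (perm_to_rem lo)) big_cons. Qed.

Lemma suffix_sum (F : I -> R) p : suffix p o ->
  \sum_(j <- o) F j = \sum_(j <- p) F j + \sum_(j <- o | j \notin p) F j.
Proof.
move=> /suffixP[r e]; move: uo; rewrite e cat_uniq => /and3P[_ /hasPn h _].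
rewrite !big_cat /= addrC; congr (_ + _).
rewrite [X in _ + X]big_seq_cond [X in _ + X]big1 ?addr0; last by move=> j /andP[->].
by rewrite big_seq [RHS]big_seq_cond; apply: eq_bigl => j; case: (boolP (j \in r)) => //= jr;
  apply/esym; apply: contraL jr => jp; apply: h.
Qed.

Lemma suffix_sum1 p lM : lM \in o -> suffix p o ->
  \sum_(j <- p) (j == lM)%:R = (lM \in p)%:R :> R.
Proof.
move=> _ /suffixP[r e]; move: uo; rewrite e cat_uniq => /and3P[_ _ up].
elim: p up {e} => [|l p IH] /=; first by rewrite big_nil.
move=> /andP[lp up]; rewrite big_cons IH // inE eq_sym; case: eqP => [->|_] //=.
  by rewrite (negbTE lp) addr0.
by rewrite add0r.
Qed.

Lemma sum_bs (M : R) lm : lm \in o -> (forall j, j \in o -> sg j <= M) ->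
  \sum_(j <- o) b j * sg j <= M * (\sum_(j <- o) b j - b lm) + b lm * sg lm.
Proof.
move=> lo hM; rewrite !(sum_rem _ lo) addrC [b lm + _]addrC addrK lerD2r mulr_sumr.
rewrite big_seq [leRHS]big_seq; apply: ler_sum => j /mem_rem jo.
by rewrite mulrC ler_wpM2r // ?b0 ?hM.
Qed.

(** The inductive bound enters twice. For the suffixes of the greedy order it controls the cost by
    Abel summation; for the whole family, with N lowered to the largest spread M, it bounds the
    total deficit by def. *)
Lemma inner_list_numeric (h w e rho T M : R) (lM : I) (full : bool) :
  2 <= e -> 1 / 8 <= rho -> rho <= 1 -> lM \in o -> M = sg lM ->
  (forall j, j \in o -> sg j <= M) -> f o <= w ->
  (full -> w = (size o)%:R) -> (~~ full -> (size o)%:R + 1 <= w) ->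
  (forall l p, suffix (l :: p) o -> (size p)%:R <= f p) ->
  T = 5 / 8 * (w + e - (size o)%:R - 1) - 3 / 8
      + 3 / 4 * (1 + \sum_(j <- o) (b j + sg j)) ->
  h <= \sum_(j <- o) sg j ->
  (forall p, suffix p o -> p != [::] ->
     h <= 5 / 8 * (f p - (size p)%:R) - 3 / 8 * M * (lM \in p)%:R
        + 3 / 4 * \sum_(j <- p) sg j + \sum_(j <- o | j \notin p) sg j) ->
  h <= 5 / 8 * (f o - (size o)%:R) * M - 3 / 8 * M + 3 / 4 * \sum_(j <- o) sg j ->
  h + rho + (e + 1) * (1 - rho) <= T \/ h + rho + cost b f o <= T.
Proof.
move=> e2 r8 r1 lMo eM hM fw wfull wnfull fsz eT h0 hp hA.
have [lB lBo eB] := top_in.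
set a := (size o)%:R in wfull wnfull eT hA.
set S := \sum_(j <- o) b j; set G := \sum_(j <- o) sg j in h0 hA.
have eSG : \sum_(j <- o) (b j + sg j) = S + G by rewrite big_split.
rewrite eSG in eT.
pose Z := \sum_(j <- o) b j * sg j.
pose def := 5 / 8 * (w - a) - 3 / 8 + 3 / 4 * (S + G) - h.
have M0 : 0 <= M by rewrite eM sg0.
have M1 : M <= 1 by rewrite eM; have := bs1 lMo; have := b0 lMo; lra.
have bM := le_top lMo; have bM1 := bs1 lMo; rewrite -eM in bM1.
have B1 : top b o <= 1 by rewrite eB; have := bs1 lBo; have := sg0 lBo; lra.
have B0 : 0 <= top b o by rewrite eB b0.
have BS : top b o <= S.
  rewrite eB /S (sum_rem _ lBo) lerDl big_seq; apply: sumr_ge0 => j /mem_rem; exact: b0.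
have Z1 : Z <= M * S.
  rewrite mulr_sumr /Z big_seq [leRHS]big_seq; apply: ler_sum => j jo.
  by rewrite mulrC ler_wpM2r // ?b0 ?hM.
have Z2 : Z <= M * (S - top b o) + top b o * (1 - top b o).
  apply: le_trans (sum_bs lBo hM) _; rewrite -/S eB lerD2l ler_wpM2l ?b0 //.
  by have := bs1 lBo; lra.
have MM : 0 <= M * (1 - M) by apply: mulr_ge0; lra.
suff [H|H] : e * (3 / 8 - rho) + 7 / 8 <= def \/
    cost b f o - def + rho - 5 / 8 * e - 1 / 8 <= 0.
- by left; rewrite eT; move: H; rewrite /def; lra.
- by right; rewrite eT; move: H; rewrite /def; lra.
apply: (@inner_numeric _ e rho def (cost b f o) (top b o) S M (b lM) Z full) => //.
- exact: b0.
- by lra.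
- move=> /wfull ew; have fa : f o <= a by rewrite -ew.
  have h1 : 0 <= (a - f o) * M by apply: mulr_ge0; lra.
  split; first by rewrite /def ew; lra.
  have := abel_cost_full f0 so fsz; rewrite -/a -/S.
  have : 0 <= (a - f o) * top b o by apply: mulr_ge0; lra.
  lra.
- move=> /wnfull aw.
  have h1 : 0 <= (w - f o) * M by apply: mulr_ge0; lra.
  have h2 : 0 <= (w - a - 1) * (1 - M) by apply: mulr_ge0; lra.
  split; first by rewrite /def; lra.
  pose v j := - (5 / 8) - 1 / 4 * sg j - 3 / 8 * M * (j == lM)%:R.
  pose c := def + 3 / 8 + 5 / 8 * a + 1 / 4 * G - 3 / 4 * S.
  have hv l p : suffix (l :: p) o -> p != [::] ->
      5 / 8 * (w - f p) <= c + \sum_(j <- p) v j.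
    move=> sl p0; have sp : suffix p o.
      by apply: suffix_trans sl; apply: (suffix_suffix [:: l]).
    have := hp p sp p0; rewrite /c /def /v.
    rewrite !big_split /= !sumrN -!mulr_sumr (suffix_sum1 lMo sp) big_const_seq.
    rewrite count_predT iter_addr_0 -mulr_natr.
    have := suffix_sum sg sp; rewrite -/G; lra.
  have := abel_cost f0 o0 so hv.
  have bot0 : 0 <= bot b o.
    by case: o o0 b0 => [//|l p] _ hb; apply: hb; rewrite mem_last.
  have -> : \sum_(j <- o) v j * (top b o - b j) =
      - (5 / 8 * a + 1 / 4 * G) * top b o - 3 / 8 * M * (top b o - b lM)
      + 5 / 8 * S + 1 / 4 * Z.
    transitivity (\sum_(j <- o) (- (5 / 8) * top b o - 1 / 4 * top b o * sg j
        - 3 / 8 * M * (top b o - b lM) * (j == lM)%:R + 5 / 8 * b j + 1 / 4 * (b j * sg j))).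
      apply: eq_bigr => j _; rewrite /v; case: eqP => [->|_] /=; ring.
    rewrite !big_split /= !sumrN -!mulr_sumr (suffix_sum1 lMo (suffix_refl o)) lMo.
    rewrite big_const_seq count_predT iter_addr_0 -mulr_natr -/a -/S -/G -/Z /=; ring.
  have h3 : 0 <= (w - f o) * top b o by apply: mulr_ge0; lra.
  (* The coefficient 5/8 w - c of [bot] is nonpositive, so that term may be dropped. *)
  have h4 : 0 <= bot b o * (c - 5 / 8 * w).
    by apply: mulr_ge0 => //; rewrite /c /def; lra.
  rewrite /c; move: h4; rewrite /c; lra.
Qed.

End ListNumeric.

(** * Inequalities for equal label sets *)

Section TopScalar.
Context {R : realFieldType}.
Implicit Types e rho def cst B S b t : R.

(** The hull of the projections has the least possible rank. The alternatives are at least three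
    labels, or two labels, which force e >= 3. *)
Lemma top_full_numeric e rho def cst S b : 1 / 8 <= rho -> rho <= 1 -> 0 <= b ->
  def <= e * (3 / 8 - rho) + 9 / 8 -> 3 / 4 * S - 3 / 8 * b <= def -> cst <= S ->
  2 <= e /\ 3 * b <= S \/ 3 <= e /\ 2 * b <= S ->
  cst <= def + 5 / 8 * (e - 2) + 9 / 8 - rho.
Proof.
move=> r8 r1 b0 hd h1 h2 [[e2 hS]|[e3 hS]].
- have : 0 <= (e - 2) * (rho - 1 / 8) by apply: mulr_ge0; lra.
  lra.
- have : 0 <= (e - 3) * (rho - 1 / 8) by apply: mulr_ge0; lra.
  lra.
Qed.

(** For e = 2 the bound on def gives rho <= 15/16 - def/2, so the right-hand side of the conclusion
    is at least 3/2 def + 3/16; times 5/8 this is 15/16 def + 15/128. Larger e only adds slack. *)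
Lemma top_target e rho def cst : 2 <= e -> 1 / 8 <= rho ->
  def <= e * (3 / 8 - rho) + 9 / 8 ->
  5 / 8 * cst <= 15 / 16 * def + 15 / 128 + 5 / 16 * (e - 2) ->
  cst <= def + 5 / 8 * (e - 2) + 9 / 8 - rho.
Proof.
move=> e2 r8 hd hc.
suff : def / 2 + 3 / 16 + (e - 2) / 2 <= 5 / 8 * (e - 2) + 9 / 8 - rho by lra.
have h1 : 0 <= (e - 2) * (rho - 1 / 8) by apply: mulr_ge0; lra.
suff : 0 <= e * (5 / 8 * (e - 2) + 9 / 8 - rho - (def / 2 + 3 / 16 + (e - 2) / 2)).
  by rewrite pmulr_rge0; lra.
have h3 : 0 <= (e - 2) * (e * (3 / 8 - rho) + 9 / 8 - def) by apply: mulr_ge0; lra.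
have h4 : 0 <= (e - 2) * (e * (rho - 1 / 8)).
  by apply: mulr_ge0; [lra | apply: mulr_ge0; lra].
lra.
Qed.

(** Generic case: the center as a further vertex adds 5/8 to the slack. The lower bound for [Q2]
    takes the largest deficit and four others. *)
Lemma top_indep_numeric t def B S b (Q2 : R) : 0 <= t -> def <= 13 / 8 + t / 4 ->
  0 <= b -> b <= B -> B <= 1 -> 5 / 8 + 3 / 4 * S - 3 / 8 * b <= def ->
  B ^+ 2 + 4 * b ^+ 2 <= Q2 ->
  (1 / 8 - 5 / 8 * t) * b + (B - b) * (def + 3 / 8 * b) - 3 / 4 * B * S + b * S
    + 7 / 8 * S - 1 / 4 * Q2 <= 15 / 16 * def + 15 / 128 + 5 / 16 * t.
Proof.
move=> t0 hd b0 bB B1 hdef hQ.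
(* The first factor is the coefficient of S on the left; the product trades S for its upper bound in
   terms of def. *)
have h1 : 0 <= (7 / 8 + b - 3 / 4 * B) * (def - 5 / 8 - 3 / 4 * S + 3 / 8 * b).
  by apply: mulr_ge0; lra.
have h2 : 0 <= b * (13 / 8 + t / 4 - def) by apply: mulr_ge0; lra.
have h3 : 0 <= t * b by apply: mulr_ge0.
have h4 := sqr_ge0 (b - 3 / 20); have h5 := sqr_ge0 (1 - B).
lra.
Qed.

(** The center is dependent, and the redundant label, of deficit b0, is not the last one, whose
    deficit b is least. The slack gains 3/4 (1 - b0) instead of 5/8, and [top_gain] brings the term
    (b0 - b)(1 - b0). *)
Lemma top_dep1_numeric t def B S b b0 (Q2 : R) : 0 <= t -> def <= 13 / 8 + t / 4 ->
  0 <= b -> b <= b0 -> b0 <= B -> B <= 1 ->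
  3 / 4 * S + 3 / 4 * (1 - b0) - 3 / 8 * b <= def ->
  B + b0 + 3 * b <= S -> B ^+ 2 + b0 ^+ 2 + 3 * b ^+ 2 <= Q2 ->
  (1 / 8 - 5 / 8 * t) * b + (B - b) * (def + 3 / 8 * b) - 3 / 4 * B * S + b * S
    + 7 / 8 * S - 1 / 4 * Q2 - (b0 - b) * (1 - b0) <= 15 / 16 * def + 15 / 128 + 5 / 16 * t.
Proof.
move=> t0 hd b_0 bb0 b0B B1 hdef hS hQ.
have h1 : 0 <= (7 / 8 + b - 3 / 4 * B) * (def - 3 / 4 * S - 3 / 4 * (1 - b0) + 3 / 8 * b).
  by apply: mulr_ge0; lra.
have h2 : 0 <= b * (13 / 8 + t / 4 - def) by apply: mulr_ge0; lra.
have h3 : 0 <= t * b by apply: mulr_ge0.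
have h4 : 0 <= 7 / 8 - 3 / 4 * B + t / 4 - 15 / 8 * b by lra.
have h5 : 0 <= (B - b0) * (b0 - b) by apply: mulr_ge0; lra.
have h6 := sqr_ge0 (B - 3 / 4); have h7 := sqr_ge0 (B - b0).
have h8 : 0 <= b * (1 - B) by apply: mulr_ge0; lra.
have h9 : 0 <= b * (B - b0) by apply: mulr_ge0; lra.
have h10 := sqr_ge0 b; have h11 : 0 <= (1 - B) * (B - b) by apply: mulr_ge0; lra.
lra.
Qed.

(** The redundant label is itself the last one, of least deficit b, and b' is the least deficit of
    the others. Every nonempty suffix contains it, so [top_gain] brings nothing. *)
Lemma top_dep2_numeric t def B S b b' (Q2 : R) : 0 <= t -> def <= 13 / 8 + t / 4 ->
  0 <= b -> b <= b' -> b' <= B -> B <= 1 ->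
  3 / 4 * S + 3 / 4 * (1 - b) - 3 / 8 * b' <= def ->
  B + b + 3 * b' <= S -> B ^+ 2 + b ^+ 2 + 3 * b' ^+ 2 <= Q2 ->
  (1 / 8 - 5 / 8 * t) * b + (B - b) * (def + 3 / 8 * b) - 3 / 4 * B * S + b * S
    + 7 / 8 * S - 1 / 4 * Q2 <= 15 / 16 * def + 15 / 128 + 5 / 16 * t.
Proof.
move=> t0 hd b_0 bb' b'B B1 hdef hS hQ.
have h1 : 0 <= (7 / 8 + b - 3 / 4 * B) * (def - 3 / 4 * S - 3 / 4 * (1 - b) + 3 / 8 * b').
  by apply: mulr_ge0; lra.
have h2 : 0 <= b * (13 / 8 + t / 4 - def) by apply: mulr_ge0; lra.
have h3 : 0 <= t * b by apply: mulr_ge0.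
have h4 : 0 <= 7 / 8 - 3 / 4 * B + t / 4 - 15 / 8 * b' by lra.
have h5 : 0 <= (B - b') * (1 - B) by apply: mulr_ge0; lra.
have h6 := sqr_ge0 (B - 7 / 10).
have h7 : 0 <= (b' - b) * (13 / 24 + 3 / 8 * (b + b') - 3 / 8 * B + b' / 2).
  by apply: mulr_ge0; lra.
have h8 : 0 <= b' * (B - b') by apply: mulr_ge0; lra.
have h9 : 0 <= B * b' by apply: mulr_ge0; lra.
lra.
Qed.

End TopScalar.

Lemma sum_ge_const (R : realFieldType) (I : eqType) (s : seq I) (F : I -> R) (c : R) :
  (forall j, j \in s -> c <= F j) -> (size s)%:R * c <= \sum_(j <- s) F j.
Proof.
move=> h; have -> : (size s)%:R * c = \sum_(j <- s) c.
  by rewrite big_const_seq count_predT iter_addr_0 mulr_natl.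
by rewrite big_seq [leRHS]big_seq; apply: ler_sum.
Qed.

Lemma seq_min (R : realFieldType) (I : eqType) (b : I -> R) (s : seq I) : s != [::] ->
  exists2 l, l \in s & forall j, j \in s -> b l <= b j.
Proof.
elim: s => [//|l s IH] _; have [->|/IH[l' h1 h2]] := eqVneq s [::].
  by exists l; rewrite ?mem_head // => j; rewrite inE => /eqP ->.
have [h|h] := leP (b l) (b l').
  exists l; first exact: mem_head.
  by move=> j; rewrite inE => /orP[/eqP->//|/h2]; apply: le_trans.
exists l'; first by rewrite inE h1 orbT.
by move=> j; rewrite inE => /orP[/eqP->|/h2//]; apply: ltW.
Qed.

Lemma bot_elt (R : realFieldType) (I : eqType) (b : I -> R) (o : seq I) : o != [::] ->
  sorted (fun x y => b y <= b x) o ->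
  exists lb, [/\ lb \in o, bot b o = b lb,
  (forall p, suffix p o -> p != [::] -> lb \in p) & forall j, j \in o -> b lb <= b j].
Proof.
move=> o0 so; have := ge_bot so; case: o o0 {so} => [//|l p] _ hb.
exists (last l p); split=> //; first exact: mem_last.
move=> [//|x q] /suffixP[r e] _.
have := congr1 (last l) e; rewrite last_cat /= => ->; exact: mem_last.
Qed.

Lemma sum_one_minus (R : realFieldType) (I : eqType) (b : I -> R) (s : seq I) :
  \sum_(j <- s) (1 - b j) = (size s)%:R - \sum_(j <- s) b j.
Proof. by rewrite big_split sumrN /= big_const_seq count_predT iter_addr_0. Qed.

(* The first alternative is the generic case, in the second one [j0] can be forgotten. *)
Definition top_gain (R : realFieldType) (I : eqType) (b : I -> R) (g : option I) (p : seq I) : R :=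
  if g is Some j0 then (1 - b j0) * (j0 \notin p)%:R else 0.

Lemma top_cost (R : realFieldType) (I : eqType) (b : I -> R) (f : seq I -> R) (o : seq I)
    (g : option I) (h w bb : R) :
  f [::] = 0 -> o != [::] -> uniq o -> sorted (fun x y => b y <= b x) o ->
  0 <= top b o -> bot b o = bb -> f o <= w ->
  (if g is Some j0 then j0 \in o else true) ->
  let a := (size o)%:R in let B := top b o in let S := \sum_(j <- o) b j in
  (forall p, suffix p o -> p != [::] ->
     h <= 5 / 8 * (f p - (size p)%:R) - 3 / 8 * (1 - bb)
        + 3 / 4 * \sum_(j <- p) (1 - b j) + \sum_(j <- o | j \notin p) (1 - b j)
        - top_gain b g p) ->
  5 / 8 * cost b f o <= (5 / 8 * w - 7 / 8 * a) * bb
    + (B - bb) * (5 / 8 * (w - a) + 3 / 4 * a - 3 / 8 - h + 3 / 8 * bb)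
    - 3 / 4 * B * S + bb * S + 7 / 8 * S - 1 / 4 * \sum_(j <- o) b j ^+ 2
    - (if g is Some j0 then (b j0 - bb) * (1 - b j0) else 0).
Proof.
move=> f0 o0 uo so B0 ebot fw hg a B S hp.
(* [abel_cost] wants a bound additive over the suffix: the gain of suffixes without j0 is the
   constant [gt] minus the contribution [gj] at j0. *)
pose gj j : R := if g is Some j0 then (1 - b j0) * (j == j0)%:R else 0.
pose gt : R := if g is Some j0 then 1 - b j0 else 0.
have gsum p : suffix p o -> \sum_(j <- p) gj j = gt - top_gain b g p.
  rewrite /gj /gt /top_gain; case: (g) hg => [j0|] hj sp; last by rewrite big1 ?subr0.
  rewrite -mulr_sumr (suffix_sum1 uo hj sp).
  by case: (j0 \in p); rewrite /= ?mulr1 ?mulr0 ?subr0 ?subrr.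
pose v j := - (7 / 8) + 1 / 4 * b j + gj j.
pose c := 5 / 8 * w - h - 3 / 8 + 3 / 8 * bb + a - S - gt.
have hv l p : suffix (l :: p) o -> p != [::] ->
    5 / 8 * (w - f p) <= c + \sum_(j <- p) v j.
  move=> sl p0; have sp : suffix p o.
    by apply: suffix_trans sl; apply: (suffix_suffix [:: l]).
  have H1 := hp p sp p0; rewrite sum_one_minus in H1.
  have H2 := suffix_sum uo (fun j => 1 - b j) sp; rewrite !sum_one_minus -/a -/S in H2.
  rewrite /c /v !big_split /= -!mulr_sumr (gsum p sp) big_const_seq count_predT iter_addr_0.
  move: H1 H2.
  move: (\sum_(j <- p) b j) (\sum_(j <- o | _) _) (top_gain _ _ _) (f p) (gt) => s1 s2 s3 s4 s5.
  rewrite -[(- _) *+ _]mulr_natr; move: ((size p)%:R) => s6; clear; lra.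
have := abel_cost f0 o0 so hv; rewrite ebot -/B.
have -> : \sum_(j <- o) v j * (B - b j) = - (7 / 8) * (a * B - S)
    + 1 / 4 * (B * S - \sum_(j <- o) b j ^+ 2)
    + (if g is Some j0 then (1 - b j0) * (B - b j0) else 0).
  transitivity (\sum_(j <- o) (- (7 / 8) * B + (7 / 8 + 1 / 4 * B) * b j
       - 1 / 4 * (b j ^+ 2) +
       (if g is Some j0 then ((1 - b j0) * (B - b j0)) * (j == j0)%:R else 0))).
    apply: eq_bigr => j _; rewrite /v /gj; case: (g) => [j0|]; last by ring.
    by case: eqP => [->|_] /=; ring.
  rewrite !big_split /= sumrN -!mulr_sumr big_const_seq count_predT iter_addr_0 -/S.
  have -> : \sum_(j <- o) (if g is Some j0 then ((1 - b j0) * (B - b j0)) * (j == j0)%:R else 0)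
     = if g is Some j0 then (1 - b j0) * (B - b j0) else 0.
    case: (g) hg => [j0|] hj; last by rewrite big1.
    by rewrite -mulr_sumr (suffix_sum1 uo hj (suffix_refl o)) hj mulr1.
  congr (_ + _); rewrite -[B *+ _]mulr_natr /a.
  move: (\sum_(i <- o) _ ^+ 2) ((size o)%:R) => q s; clearbody B S; clear; ring.
have h1 : 0 <= (w - f o) * B by rewrite mulr_ge0 // subr_ge0.
move: h1; rewrite /c /gt.
case: (g) => [j0|].
  move: (cost b f o) (\sum_(j <- o) _) (b j0) => s1 s2 s3; clear; lra.
move: (cost b f o) (\sum_(j <- o) _) => s1 s2; clear; lra.
Qed.

Lemma sum_two (R : realFieldType) (I : eqType) (o : seq I) (j0 jB : I) (F : I -> R) (c : R) :
  uniq o -> j0 \in o -> jB \in o -> jB != j0 ->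
  (forall j, j \in o -> j != j0 -> c <= F j) ->
  F j0 + F jB + ((size o)%:R - 2) * c <= \sum_(j <- o) F j.
Proof.
move=> uo hj hB nB hc; rewrite (sum_rem _ hj).
have hB' : jB \in rem j0 o by rewrite mem_rem_uniq // inE nB.
rewrite (sum_rem _ hB') -addrA !lerD2l.
have s1 : (0 < size (rem j0 o))%N by case: (rem j0 o) hB'.
have -> : (size o)%:R - 2 = (size (rem jB (rem j0 o)))%:R :> R.
  move: s1; rewrite !size_rem //.
  by case: (size o) => [|[|n]] //= _; rewrite -[n.+2]addn2 natrD addrK.
apply: sum_ge_const => j; rewrite mem_rem_uniq ?rem_uniq // inE mem_rem_uniq // inE.
by move=> /and3P[_ h1 h2]; apply: hc.
Qed.

Lemma top_list_numeric (R : realFieldType) (I : eqType) (b : I -> R) (f : seq I -> R)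
    (o : seq I) (h w e rho T : R) (dn E : nat) :
  f [::] = 0 -> o != [::] -> uniq o -> sorted (fun x y => b y <= b x) o ->
  (forall j, j \in o -> 0 <= b j) -> (forall j, j \in o -> b j <= 1) ->
  let a := (size o)%:R in let sg j := 1 - b j in
  (4 <= dn)%N -> (size o < dn)%N -> (3 <= E <= dn.+2)%N -> e = E%:R - 1 ->
  w = dn%:R + 2 - E%:R -> (5 * dn < 7 * (size o).+1)%N ->
  1 / 8 <= rho -> rho <= 1 -> (5 * dn%:R - 7 * (a + 1)) / 8 + 1 <= rho ->
  a <= f o -> f o <= w ->
  (forall l p, suffix (l :: p) o -> (size p)%:R <= f p) ->
  T = 5 / 8 * (dn%:R - a - 1) + 3 / 4 * (a + 1) ->
  (forall p l, suffix p o -> l \in p ->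
     h <= 5 / 8 * (f p - (size p)%:R) - 3 / 8 * sg l
        + 3 / 4 * \sum_(j <- p) sg j + \sum_(j <- o | j \notin p) sg j) ->
  h <= 5 / 8 * (f o - a) * (1 - bot b o) - 3 / 8 * (1 - bot b o)
        + 3 / 4 * \sum_(j <- o) sg j ->
  (forall l, l \in o -> h <= 5 / 8 * (w - (a + 1)) - 3 / 8 * sg l
        + 3 / 4 * \sum_(j <- o) sg j) \/
  (exists j0 j1, [/\ j0 \in o, j1 \in o, j0 != j1, b j0 <= b j1 &
     (forall l, l \in o -> l != j0 -> h <= 5 / 8 * (w - a) - 3 / 8 * sg l
        + 3 / 4 * (\sum_(j <- o) sg j - sg j0)) /\
     (forall p l, suffix p o -> j0 \notin p -> l \in p ->
        h <= 5 / 8 * (f p - (size p)%:R) - 3 / 8 * sg l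
        + 3 / 4 * \sum_(j <- p) sg j + \sum_(j <- o | j \notin p) sg j - sg j0)]) ->
  h + rho + (e + 1) * (1 - rho) <= T \/ h + rho + cost b f o <= T.
Proof.
move=> f0 o0 uo so b0 b1 a sg d4 ad /andP[E3 Ed] eE ew d7 r8 r1 rT af fw fsz eT hp hA hC.
have [lB lBo eB] := top_in b o0; have [lb [lbo ebot lbp lbmin]] := bot_elt o0 so.
have bleB j : j \in o -> b j <= top b o by move=> jo; apply: le_top.
set B := top b o in eB bleB; set bb := b lb in ebot lbmin; rewrite ebot in hA.
set S := \sum_(j <- o) b j.
pose Q := \sum_(j <- o) b j ^+ 2.
pose def := 5 / 8 * (w - a) + 3 / 4 * a - 3 / 8 - h.
have e2 : 2 <= e by move: E3; rewrite eE -(ler_nat R); clear; lra.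
have bbB : bb <= B by rewrite eB; apply: lbmin.
have bb0 : 0 <= bb by apply: b0.
have B0 : 0 <= B by apply: le_trans bbB.
have B1 : B <= 1 by rewrite eB; apply: b1.
(* T - h equals def + 5/8 (e - 2) + 9/8, and the premise is the failure of the first alternative. *)
suff : def <= e * (3 / 8 - rho) + 9 / 8 -> cost b f o <= def + 5 / 8 * (e - 2) + 9 / 8 - rho.
  case: (leP (e * (3 / 8 - rho) + 9 / 8) def) => hd H.
    by left; rewrite eT; move: hd; rewrite /def ew eE; clear; lra.
  right; have := H (ltW hd); rewrite eT /def ew eE; move: (cost b f o); clear => cst; lra.
move=> hd.
have costS := abel_cost_full f0 so fsz; rewrite -/a -/S -/B in costS.
have S_ge : a * bb <= S by apply: sum_ge_const.
have a2 : (2 <= size o)%N by clear -d7 d4; lia.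
rewrite sum_one_minus -/a -/S in hA hC.
have wE : w = (dn.+2 - E)%:R by rewrite natrB // -addn2 natrD ew.
have [wa|wa] : w = a \/ a + 1 <= w.
- have : (size o <= dn.+2 - E)%N by rewrite -(ler_nat R) -wE (le_trans af).
  rewrite leq_eqVlt => /orP[/eqP h1|h1]; [left|right].
    by rewrite /a h1 wE.
  by move: h1; rewrite -(ler_nat R) -natr1 -wE.
- have fa : f o <= a by rewrite -wa.
  have h1 : 0 <= (a - f o) * (1 - bb).
    by apply: mulr_ge0; rewrite subr_ge0 // (le_trans bbB).
  have h2 : 0 <= (a - f o) * B by apply: mulr_ge0; rewrite // subr_ge0.
  have c3 : cost b f o <= S.
    by move: costS h2; move: (cost b f o) => cst; clearbody B S; clear; lra.
  apply: (@top_full_numeric _ e rho def _ S bb) => //.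
    by move: hA h1; rewrite /def wa; clearbody S bb; clear; lra.
  have [a3|a3] := leqP 3 (size o).
    left; split=> //; apply: le_trans S_ge; apply: ler_wpM2r => //.
    by rewrite (ler_nat R 3).
  right; split; last first.
    by apply: le_trans S_ge; apply: ler_wpM2r => //; rewrite (ler_nat R 2).
  have E4 : (4 <= E)%N.
    have : size o = (dn.+2 - E)%N by apply/eqP; rewrite -(eqr_nat R) -/a -wa wE.
    by clear -a3 a2 ad d4 d7 Ed; lia.
  by move: E4; rewrite eE -(ler_nat R); clear; lra.
have costSB : cost b f o <= S + (w - a) * B.
  have : 0 <= (w - f o) * B by apply: mulr_ge0; rewrite // subr_ge0.
  by move: costS; move: (cost b f o) => cst; clearbody B S; clear; lra.
have aE : ((size o).+1 <= dn.+2 - E)%N by rewrite -(ler_nat R) -natr1 -wE.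
have nat5 : (5 * (dn.+2 - E) + 5 * E <= 7 * size o + 16)%N by clear -d7 aE Ed; lia.
have r5 : 5 / 8 * w - 7 / 8 * a <= 1 / 8 - 5 / 8 * (e - 2).
  move: nat5; rewrite -(ler_nat R) (natrD _ (5 * _)) (natrD _ (7 * _)).
  rewrite (natrM _ 5 (_ - _)) (natrM _ 5 E) (natrM _ 7) -wE -/a eE; move: (E%:R) => E'.
  clear; lra.
have hd13 : def <= 13 / 8 + (e - 2) / 4.
  have : 0 <= e * (rho - 1 / 8) by apply: mulr_ge0; move: e2 r8; clear; lra.
  by move: hd; clear; lra.
have K g : (if g is Some j0 then j0 \in o else true) ->
    (forall p, suffix p o -> p != [::] ->
     h <= 5 / 8 * (f p - (size p)%:R) - 3 / 8 * (1 - bb)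
        + 3 / 4 * \sum_(j <- p) (1 - b j) + \sum_(j <- o | j \notin p) (1 - b j)
        - top_gain b g p) ->
  5 / 8 * cost b f o <= (1 / 8 - 5 / 8 * (e - 2)) * bb
    + (B - bb) * (def + 3 / 8 * bb) - 3 / 4 * B * S + bb * S + 7 / 8 * S - 1 / 4 * Q
    - (if g is Some j0 then (b j0 - bb) * (1 - b j0) else 0).
  move=> hg hgp; have H := top_cost f0 o0 uo so B0 ebot fw hg hgp.
  apply: (le_trans H).
  rewrite -/a -/S -/B -/Q lerD2r -addrA -[leRHS]addrA.
  have : 0 <= bb * (1 / 8 - 5 / 8 * (e - 2) - (5 / 8 * w - 7 / 8 * a)).
    by rewrite mulr_ge0 // subr_ge0.
  rewrite /def; clearbody bb B S Q; clear; lra.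
(* Some label other than j0 attains the maximum B; this is the use of [b j0 <= b j1]. *)
have exB j0 j1 : j0 \in o -> j1 \in o -> j0 != j1 -> b j0 <= b j1 ->
    exists jB, [/\ jB \in o, jB != j0 & b jB = B].
  move=> j0o j1o j01 b01; have [e0|n0] := eqVneq lB j0; last by exists lB; rewrite -eB.
  exists j1; split=> //; first by rewrite eq_sym.
  by apply/eqP; rewrite eq_le bleB //= eB e0.
have rem_min j0 : j0 \in o -> exists l', [/\ l' \in o, l' != j0 &
    forall j, j \in o -> j != j0 -> b l' <= b j].
  move=> j0o; have hr : rem j0 o != [::].
    by rewrite -size_eq0 size_rem //; clear -a2; lia.
  have [l' l'r l'min] := seq_min b hr; exists l'.
  move: l'r; rewrite mem_rem_uniq // inE => /andP[l'n l'o]; split=> // j jo jn.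
  by apply: l'min; rewrite mem_rem_uniq // inE jn.
have [a4|a5] := leqP (size o) 4.
- have [E_3 d_a] : E = 3%N /\ dn = (size o).+2 by clear -a4 a2 aE d7 Ed E3; lia.
  have ee : e = 2 by rewrite eE E_3; clear; lra.
  have ww : w = a + 1 by rewrite ew d_a E_3 -addn2 natrD -/a; clear; lra.
  have rr : (11 - 2 * a) / 8 <= rho.
    by move: rT; rewrite d_a -[(size o).+2]addn2 (natrD _ (size o)) -/a; clear; lra.
  rewrite ww in costSB; rewrite ee in hd *.
  have {}costSB : cost b f o <= S + B.
    by move: costSB; move: (cost b f o) => cst; clearbody B S; clear; lra.
  apply: le_trans costSB _; rewrite subrr mulr0 addr0.
  case: hC => [hC|[j0 [j1 [j0o j1o j01 b01 [hC _]]]]].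
  + have := hC lb lbo; rewrite /sg -/bb ww => hdef.
    have {hdef} : 5 / 8 + 3 / 4 * S - 3 / 8 * bb <= def.
      by move: hdef; rewrite /def ww; clearbody S bb; clear; lra.
    have SB3 : B + (a - 1) * bb <= S.
      rewrite /S (sum_rem _ lBo) eB lerD2l.
      have -> : a - 1 = (size (rem lB o))%:R.
        by rewrite size_rem // -subn1 natrB // (ltn_trans _ a2).
      by apply: sum_ge_const => j /mem_rem; apply: lbmin.
    have : size o = 2%N \/ size o = 3%N \/ size o = 4%N by clear -a4 a2; lia.
    move: hd SB3 rr bb0 bbB r1; rewrite /a; clearbody def S B bb; clear => hd.
    by move=> SB3 rr bb0 bbB r1 [E|[E|E]]; rewrite E in SB3 rr; lra.
  + have [l' [l'o l'n l'min]] := rem_min _ j0o.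
    have [jB [jBo jBn ejB]] := exB _ _ j0o j1o j01 b01.
    have := hC l' l'o l'n; rewrite /sg; set b' := b l' in l'min *; set bz := b j0 in b01 *.
    move=> hdef; have {hdef} : 3 / 4 * S + 3 / 4 * (1 - bz) - 3 / 8 * b' <= def.
      by move: hdef; rewrite /def ww; clearbody S b' bz; clear; lra.
    have : bz + B + (a - 2) * b' <= S.
      by rewrite -ejB; apply: sum_two.
    have : 0 <= b' by apply: b0.
    have : b' <= B by apply: bleB.
    have : 0 <= bz by apply: b0.
    have : bz <= B by apply: bleB.
    have : size o = 2%N \/ size o = 3%N \/ size o = 4%N by clear -a4 a2; lia.
    move: hd rr r1; rewrite /a; clearbody def S B b' bz; clear => hd.
    move=> rr r1 [E|[E|E]]; rewrite E in rr *; lra.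
have a5' : 5 <= a by rewrite (ler_nat R 5).
have t0 : 0 <= e - 2 by rewrite subr_ge0.
have hpb p : suffix p o -> p != [::] ->
    h <= 5 / 8 * (f p - (size p)%:R) - 3 / 8 * (1 - bb)
      + 3 / 4 * \sum_(j <- p) (1 - b j) + \sum_(j <- o | j \notin p) (1 - b j)
      - top_gain b None p.
  by move=> sp p0; rewrite /top_gain subr0; apply: hp => //; apply: lbp.
apply: top_target => //; case: hC => [hC|[j0 [j1 [j0o j1o j01 b01 [hC1 hC2]]]]].
- apply: le_trans (K None isT hpb) _; rewrite subr0.
  apply: top_indep_numeric => //.
    by have := hC lb lbo; rewrite /sg /def -/bb; clearbody S bb; clear; lra.
  rewrite /Q (sum_rem _ lBo) eB lerD2l.
  have h4 : (size (rem lB o))%:R * bb ^+ 2 <= \sum_(j <- rem lB o) b j ^+ 2.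
    apply: sum_ge_const => j /mem_rem jo; rewrite ler_pXn2r ?nnegrE ?b0 //.
    exact: lbmin.
  apply: le_trans h4; apply: ler_wpM2r; first exact: sqr_ge0.
  rewrite (ler_nat R 4) size_rem //; clear -a5; lia.
have [jB [jBo jBn ejB]] := exB _ _ j0o j1o j01 b01.
have sq j : (j \in o) -> forall c, 0 <= c -> c <= b j -> c ^+ 2 <= b j ^+ 2.
  by move=> jo c c0 cb; rewrite ler_pXn2r ?nnegrE ?b0.
have three c : 0 <= c -> 3 * c <= (a - 2) * c.
  by move=> c0; apply: ler_wpM2r => //; move: a5'; clear; lra.
have B0' : b j0 <= B by apply: bleB.
have [e0|n0] := eqVneq j0 lb; last first.
- have hgp p : suffix p o -> p != [::] ->
      h <= 5 / 8 * (f p - (size p)%:R) - 3 / 8 * (1 - bb)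
        + 3 / 4 * \sum_(j <- p) (1 - b j) + \sum_(j <- o | j \notin p) (1 - b j)
        - top_gain b (Some j0) p.
    move=> sp p0; rewrite /top_gain; case: (boolP (j0 \in p)) => jp /=.
      by rewrite mulr0 subr0; apply: hp => //; apply: lbp.
    by rewrite mulr1; apply: hC2 => //; apply: lbp.
  apply: le_trans (K (Some j0) j0o hgp) _.
  have bb_0 : bb <= b j0 by apply: lbmin.
  apply: top_dep1_numeric => //.
  + have := hC1 lb lbo; rewrite eq_sym => /(_ n0).
    by rewrite /sg /def -/bb; move: (b j0); clearbody S bb; clear => x; lra.
  + have : b j0 + b jB + (a - 2) * bb <= S by apply: sum_two => // j jo _; apply: lbmin.
    have := three bb bb0; rewrite ejB; move: ((a - 2) * bb) (b j0); clearbody S bb B.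
    by clear => x y; lra.
  + have : b j0 ^+ 2 + b jB ^+ 2 + (a - 2) * bb ^+ 2 <= Q.
      by apply: (sum_two (F := fun j => b j ^+ 2)) => // j jo _; apply: sq => //; apply: lbmin.
    have := three (bb ^+ 2) (sqr_ge0 _); rewrite ejB.
    move: ((a - 2) * bb ^+ 2) (b j0 ^+ 2) (bb ^+ 2) (B ^+ 2); clearbody Q.
    by clear => x y z u; lra.
have [l' [l'o l'n l'min]] := rem_min _ j0o.
have bl0 : 0 <= b l' by apply: b0.
have e0b : b j0 = bb by rewrite e0.
apply: le_trans (K None isT hpb) _; rewrite subr0.
apply: (@top_dep2_numeric _ _ _ _ _ bb (b l')) => //.
- exact: lbmin.
- exact: bleB.
- have := hC1 l' l'o l'n; rewrite /sg /def e0b; move: (b l'); clearbody S bb.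
  by clear => x; lra.
- have : b j0 + b jB + (a - 2) * b l' <= S by apply: sum_two.
  have := three _ bl0; rewrite ejB e0b; move: ((a - 2) * b l') (b l'); clearbody S bb B.
  by clear => x y; lra.
- have : b j0 ^+ 2 + b jB ^+ 2 + (a - 2) * b l' ^+ 2 <= Q.
    by apply: (sum_two (F := fun j => b j ^+ 2)) => // j jo jn; apply: sq => //; apply: l'min.
  have := three (b l' ^+ 2) (sqr_ge0 _); rewrite ejB e0b.
  move: ((a - 2) * b l' ^+ 2) (b l' ^+ 2) (bb ^+ 2) (B ^+ 2); clearbody Q.
  by clear => x y z u; lra.
Qed.

(** * The unbalanced bound *)

Section Unbalanced.
Context {R : realType} {d : nat} {I : finType}.

(* All logarithms; [m] bounds the rank of the point set and [N] the logarithms of the label sets.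
   For equal label sets this is 5/8 (m - k) + 3/4 k - 3/8, and 5/8 (d - k) + 3/4 k is 5/8 d + 1/8 k. *)
Definition inner_bound (eps C : R) (k : nat) :=
  forall (T : finType) (pt : T -> 'rV[R]_d) (J : {set I}) (P : I -> {set T})
    (D : I -> I -> R) (X : {set {ffun I -> T}}) (m : nat) (N : R) (i0 : I),
  nondeg J D -> (#|J| <= k)%N -> family_on pt J P D X -> X != set0 ->
  (forall j, j \in J -> {in P j &, injective pt}) ->
  (rk pt (\bigcup_(j in J) P j) <= m)%N ->
  (forall j, j \in J -> lnc (P j) <= N) -> i0 \in J ->
  lnc X <= C + eps * N + 5 / 8 * (m%:R - #|J|%:R) * N - 3 / 8 * lnc (P i0)
           + 3 / 4 * \sum_(j in J) lnc (P j).

Lemma family_rk (T : finType) (pt : T -> 'rV[R]_d) (J : {set I}) P D X :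
  nondeg J D -> family_on pt J P D X -> X != set0 ->
  (#|J| <= rk pt (\bigcup_(j in J) P j))%N.
Proof.
move=> nd [h1 h2 _] /set0Pn[x hx].
apply: leq_trans (nondeg_rk nd (x := x) _) _; first by move=> j l; apply: h2.
apply: rk_mono; apply/subsetP => _ /imsetP[j jJ ->].
by apply/bigcupP; exists j => //; apply: h1.
Qed.

Lemma cost_labels (T : finType) (pt : T -> 'rV[R]_d) (Q : I -> {set T}) (g : I -> R)
    (L : R) (o : seq I) : L != 0 ->
  \sum_(l <- labels pt Q o) g l =
  L * cost (fun l => g l / L) (fun p => (rk pt (hull Q p))%:R) o.
Proof.
move=> L0; elim: o => [|l o IH]; first by rewrite big_nil /= mulr0.
rewrite [labels _ _ _]/= big_cat /= big_nseq iter_addr_0 IH mulrDr; congr (_ + _).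
rewrite -natrB; last by apply/rk_mono/hull_sub => j hj; rewrite inE hj orbT.
by rewrite mulrCA [L * _]mulrC divfK // mulr_natl.
Qed.

Lemma hull_card (T : finType) (pt : T -> 'rV[R]_d) (A : {set I}) D X (p : seq I) :
  nondeg A D -> family_on pt A (proj X) D X -> X != set0 -> {subset p <= A} ->
  uniq p -> (size p <= rk pt (hull (proj X) p))%N.
Proof.
move=> nd [h1 h2 h3] /set0Pn[x hx] pA up.
have e : #|[set j in p]| = size p by rewrite cardsE; apply/card_uniqP.
rewrite -e; have s : [set j in p] \subset A by apply/subsetP => j; rewrite inE => /pA.
apply: leq_trans (nondeg_rk (nondeg_sub s nd) (x := x) _) _.
  by move=> j l; rewrite !inE => /pA jA /pA lA; apply: h2.
apply: rk_mono; apply/subsetP => _ /imsetP[j + ->]; rewrite inE => jp.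
by apply/bigcupP; exists j => //; apply: imset_f.
Qed.

(* The bound for a subfamily, completed by the trivial bound for the other labels. *)
Lemma prefix_bound (eps C : R) (k : nat) (T : finType) (pt : T -> 'rV[R]_d)
    (A B : {set I}) (Q : I -> {set T}) (D : I -> I -> R) (X : {set {ffun I -> T}})
    (N : R) (i0 : I) :
  inner_bound eps C k -> nondeg A D -> (#|B| <= k)%N -> B \subset A ->
  family_on pt A Q D X -> X != set0 ->
  (forall j, j \in A -> {in Q j &, injective pt}) ->
  (forall j, j \in A -> lnc (Q j) <= N) -> i0 \in B ->
  lnc X <= C + eps * N + 5 / 8 * ((rk pt (\bigcup_(j in B) Q j))%:R - #|B|%:R) * N
     - 3 / 8 * lnc (Q i0) + 3 / 4 * \sum_(j in B) lnc (Q j)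
     + \sum_(j in A :\: B) lnc (Q j).
Proof.
move=> hb nd Bk BA fX X0 inj hN i0B.
have [Y [Y0 fY hY]] := family_drops BA X0 fX.
apply: (le_trans hY); rewrite lerD2r.
apply: (hb T pt B Q D Y) => //.
- exact: nondeg_sub nd.
- by move=> j /(subsetP BA); apply: inj.
- by move=> j /(subsetP BA); apply: hN.
Qed.

Section RichFacts.
Context {T : finType} (pt : T -> 'rV[R]_d) (A : {set I}) (i : I) (P : I -> {set T})
  (D : I -> I -> R) (X : {set {ffun I -> T}}) (Y : {set T}) (m k : nat) (L C eps : R).
Hypotheses (IH : inner_bound eps C k) (nd : nondeg A D) (Ak : (#|A| <= k)%N)
  (A0 : A != set0) (fX : family_on pt A P D X) (X0 : X != set0)
  (inj : forall j, j \in A -> {in P j &, injective pt})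
  (PL : forall j, j \in A -> lnc (P j) <= L) (L0 : 0 < L)
  (eps0 : 0 <= eps) (C0 : 0 <= C)
  (cpl : forall y x j, y \in Y -> x \in X -> j \in A -> dd pt y (x j) = D i j)
  (Y0 : Y != set0) (Pm : (rk pt (Y :|: \bigcup_(j in A) P j) <= m)%N).

(* Logarithms normalized by [L], which plays the role of the logarithm of n. *)
Definition deficit j : R := (lnc (P j) - lnc (proj X j)) / L.
Definition spread j : R := lnc (proj X j) / L.
(** [labels] builds the basis from the end, so decreasing deficits make the fullest projections
    supply as many vectors as possible. *)
Definition greedy : seq I := sort (fun x y => deficit y <= deficit x) (enum A).
Definition hrk (p : seq I) : R := (rk pt (hull (proj X) p))%:R.
(** The error terms of the inductive bound are subtracted, so that the numerical lemmas are free of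
    them. *)
Definition height : R := (lnc X - (C + eps * L)) / L.
Local Notation b := deficit.
Local Notation sg := spread.
Local Notation o := greedy.
Local Notation f := hrk.

Lemma mem_greedy : o =i A.
Proof. by move=> j; rewrite mem_sort mem_enum. Qed.

Lemma greedy_uniq : uniq o.
Proof. by rewrite sort_uniq enum_uniq. Qed.

Lemma greedy_sorted : sorted (fun x y => b y <= b x) o.
Proof. by apply: sort_sorted => x y; apply: le_total. Qed.

Lemma sum_greedy (F : I -> R) : \sum_(j <- o) F j = \sum_(j in A) F j.
Proof. by rewrite (perm_big _ (permEl (perm_sort _ _))) /= big_enum. Qed.

Lemma size_greedy : size o = #|A|.
Proof. by rewrite size_sort -cardE. Qed.

Lemma greedy_nil : o != [::].
Proof. by rewrite -size_eq0 size_greedy cards_eq0. Qed.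

Lemma hrk0 : f [::] = 0.
Proof. by rewrite /hrk /hull big_pred0 // rk0. Qed.

Lemma lnc_proj j : j \in A -> lnc (proj X j) <= lnc (P j) :> R.
Proof. by move=> jA; apply: lnc_mono; apply: proj_sub fX jA. Qed.

Lemma deficit_ge0 j : j \in o -> 0 <= b j.
Proof. by rewrite mem_greedy => jA; rewrite divr_ge0 ?(ltW L0) // subr_ge0 lnc_proj. Qed.

Lemma spread_ge0 j : j \in o -> 0 <= sg j.
Proof. by move=> _; rewrite divr_ge0 ?lnc_ge0 ?(ltW L0). Qed.

Lemma deficit_spread j : b j + sg j = lnc (P j) / L.
Proof. by rewrite /deficit /spread -mulrDl subrK. Qed.

Lemma deficit_spread_le1 j : j \in o -> b j + sg j <= 1.
Proof.
by rewrite mem_greedy => jA; rewrite deficit_spread ler_pdivrMr // mul1r PL.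
Qed.

Lemma spreadE j : lnc (proj X j) = sg j * L.
Proof. by rewrite /spread divfK ?gt_eqF. Qed.

Lemma sum_spreadE (r : seq I) (PP : pred I) :
  \sum_(j <- r | PP j) lnc (proj X j) = (\sum_(j <- r | PP j) sg j) * L.
Proof. by rewrite mulr_suml; apply: eq_bigr => j _; rewrite spreadE. Qed.

Lemma height_le z : lnc X <= C + eps * L + z * L -> height <= z.
Proof. by move=> hz; rewrite /height ler_pdivrMr // lerBlDl. Qed.

Lemma hull_greedy : hull (proj X) o = \bigcup_(j in A) proj X j.
Proof. by apply: eq_bigl => j; rewrite -mem_greedy. Qed.

Lemma suffix_greedy p : suffix p o -> {subset p <= A} /\ uniq p.
Proof.
move=> /suffixP[r E]; split; last by move: greedy_uniq; rewrite E cat_uniq => /and3P[].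
by move=> j jp; rewrite -mem_greedy E mem_cat jp orbT.
Qed.

Lemma hrk_ge p : {subset p <= A} -> uniq p -> (size p)%:R <= f p.
Proof. by move=> sA up; rewrite ler_nat; apply: (hull_card nd (family_proj fX)). Qed.

Lemma hrk_tail l p : suffix (l :: p) o -> (size p)%:R <= f p.
Proof.
move=> /suffix_greedy[sA /andP[_ up]]; apply: hrk_ge => // j jp.
by apply: sA; rewrite inE jp orbT.
Qed.

Lemma hrk_total : (rk pt Y)%:R + f o <= m%:R + 1.
Proof.
rewrite natr1 /hrk -natrD ler_nat.
have /set0Pn[y0 hy0] := Y0; have /set0Pn[x1 hx1] := X0; have /set0Pn[j0 j0A] := A0.
have z0 : x1 j0 \in hull (proj X) o.
  by apply/bigcupP; exists j0; rewrite ?mem_greedy //; apply: imset_f.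
apply: leq_trans (rk_orthogonal hy0 z0 _) _.
  move=> y y' z hy hy' /bigcupP[j]; rewrite mem_greedy => jA /imsetP[x hx ->].
  by rewrite !cpl.
rewrite ltnS; apply: leq_trans Pm; apply: rk_mono; apply: setUS.
apply/bigcupsP => j; rewrite mem_greedy => jA.
by apply: (subset_trans (proj_sub fX jA)); apply: bigcup_sup.
Qed.

Lemma height_trivial : height <= \sum_(j <- o) sg j.
Proof.
apply: height_le; apply: (le_trans (family_trivial X0 (family_proj fX))).
by rewrite -sum_greedy sum_spreadE lerDr addr_ge0 // mulr_ge0 // (ltW L0).
Qed.

Lemma sum_outside (p : seq I) (F : I -> R) :
  \sum_(j in A :\: [set j in p]) F j = \sum_(j <- o | j \notin p) F j.
Proof.
rewrite [RHS]big_mkcond sum_greedy -big_mkcondr; apply: eq_bigl => j.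
by rewrite !inE andbC.
Qed.

Let QL j : j \in A -> lnc (proj X j) <= L.
Proof. by move=> jA; apply: le_trans (lnc_proj jA) (PL jA). Qed.

Let injQ j : j \in A -> {in proj X j &, injective pt}.
Proof.
move=> jA p p' /(subsetP (proj_sub fX jA)) hp /(subsetP (proj_sub fX jA)); exact: inj.
Qed.

Lemma height_prefix p l : suffix p o -> l \in p ->
  height <= 5 / 8 * (f p - (size p)%:R) - 3 / 8 * sg l
    + 3 / 4 * \sum_(j <- p) sg j + \sum_(j <- o | j \notin p) sg j.
Proof.
move=> sp lp; have [sA up] := suffix_greedy sp.
pose B := [set j in p].
have BA : B \subset A by apply/subsetP => j; rewrite inE => /sA.
have cB : #|B| = size p by rewrite cardsE; apply/card_uniqP.
have Bk : (#|B| <= k)%N by apply: leq_trans Ak; apply: subset_leq_card.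
have sB : \sum_(j in B) lnc (proj X j) = (\sum_(j <- p) sg j) * L.
  rewrite (eq_bigl (mem p)); last by move=> j; rewrite inE.
  by rewrite -big_uniq // -sum_spreadE.
have hB : \bigcup_(j in B) proj X j = hull (proj X) p.
  by apply: eq_bigl => j; rewrite inE.
apply: height_le; have lB : l \in B by rewrite inE.
have := prefix_bound IH nd Bk BA (family_proj fX) X0 injQ QL lB.
rewrite hB -/(f p) cB sB sum_outside sum_spreadE spreadE.
by move: (\sum_(j <- p) _) (\sum_(j <- o | _) _) => u v; lra.
Qed.

(** The projections serve as label sets, and their logarithms are at most M L, so N may be M L
    instead of L. *)
Lemma height_full l M : l \in A -> M = sg l -> (forall j, j \in A -> sg j <= M) ->
  height <= 5 / 8 * (f o - (size o)%:R) * M - 3 / 8 * M + 3 / 4 * \sum_(j <- o) sg j.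
Proof.
move=> lA eM hM; apply: height_le.
have ML : M * L <= L by rewrite ger_pMl // eM ler_pdivrMr // mul1r QL.
have QM j : j \in A -> lnc (proj X j) <= M * L.
  by move=> jA; rewrite spreadE ler_pM2r // hM.
have := prefix_bound IH nd Ak (subxx A) (family_proj fX) X0 injQ QM lA.
rewrite setDv big_set0 -hull_greedy -/(f o) -sum_greedy sum_spreadE spreadE -eM size_greedy addr0.
have : 0 <= eps * (L - M * L) by rewrite mulr_ge0 // subr_ge0.
by move: (\sum_(j <- o) _) (f o) => u v; lra.
Qed.

Lemma cost_greedy :
  \sum_(l <- labels pt (proj X) o) (lnc (P l) - lnc (proj X l)) = L * cost b f o.
Proof. by rewrite (cost_labels _ _ _ _ (lt0r_neq0 L0)). Qed.

Lemma max_spread : exists2 l, l \in A & forall j, j \in A -> sg j <= sg l.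
Proof.
have /set0Pn[j0 j0A] := A0.
pose l := [arg max_(j > j0 in A) #|proj X j|]%N.
have [lA lmax] : l \in A /\ forall j, j \in A -> (#|proj X j| <= #|proj X l|)%N.
  by rewrite /l; case: arg_maxnP.
exists l => // j /lmax/(ln_nat_mono (R := R)) hj.
by rewrite /spread ler_pM2r ?invr_gt0.
Qed.

Hypotheses (eL : lnc (P i) = L) (rY : (3 <= rk pt Y)%N) (YL : lnc Y <= L).

Lemma inner_rich : L / 8 < lnc Y ->
  rich_bound pt A i P (C + eps * L + (5 / 8 * (m%:R - #|A|%:R - 1) * L - 3 / 8 * L
     + 3 / 4 * (L + \sum_(j in A) lnc (P j)))) Y X.
Proof.
move=> tY; have [lM lMA hM] := max_spread.
(* e is the dimension of the hull of Y, and w bounds the rank left for the hull of the projections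
   by [hrk_total]. *)
pose e : R := (rk pt Y)%:R - 1; pose w := m%:R - e; pose a : R := #|A|%:R.
pose rho := lnc Y / L.
pose TT := 5 / 8 * (w + e - (size o)%:R - 1) - 3 / 8
    + 3 / 4 * (1 + \sum_(j <- o) (b j + sg j)).
have lMo : lM \in o by rewrite mem_greedy.
have hMo j : j \in o -> sg j <= sg lM by rewrite mem_greedy; apply: hM.
have r8 : 1 / 8 <= rho by rewrite /rho ler_pdivlMr //; lra.
have r1 : rho <= 1 by rewrite /rho ler_pdivrMr // mul1r.
have e2 : 2 <= e by move: rY; rewrite -(ler_nat R) /e; lra.
have fw : f o <= w by have := hrk_total; rewrite /w /e; lra.
pose full := (m.+1 <= rk pt Y + #|A|)%N.
have af : a <= f o.
  rewrite /a -size_greedy; apply: hrk_ge greedy_uniq => j; by rewrite mem_greedy.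
have wfull : full -> w = (size o)%:R.
  rewrite /full size_greedy -/a -(ler_nat R) natrD -natr1 -/a => h.
  apply/eqP; rewrite eq_le (le_trans af fw) andbT /w /e; move: h; lra.
have wnfull : ~~ full -> (size o)%:R + 1 <= w.
  rewrite /full -ltnNge ltnS size_greedy -/a -(ler_nat R) natrD -/a /w /e; lra.
have hp p : suffix p o -> p != [::] ->
     height <= 5 / 8 * (f p - (size p)%:R) - 3 / 8 * sg lM * (lM \in p)%:R
        + 3 / 4 * \sum_(j <- p) sg j + \sum_(j <- o | j \notin p) sg j.
  move=> sp p0; case: (boolP (lM \in p)) => lp.
    by rewrite mulr1; apply: height_prefix.
  have [l lp'] : exists l, l \in p.
    by case: (p) p0 => // l p' _; exists l; rewrite mem_head.
  have := height_prefix sp lp'; have lo : l \in o.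
    by rewrite mem_greedy; apply: (suffix_greedy sp).1.
  have := spread_ge0 lo; rewrite mulr0; lra.
have eU : C + eps * L + (5 / 8 * (m%:R - a - 1) * L - 3 / 8 * L
     + 3 / 4 * (L + \sum_(j in A) lnc (P j))) = C + eps * L + TT * L.
  rewrite /TT /w size_greedy -/a.
  have -> : \sum_(j <- o) (b j + sg j) = (\sum_(j in A) lnc (P j)) / L.
    by rewrite sum_greedy mulr_suml; apply: eq_bigr => j _; rewrite deficit_spread.
  by field; rewrite gt_eqF.
rewrite /rich_bound eU eL.
have [H|H] := inner_list_numeric hrk0 greedy_nil greedy_uniq greedy_sorted deficit_ge0
  spread_ge0 deficit_spread_le1 e2 r8 r1 lMo erefl hMo fw wfull wnfull hrk_tail (erefl TT)
  height_trivial hp (height_full lMA erefl hM).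
- left; have := ler_wpM2r (ltW L0) H.
  have -> : (height + rho + (e + 1) * (1 - rho)) * L =
     lnc X - (C + eps * L) + lnc Y + (rk pt Y)%:R * (L - lnc Y).
    by rewrite /height /rho /e; field; rewrite gt_eqF.
  by move: (TT * L) (C + eps * L) (_%:R * _) => t1 t2 t3; lra.
- right; exists o; split; [exact: greedy_uniq | exact: mem_greedy | rewrite cost_greedy].
  have := ler_wpM2r (ltW L0) H.
  have -> : (height + rho + cost b f o) * L =
     lnc X - (C + eps * L) + lnc Y + L * cost b f o.
    by rewrite /height /rho; field; rewrite gt_eqF.
  by move: (TT * L) (C + eps * L) (L * _) => t1 t2 t3; lra.
Qed.

End RichFacts.

End Unbalanced.

Lemma small_eps (R : realType) (I : finType) (eps : R) : 0 < eps -> exists q : nat, #|I|%:R / q.+1%:R <= eps.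
Proof.
move=> e0; exists (Num.bound (#|I|%:R / eps)).
rewrite ler_pdivrMr // mulrC -ler_pdivrMr //; apply: ltW.
apply: (lt_trans (archi_boundP _)); first by rewrite divr_ge0 // ltW.
by rewrite ltr_nat.
Qed.

Section Inner.
Context {R : realType} {d : nat} {I : finType}.
Local Notation inner_bound := (@inner_bound R d I).

(** With one label there is nothing to peel: rank 1 is a single point, and from rank 2 on 5/8 - 3/8
    + 3/4 = 1 covers the trivial bound. *)
Lemma inner_single (T : finType) (pt : T -> 'rV[R]_d) (i : I) (P : I -> {set T})
    (D : I -> I -> R) (X : {set {ffun I -> T}}) (m : nat) (L : R) :
  family_on pt [set i] P D X -> X != set0 -> {in P i &, injective pt} ->
  (rk pt (P i) <= m)%N -> lnc (P i) <= L ->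
  lnc X <= 5 / 8 * (m%:R - 1) * L - 3 / 8 * lnc (P i) + 3 / 4 * lnc (P i).
Proof.
move=> fX X0 inj hm hL.
have := family_trivial X0 fX; rewrite big_set1 => h.
have L0 : 0 <= L by apply: le_trans hL; apply: lnc_ge0.
case: m hm => [|[|m]] hm.
- have /set0Pn[x hx] := X0; have xP : x i \in P i by case: fX => + _ _; apply; rewrite ?inE.
  have := rk_mono pt (_ : [set x i] \subset P i); rewrite sub1set rk1 => /(_ xP).
  by move: hm; rewrite leqn0 => /eqP ->.
- suff e : lnc (P i) = 0 :> R by rewrite e in h *; lra.
  suff c : (#|P i| <= 1)%N.
    apply/eqP; rewrite eq_le lnc_ge0 andbT.
    by have := ln_nat_mono (R := R) c; rewrite mulr1n ln1.
  apply/card_le1_eqP => y y' hy hy'; apply: inj => //; apply/eqP; apply: contraT => ne.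
  have s : [set y; y'] \subset P i by apply/subsetP => t /set2P[]->.
  by have := leq_trans (rk_mono pt s) hm; rewrite rk2 // eq_sym.
- have : 0 <= m%:R * L by apply: mulr_ge0.
  have -> : m.+2%:R = m%:R + 2 :> R by rewrite -addn2 natrD.
  lra.
Qed.

Lemma inner_step (eps C : R) (k q : nat) : 0 < eps -> 0 <= C ->
  #|I|%:R / q.+1%:R <= eps -> inner_bound eps C k ->
  inner_bound (eps + eps) (C + `|ln (@peel_const R d I q)|) k.+1.
Proof.
move=> eps0 C0 hq IH T pt J P D X m N i0 nd Jk fX X0 inj hm hN i0J.
(* Removing the largest set makes L bound all logarithms, and -3/8 L is the strongest form of the
   claim. *)
pose i := [arg max_(j > i0 in J) #|P j|]%N.
have [iJ imax] : i \in J /\ forall j, j \in J -> (#|P j| <= #|P i|)%N.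
  by rewrite /i; case: arg_maxnP.
pose L : R := lnc (P i).
have L0 : 0 <= L by apply: lnc_ge0.
have LN : L <= N by apply: hN.
have hL j : j \in J -> lnc (P j) <= L by move=> /imax/(ln_nat_mono (R := R)).
have Jm : (#|J| <= m)%N by apply: leq_trans hm; apply: family_rk fX X0.
have Jm' : 0 <= m%:R - #|J|%:R :> R by rewrite subr_ge0 ler_nat.
set c := `|ln _|; have c0 : 0 <= c by apply: normr_ge0.
suff : lnc X <= C + c + (eps + eps) * L + 5 / 8 * (m%:R - #|J|%:R) * L - 3 / 8 * L
           + 3 / 4 * \sum_(j in J) lnc (P j).
  move=> h; apply: (le_trans h); rewrite lerD2r.
  have h1 : 0 <= eps * (N - L) by apply: mulr_ge0; lra.
  have h2 : 0 <= (m%:R - #|J|%:R) * (N - L) by apply: mulr_ge0; lra.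
  have h3 := hL _ i0J; lra.
have eL0 : 0 <= eps * L by apply: mulr_ge0; lra.
pose A := J :\ i.
have JA : #|J| = #|A|.+1 by rewrite (cardsD1 i) iJ.
have Ak : (#|A| <= k)%N by rewrite -ltnS -JA.
have AJ : A \subset J by apply: subD1set.
have iA : i \notin A by rewrite !inE eqxx.
have eJ : J = i |: A by rewrite setD1K.
have [A0|A0] := eqVneq A set0.
  have eJ1 : J = [set i] by rewrite eJ A0 setU0.
  rewrite eJ1 cards1 big_set1.
  rewrite eJ1 in fX hm; rewrite big_set1 in hm.
  have := inner_single fX X0 (inj i iJ) hm (lexx _); rewrite -/L; lra.
have ndA := nondeg_sub AJ nd.
have /set0Pn[x0 hx0] := X0.
pose XA := restr A x0 @: X.
have fXA : family_on pt A P D XA by apply: family_restr fX.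
have XA0 : XA != set0 by apply/set0Pn; exists (restr A x0 x0); apply: imset_f.
pose a := #|A|; pose mr : R := m%:R; pose ar : R := a%:R.
have Jr : #|J|%:R = ar + 1 :> R by rewrite JA -natr1.
rewrite Jr in Jm' *.
pose SJ : R := \sum_(j in A) lnc (P j).
have eSJ : \sum_(j in J) lnc (P j) = L + SJ by rewrite (big_setD1 i).
rewrite eSJ.
pose U := C + eps * L + (5 / 8 * (mr - ar - 1) * L - 3 / 8 * L + 3 / 4 * (L + SJ)).
have Pm : (rk pt (\bigcup_(j in A) P j) <= m)%N.
  apply: leq_trans hm; apply: rk_mono; apply/bigcupsP => j /(subsetP AJ) jJ.
  exact: bigcup_sup.
(* The new vertex adds 3/4 - 5/8 = 1/8 to the exponent, so links with at most exp(L/8) points fit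
   into U. *)
have poor : lnc XA + L / 8 <= U.
  have /set0Pn[j0 j0A] := A0.
  pose i1 := [arg max_(j > j0 in A) #|P j|]%N.
  have [i1A i1max] : i1 \in A /\ forall j, j \in A -> (#|P j| <= #|P i1|)%N.
    by rewrite /i1; case: arg_maxnP.
  have hmu j : j \in A -> lnc (P j) <= lnc (P i1) :> R.
    by move=> /i1max/(ln_nat_mono (R := R)).
  have injA j : j \in A -> {in P j &, injective pt}.
    by move=> /(subsetP AJ); apply: inj.
  have := IH T pt A P D XA m _ i1 ndA Ak fXA XA0 injA Pm hmu i1A.
  have muL := hL _ (subsetP AJ _ i1A).
  have mu0 : 0 <= lnc (P i1) :> R by apply: lnc_ge0.
  rewrite -/SJ -/a -/mr -/ar; set mu := lnc (P i1) in muL mu0 * => h.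
  have h1 : 0 <= (mr - ar - 1) * (L - mu) by apply: mulr_ge0; rewrite /mr; lra.
  have h2 : 0 <= eps * (L - mu) by apply: mulr_ge0; lra.
  by rewrite /U; lra.
have rich : forall (Y : {set T}) (X' : {set {ffun I -> T}}), Y \subset P i -> X' \subset XA ->
    X' != set0 -> (forall y x j, y \in Y -> x \in X' -> j \in A -> dd pt y (x j) = D i j) ->
    (3 <= rk pt Y)%N -> L / 8 < lnc Y -> rich_bound pt A i P U Y X'.
  move=> Y X' YP X'A X'0 cpl rY tY.
  have YL := lnc_mono (R := R) YP.
  have Lp : 0 < L by move: tY YL; rewrite -/L; clear; lra.
  have Y0 : Y != set0 by apply: contraTN rY => /eqP ->; rewrite rk0.
  apply: (inner_rich IH ndA Ak A0 (family_sub X'A fXA) X'0) => //.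
  - by move=> j /(subsetP AJ); apply: inj.
  - by move=> j /(subsetP AJ); apply: hL.
  - exact: ltW.
  - apply: leq_trans hm; apply: rk_mono; rewrite eJ big_setU1 //=.
    by rewrite setSU.
have L8 : 0 <= L / 8 by apply: divr_ge0.
have := peel q (inj i iJ) A0 L8 L0 _ fXA poor rich.
move=> /(_ (fun j jA => hL j (subsetP AJ j jA))) pb.
have cX : (#|X| <= \sum_(y in XA) #|link pt A i P D y|)%N.
  apply: (card_restr (F := link pt A i P D) fX) => x hx; apply/linkP.
  case: fX => h1 h2 _; split; first exact: h1.
  by move=> j jA; rewrite restrE // h2 // (subsetP AJ).
have X1 : 1 <= #|X|%:R :> R by rewrite ler1n card_gt0.
have {}pb : #|X|%:R <= @peel_const R d I q * expR (U + #|I|%:R / q.+1%:R * L).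
  by apply: le_trans pb; rewrite ler_nat.
have K0 : 0 < @peel_const R d I q.
  rewrite -(pmulr_lgt0 _ (expR_gt0 (U + #|I|%:R / q.+1%:R * L))).
  by apply: lt_le_trans pb; lra.
have : lnc X <= ln (@peel_const R d I q) + (U + #|I|%:R / q.+1%:R * L).
  rewrite -[Z in _ + Z]expRK -lnM ?posrE ?expR_gt0 // ler_ln // posrE.
    exact: lt_le_trans ltr01 X1.
  exact: mulr_gt0 K0 (expR_gt0 _).
have := ler_norm (ln (@peel_const R d I q)); rewrite -/c.
have := ler_wpM2r L0 hq; move: (#|I|%:R / q.+1%:R * L) (ln _) => z1 z2.
by clear rich poor; rewrite /U /mr; lra.
Qed.

Lemma inner k eps : 0 < eps -> exists2 C : R, 0 <= C & inner_bound eps C k.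
Proof.
elim: k eps => [|k IH] eps eps0.
  exists 0 => // T pt J P D X m N i0 _; rewrite leqn0 cards_eq0 => /eqP -> _ _ _ _ _.
  by rewrite inE.
have e2 : 0 < eps / 2 by rewrite divr_gt0.
have [C C0 hC] := IH _ e2.
have [q hq] := small_eps I e2.
exists (C + `|ln (@peel_const R d I q)|); first by rewrite addr_ge0.
have -> : eps = eps / 2 + eps / 2 by lra.
exact: inner_step.
Qed.

End Inner.

(** * The balanced bound *)

Section Center.
Context {R : realType} {d : nat} {T I : finType} (pt : T -> 'rV[R]_d).
Context (A : {set I}) (i : I) (P : I -> {set T}) (D : I -> I -> R)
  (X : {set {ffun I -> T}}) (Y : {set T}).
Hypotheses (A0 : A != set0) (iA : i \notin A) (X0 : X != set0) (Y0 : Y != set0)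
  (fX : family_on pt A P D X)
  (cpl : forall y x j, y \in Y -> x \in X -> j \in A -> dd pt y (x j) = D i j).

(** The center is the foot of the perpendicular from any vertex of any tuple to the hull of Y.
    Differences of such vertices are orthogonal to that hull, so the foot is always the same;
    Pythagoras gives both distances. *)
Lemma center_exists : exists q r2,
  (forall x j, x \in X -> j \in A -> sqdist q (pt (x j)) = D i j - r2) /\
  (forall y, y \in Y -> sqdist (pt y) q = r2).
Proof.
have /set0Pn[y0 hy0] := Y0; have /set0Pn[x1 hx1] := X0; have /set0Pn[j0 j0A] := A0.
have [u u1 u2] := proj_exists [seq pt y - pt y0 | y <- enum Y] (pt (x1 j0) - pt y0).
have orth x j y : x \in X -> j \in A -> y \in Y ->
    dot (pt (x j) - (pt y0 + u)) (pt y - pt y0) = 0.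
  move=> hx jA hy.
  have : pt y - pt y0 \in [seq pt y - pt y0 | y <- enum Y].
    by apply: (map_f (fun y => pt y - pt y0)); rewrite mem_enum.
  move=> /u1.
  have := cpl hy hx jA; have := cpl hy0 hx jA.
  have := cpl hy hx1 j0A; have := cpl hy0 hx1 j0A.
  rewrite /dd !sqdistE !dotE (dotC (pt (x j)) (pt y)) (dotC (pt (x j)) (pt y0)).
  rewrite (dotC (pt (x1 j0)) (pt y)) (dotC (pt (x1 j0)) (pt y0)) (dotC u (pt y)) (dotC u (pt y0)).
  lra.
have orthu x j : x \in X -> j \in A -> dot (pt (x j) - (pt y0 + u)) u = 0.
  by move=> hx jA; apply: u2 => v /mapP[y]; rewrite mem_enum => hy ->; apply: orth.
exists (pt y0 + u), (dot u u); split.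
  move=> x j hx jA; rewrite -(cpl hy0 hx jA) /dd (sqdistC (pt y0)) sqdistC !sqdistE.
  have -> : pt (x j) - pt y0 = pt (x j) - (pt y0 + u) + u by rewrite opprD addrA subrK.
  have := orthu x j hx jA; move: (pt (x j) - (pt y0 + u)) => v hv.
  by rewrite dotDl !dotDr (dotC u v) hv; ring.
move=> y hy.
have := cpl hy hx1 j0A; rewrite -(cpl hy0 hx1 j0A) /dd !(sqdistC _ (pt (x1 j0))) !sqdistE.
have -> : pt (x1 j0) - pt y0 = pt (x1 j0) - (pt y0 + u) + u.
  by rewrite opprD addrA subrK.
have -> : pt (x1 j0) - pt y = pt (x1 j0) - (pt y0 + u) + u - (pt y - pt y0).
  by rewrite opprD addrA subrK opprB addrA subrK.
have -> : pt y - (pt y0 + u) = pt y - pt y0 - u by rewrite opprD addrA.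
move: (orth x1 j0 y hx1 j0A hy) (orthu x1 j0 hx1 j0A).
move: (pt (x1 j0) - (pt y0 + u)) (pt y - pt y0) => v g h1 h2.
rewrite !dotE (dotC u v) (dotC g v) (dotC g u) h1 h2; lra.
Qed.

Context (q : 'rV[R]_d) (r2 : R).
Hypotheses (qX : forall x j, x \in X -> j \in A -> sqdist q (pt (x j)) = D i j - r2)
  (qY : forall y, y \in Y -> sqdist (pt y) q = r2).

Definition cpt (t : option T) : 'rV[R]_d := if t is Some s then pt s else q.

Definition cdist (j l : I) : R :=
  if j == i then (if l == i then 0 else D i l - r2)
  else if l == i then D i j - r2 else D j l.

Definition cslot (j : I) : {set option T} :=
  if j == i then [set None] else Some @: proj X j.

Definition cemb (x : {ffun I -> T}) : {ffun I -> option T} :=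
  [ffun j => if j == i then None else Some (x j)].

Lemma rk_Some (Z : {set T}) : rk cpt (Some @: Z) = rk pt Z.
Proof. by rewrite /rk /aff big_imset //= => x y _ _ []. Qed.

Lemma family_center (A' : {set I}) P' : A' \subset A -> family_on pt A' P' D X ->
  family_on cpt (i |: A') cslot cdist (cemb @: X).
Proof.
move=> /subsetP s [_ h2 h3].
have ni j : j \in A' -> (j == i) = false.
  by move=> /s jA; apply: contraNF iA => /eqP <-.
split.
- move=> _ j /imsetP[x hx ->] _; rewrite /cslot ffunE; case: eqP => _; first by rewrite inE.
  by apply: (imset_f Some); apply: imset_f.
- move=> _ j l /imsetP[x hx ->] /setU1P[->|jA] /setU1P[->|lA];
    rewrite /cdist /dd !ffunE ?eqxx ?ni //=.
  + exact: sqdistxx.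
  + by rewrite qX // s.
  + by rewrite sqdistC qX // s.
  + exact: h2.
- move=> _ _ /imsetP[x hx ->] /imsetP[y hy ->] e; congr cemb; apply: h3 => // j jA.
  by have := e j; rewrite !inE jA orbT !ffunE ni // => /(_ isT) [].
Qed.

Lemma card_cemb (A' : {set I}) P' : A' \subset A -> family_on pt A' P' D X ->
  #|cemb @: X| = #|X|.
Proof.
move=> /subsetP s [_ _ h3]; apply: card_in_imset => x y hx hy e.
apply: h3 => // j jA; have := congr1 (fun f : {ffun I -> option T} => f j) e.
have ne : (j == i) = false by apply: contraNF iA => /eqP <-; apply: s.
by rewrite !ffunE ne => -[].
Qed.

(** The center is equidistant from the points of Y too, so the hull enlarged by it remains
    orthogonal to that of Y and the center takes no dimension away. *)
Lemma center_rk : (rk pt Y + rk cpt (\bigcup_(j in i |: A) cslot j) <= d.+2)%N.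
Proof.
have /set0Pn[y0 hy0] := Y0.
have cl z : z \in \bigcup_(j in i |: A) cslot j ->
    z = None \/ exists x j, [/\ x \in X, j \in A & z = Some (x j)].
  move=> /bigcupP[j /setU1P[->|jA]]; rewrite /cslot ?eqxx.
    by rewrite inE => /eqP; left.
  have -> : (j == i) = false by apply: contraNF iA => /eqP <-.
  by move=> /imsetP[_ /imsetP[x hx ->] ->]; right; exists x, j.
rewrite -rk_Some; apply: leq_trans (rk_orthogonal (y0 := Some y0) (z0 := None) _ _ _) _.
- exact: imset_f.
- by apply/bigcupP; exists i; rewrite ?setU11 // /cslot eqxx inE.
- move=> _ _ z /imsetP[y hy ->] /imsetP[y' hy' ->] /cl[->|[x [j [hx jA ->]]]].
    by rewrite /dd /= !qY.
  by have := cpl hy hx jA; have := cpl hy' hx jA; rewrite /dd /= => -> ->.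
- by rewrite ltnS rk_max.
Qed.

(** Compared with the bound for X alone, the number of labels grows by one and the new slot has
    logarithm 0: a gain of 5/8 L. *)
Lemma center_bound (eps C L : R) (k : nat) (A' : {set I}) l : @inner_bound R d I eps C k ->
  A' \subset A -> (#|A'| < k)%N -> nondeg (i |: A') cdist -> family_on pt A' P D X ->
  (forall j, j \in A -> {in P j &, injective pt}) ->
  (forall j, j \in A -> lnc (P j) <= L) -> 0 <= L -> l \in A' ->
  lnc X <= C + eps * L + 5 / 8 * (d%:R + 2 - (rk pt Y)%:R - (#|A'|%:R + 1)) * L
     - 3 / 8 * lnc (proj X l) + 3 / 4 * \sum_(j in A') lnc (proj X j).
Proof.
move=> hb sA Ak nd fA' inj PL L0 lA'.
have ni j : j \in A' -> (j == i) = false.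
  by move=> /(subsetP sA) jA; apply: contraNF iA => /eqP <-.
have iA' : i \notin A' by apply: contraNN iA; apply: (subsetP sA).
have cs j : j \in A' -> lnc (cslot j) = lnc (proj X j) :> R.
  by move=> jA; rewrite /cslot ni // /lnc card_imset // => x y [].
have PX j : j \in A -> proj X j \subset P j by apply: proj_sub fX.
have csi : lnc (cslot i) = 0 :> R by rewrite /cslot eqxx /lnc cards1 ln1.
have rkm : (rk cpt (\bigcup_(j in i |: A') cslot j) <= d.+2 - rk pt Y)%N.
  rewrite leq_subRL; last by apply: leq_trans (rk_max _ _) _.
  apply: leq_trans center_rk; rewrite leq_add2l; apply: rk_mono.
  by apply/bigcupsP => j hj; apply: bigcup_sup; move: hj; apply/subsetP/setUS.
have := hb _ cpt (i |: A') cslot cdist (cemb @: X) _ L l nd _ (family_center sA fA') _ _ rkm.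
rewrite cardsU1 iA' /= add1n -[#|A'|.+1]addn1 natrD.
rewrite big_setU1 //= csi add0r (eq_bigr _ cs) (cs l) //.
have -> : lnc (cemb @: X) = lnc X :> R by rewrite /lnc (card_cemb sA fA').
rewrite natrB; last by apply: leq_trans (rk_max _ _) _.
rewrite -[d.+2]addn2 natrD; apply => //.
- by rewrite addn1.
- by rewrite imset_eq0.
- move=> j /setU1P[->|jA]; rewrite /cslot ?eqxx ?ni //.
    by move=> t t' /set1P-> /set1P->.
  have jA1 := subsetP sA j jA.
  move=> _ _ /imsetP[t ht ->] /imsetP[t' ht' ->] /= e; congr Some.
  by apply: (inj j) => //; apply: (subsetP (PX j jA1)).
- move=> j /setU1P[->|jA]; first by rewrite csi.
  have jA1 := subsetP sA j jA; rewrite cs //.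
  exact: le_trans (lnc_mono (PX j jA1)) (PL j jA1).
- by rewrite setU1r.
Qed.

End Center.

Section TopRich.
Context {R : realType} {d : nat} {T I : finType} (pt : T -> 'rV[R]_d).
Context (A : {set I}) (i : I) (P0 : {set T}) (D : I -> I -> R)
  (X : {set {ffun I -> T}}) (Y : {set T}) (k : nat) (C eps : R).
Local Notation P := (fun _ : I => P0).
Local Notation L := (lnc P0 : R).
Hypotheses (IH : @inner_bound R d I eps C k) (nd : nondeg A D) (Ak : (#|A| < k)%N)
  (A0 : A != set0) (iA : i \notin A) (fX : family_on pt A P D X) (X0 : X != set0)
  (inj : {in P0 &, injective pt}) (L0 : 0 < L) (eps0 : 0 <= eps) (C0 : 0 <= C)
  (cpl : forall y x j, y \in Y -> x \in X -> j \in A -> dd pt y (x j) = D i j)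
  (YP : Y \subset P0) (rY : (3 <= rk pt Y)%N)
  (good : forall j, j \in A -> exists l, [/\ l \in A, l != j & D i l != D i j + D j l]).

Local Notation b := (deficit P X L).
Local Notation sg := (spread X L).
Local Notation o := (greedy A P X L).
Local Notation f := (hrk pt X).
Local Notation h := (height X L C eps).
Local Notation a := (#|A|%:R : R).
Local Notation w := (d%:R + 2 - (rk pt Y)%:R : R).

Let Y0 : Y != set0.
Proof. by apply: contraTN rY => /eqP ->; rewrite rk0. Qed.

Let PL j : j \in A -> lnc (P j) <= L. Proof. by []. Qed.

Let injA j : j \in A -> {in P j &, injective pt}. Proof. by move=> _; apply: inj. Qed.

(* Either the circumcenter of [Y] joins the label set as a new nondegenerate vertex, or it is an
   affine combination of the other vertices, in which at least two of them occur. *)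
Lemma center_dichotomy :
  (forall l, l \in A -> h <= 5 / 8 * (w - (a + 1)) - 3 / 8 * sg l
        + 3 / 4 * \sum_(j in A) sg j) \/
  (exists j0 j1, [/\ j0 \in A, j1 \in A, j0 != j1, b j0 <= b j1 &
     family_on pt (A :\ j0) P D X /\
     forall l, l \in A -> l != j0 -> h <= 5 / 8 * (w - a) - 3 / 8 * sg l
        + 3 / 4 * (\sum_(j in A) sg j - sg j0)]).
Proof.
have [q [r2 [qX qY]]] := center_exists A0 X0 Y0 cpl.
pose D' := cdist i D r2.
have bnd (A' : {set I}) l : A' \subset A -> nondeg (i |: A') D' ->
    family_on pt A' P D X -> l \in A' ->
    h <= 5 / 8 * (w - (#|A'|%:R + 1)) - 3 / 8 * sg l + 3 / 4 * \sum_(j in A') sg j.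
  move=> sA nd' fA' lA'.
  have Ak' : (#|A'| < k)%N by apply: leq_ltn_trans Ak; apply: subset_leq_card.
  have H := center_bound iA X0 Y0 fX cpl qX qY IH sA Ak' nd' fA' injA PL (ltW L0) lA'.
  apply: (height_le L0).
  have e : \sum_(j in A') lnc (proj X j) = (\sum_(j in A') sg j) * L.
    by rewrite mulr_suml; apply: eq_bigr => j _; rewrite (spreadE X L0).
  rewrite e (spreadE X L0 l) in H; move: H.
  move: (\sum_(j in A') sg j) (sg l) (#|A'|%:R) => s1 s2 s3; lra.
have [nd'|] := pselect (nondeg (i |: A) D').
  by left=> l lA; apply: bnd fX lA.
move=> /existsNP[c] /not_implyP[cs] /not_implyP[csum] /not_implyP[cq] /existsNP[jc /eqP cj].
right; have /set0Pn[x hx] := X0.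
(* a vanishing quadratic form of squared distances is a vanishing combination *)
pose px z j := cpt pt q (cemb i z j).
have dist z j l : z \in X -> j \in i |: A -> l \in i |: A ->
    sqdist (px z j) (px z l) = D' j l.
  move=> hz; have [_ + _] := family_center iA qX (subxx A) fX.
  by move=> H jA lA; apply: H => //; apply: imset_f.
have quad z (v : I -> R) : z \in X -> (forall j, j \notin i |: A -> v j = 0) ->
    \sum_j v j = 0 -> \sum_j \sum_l v j * v l * D' j l
      = - 2 * dot (\sum_j v j *: px z j) (\sum_j v j *: px z j).
  move=> hz vs v0; rewrite -sum_sqdist //.
  apply: eq_bigr => j _; apply: eq_bigr => l _.
  have [jA|/vs ->] := boolP (j \in i |: A); last by rewrite !mul0r.
  have [lA|/vs ->] := boolP (l \in i |: A); last by rewrite mulr0 !mul0r.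
  by rewrite dist.
have lin z (v : I -> R) : z \in X -> (forall j, j \notin i |: A -> v j = 0) ->
    \sum_j v j = 0 -> \sum_j \sum_l v j * v l * D' j l = 0 -> \sum_j v j *: px z j = 0.
  move=> hz vs v0 vq; apply: dotxx_eq0.
  by have := quad z v hz vs v0; rewrite vq; lra.
have clin z : z \in X -> \sum_j c j *: px z j = 0 by move=> hz; apply: lin.
have D'A j l : j \in A -> l \in A -> D' j l = D j l.
  move=> jA lA; rewrite /D' /cdist.
  have -> : (j == i) = false by apply: contraNF iA => /eqP <-.
  by have -> : (l == i) = false by apply: contraNF iA => /eqP <-.
have onA (v : I -> R) : (forall j, j \notin A -> v j = 0) -> \sum_j v j = 0 ->
    \sum_j v j *: px x j = 0 -> forall j, v j = 0.
  move=> vs v0 vl; apply: nd => //.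
  have vs' j : j \notin i |: A -> v j = 0.
    by move=> hj; apply: vs; apply: contraNN hj => jA; rewrite inE jA orbT.
  have := quad x v hx vs' v0; rewrite vl dot0l mulr0 => e; rewrite -[RHS]e.
  apply: eq_bigr => j _; apply: eq_bigr => l _.
  have [jA|/vs ->] := boolP (j \in A); last by rewrite !mul0r.
  have [lA|/vs ->] := boolP (l \in A); last by rewrite mulr0 !mul0r.
  by rewrite D'A.
have ci : c i != 0.
  apply: contraNN cj => /eqP ci; apply/eqP; apply: onA => //; last exact: clin.
  move=> j jA; have [->//|ji] := eqVneq j i.
  by apply: cs; rewrite !inE negb_or ji.
have pxA z j : j \in A -> px z j = pt (z j).
  move=> jA; rewrite /px ffunE; have -> : (j == i) = false => //.
  by apply: contraNF iA => /eqP <-.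
have pxi z : px z i = q by rewrite /px ffunE eqxx.
(* If only j0 occurred besides the center, the center would be the vertex j0, and all triangles i,
   j0, l would have a right angle at j0, contrary to [good]. *)
have [j0 [j1 [j0A j1A j01 c0 c1]]] : exists j0 j1, [/\ j0 \in A, j1 \in A, j0 != j1,
    c j0 != 0 & c j1 != 0].
  have [j0 j0A c0] : exists2 j, j \in A & c j != 0.
    apply: contrapT => H; move/eqP: ci; apply.
    rewrite -csum (bigD1 i) //= big1 ?addr0 // => j ji.
    have [jA|jA] := boolP (j \in A); last by apply: cs; rewrite !inE negb_or ji.
    by apply/eqP; apply: contrapT => /negP cj0; apply: H; exists j.
  exists j0; apply: contrapT => H.
  have c0' l : l \in A -> l != j0 -> c l = 0.
    move=> lA lj; apply/eqP; apply: contrapT => /negP cl; apply: H; exists l.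
    by split=> //; rewrite eq_sym.
  have out l : l != i -> l != j0 -> c l = 0.
    move=> li lj; have [lA|lA] := boolP (l \in A); first exact: c0'.
    by apply: cs; rewrite !inE negb_or li.
  have j0i : j0 != i by apply: contraNN iA => /eqP <-.
  have e1 : c j0 = - c i.
    move: csum; rewrite (bigD1 i) //= (bigD1 j0) //= big1 ?addr0; last first.
      by move=> l /andP[li lj]; apply: out.
    by move=> e; apply/eqP; rewrite -addr_eq0 addrC e.
  have e2 : pt (x j0) = q.
    have := clin x hx; rewrite (bigD1 i) //= (bigD1 j0) //= big1 ?addr0; last first.
      by move=> l /andP[li lj]; rewrite out // scale0r.
    rewrite e1 scaleNr pxi pxA // -scalerBr => /eqP.
    by rewrite scaler_eq0 (negbTE ci) subr_eq0 => /eqP.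
  have [l [lA lj /eqP gl]] := good j0A; apply: gl.
  have [_ hD _] := fX.
  have h1 := qX x j0 hx j0A; rewrite -e2 sqdistxx in h1.
  by have := qX x l hx lA; rewrite -e2 -(hD x j0 l) // /dd; lra.
(* The relation is symmetric in j0 and j1; the label of smaller deficit is the one to be
   forgotten. *)
wlog b01 : j0 j1 j0A j1A j01 c0 c1 / b j0 <= b j1.
  move=> H; have [hb|hb] := leP (b j0) (b j1); first exact: (H j0 j1).
  by apply: (H j1 j0) => //; [rewrite eq_sym | exact: ltW].
(* Vertex j0 is determined by the other vertices and the center, which is the same for all tuples of
   X. *)
have fX' : family_on pt (A :\ j0) P D X.
  have [h1 h2 h3] := fX; split.
  - by move=> z j hz /setD1P[_]; apply: h1.
  - by move=> z j l hz /setD1P[_ jA] /setD1P[_ lA]; apply: h2.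
  move=> z z' hz hz' e; apply: h3 => // j jA.
  have [->|jj] := eqVneq j j0; last by apply: e; rewrite !inE jj.
  apply: inj; [exact: h1 | exact: h1 |].
  have e0 : \sum_j c j *: px z j = \sum_j c j *: px z' j by rewrite !clin.
  move: e0; rewrite (bigD1 j0) //= [RHS](bigD1 j0) //=.
  rewrite (eq_bigr (fun j => c j *: px z' j)); last first.
    move=> l lj; have [->|li] := eqVneq l i; first by rewrite !pxi.
    have [lA|lA] := boolP (l \in A); last by rewrite cs ?scale0r // !inE negb_or li.
    by rewrite !pxA // e // !inE lj.
  move=> /addIr /(scalerI c0); by rewrite !pxA.
exists j0, j1; split=> //; split=> // l lA lj.
have sub : A :\ j0 \subset A by apply: subD1set.
have lA' : l \in A :\ j0 by rewrite !inE lj.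
have -> : \sum_(j in A) sg j - sg j0 = \sum_(j in A :\ j0) sg j.
  by rewrite (big_setD1 j0) //= addrAC subrr add0r.
have -> : a = #|A :\ j0|%:R + 1 by rewrite (cardsD1 j0) j0A natrD addrC.
apply: bnd fX' lA' => // v vs v0 vq.
have vs' j : j \notin i |: A -> v j = 0.
  by move=> hj; apply: vs; apply: contraNN hj; rewrite !inE => /orP[->|/andP[_ ->]]; rewrite ?orbT.
have vl := lin x v hx vs' v0 vq.
have vj0 : v j0 = 0.
  apply: vs; rewrite !inE eqxx /= orbF; apply: contraNN iA => /eqP <- //.
(* Subtracting a multiple of c removes the center and leaves a relation on A, which is trivial. At
   j0, where v vanishes and c does not, this gives v i = 0. *)
pose u j := v j - v i / c i * c j.
have u0 : forall j, u j = 0.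
  apply: onA.
  - move=> j jA; rewrite /u; have [->|ji] := eqVneq j i; first by rewrite divfK // subrr.
    have hj : j \notin i |: A by rewrite !inE negb_or ji.
    by rewrite (vs' _ hj) (cs _ hj) mulr0 subr0.
  - by rewrite /u sumrB -mulr_sumr v0 csum mulr0 subr0.
  - rewrite /u; under eq_bigr do rewrite scalerBl -scalerA.
    by rewrite sumrB -scaler_sumr vl clin // scaler0 subr0.
have vi0 : v i / c i = 0.
  by have /eqP := u0 j0; rewrite /u vj0 sub0r oppr_eq0 mulf_eq0 (negbTE c0) orbF => /eqP.
by move=> j; have := u0 j; rewrite /u vi0 mul0r subr0.
Qed.

Hypotheses (d4 : (4 <= d)%N) (Ad : (#|A| < d)%N) (dA : (5 * d < 7 * #|A|.+1)%N).

Lemma top_rich :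
  L / 8 <= lnc Y -> ((5 * d%:R - 7 * (a + 1)) / 8 + 1) * L <= lnc Y ->
  rich_bound pt A i P
    (C + eps * L + (5 / 8 * (d%:R - a - 1) + 3 / 4 * (a + 1)) * L) Y X.
Proof.
move=> tY1 tY2.
have YL : lnc Y <= L by apply: lnc_mono.
have Pm : (rk pt (Y :|: \bigcup_(j in A) P j) <= d.+1)%N by apply: rk_max.
have Ak' : (#|A| <= k)%N by apply: ltnW.
pose rho := lnc Y / L.
have so := size_greedy A P X L.
have mo := mem_greedy A P X L.
have ds j : b j + sg j = 1 by rewrite deficit_spread divff ?gt_eqF.
have sgE : sg = fun j => 1 - b j.
  by apply: functional_extensionality_dep => j; rewrite -(ds j) addrC addKr.
have b0 j : j \in o -> 0 <= b j by apply: (deficit_ge0 fX L0).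
have sg0 j : j \in o -> 0 <= sg j by apply: spread_ge0.
have b1 j : j \in o -> b j <= 1 by move=> /sg0; rewrite -(ds j) lerDl.
have osort := greedy_sorted A P X L.
have onil := greedy_nil P X L A0.
have [lb [lbo ebot lbp lbmin]] := bot_elt onil osort.
have lbA : lb \in A by rewrite -mo.
have fo : a <= f o.
  by rewrite -so; apply: (hrk_ge nd fX X0) (greedy_uniq A P X L) => j; rewrite mo.
have fw : f o <= w.
  have := hrk_total L A0 fX X0 cpl Y0 Pm; rewrite -[d.+1]addn1 natrD.
  by move: (f o) => s; lra.
have r8 : 1 / 8 <= rho by rewrite /rho ler_pdivlMr // mulrC mulrA mulr1.
have r1 : rho <= 1 by rewrite /rho ler_pdivrMr // mul1r.
have rT : (5 * d%:R - 7 * (a + 1)) / 8 + 1 <= rho by rewrite /rho ler_pdivlMr.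
have hA : h <= 5 / 8 * (f o - a) * (1 - bot b o) - 3 / 8 * (1 - bot b o)
    + 3 / 4 * \sum_(j <- o) (1 - b j).
  have eM : 1 - bot b o = sg lb by rewrite ebot -(ds lb) addrC addKr.
  have := height_full IH nd Ak' fX X0 injA PL L0 eps0 lbA eM.
  rewrite so sgE; apply=> j jA; rewrite ebot -/(b lb) lerD2l lerN2.
  by apply: lbmin; rewrite mo.
have hC : (forall l, l \in o -> h <= 5 / 8 * (w - (a + 1)) - 3 / 8 * (1 - b l)
        + 3 / 4 * \sum_(j <- o) (1 - b j)) \/
  (exists j0 j1, [/\ j0 \in o, j1 \in o, j0 != j1, b j0 <= b j1 &
     (forall l, l \in o -> l != j0 -> h <= 5 / 8 * (w - a) - 3 / 8 * (1 - b l)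
        + 3 / 4 * (\sum_(j <- o) (1 - b j) - (1 - b j0))) /\
     (forall p l, suffix p o -> j0 \notin p -> l \in p ->
        h <= 5 / 8 * (f p - (size p)%:R) - 3 / 8 * (1 - b l)
        + 3 / 4 * \sum_(j <- p) (1 - b j) + \sum_(j <- o | j \notin p) (1 - b j)
        - (1 - b j0))]).
  have so' : \sum_(j <- o) (1 - b j) = \sum_(j in A) sg j by rewrite sum_greedy sgE.
  have sgl l : 1 - b l = sg l by rewrite sgE.
  case: center_dichotomy => [H|[j0 [j1 [j0A j1A j01 b01 [fX' H]]]]]; [left|right].
    by move=> l; rewrite mo so' sgl; apply: H.
  exists j0, j1; split; rewrite ?mo //; split.
    by move=> l; rewrite mo so' !sgl; apply: H.
  move=> p l sp jp lp; have [sA up] := suffix_greedy sp.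
  pose B := [set j in p].
  have BA : B \subset A :\ j0.
    apply/subsetP => j; rewrite !inE => hj; rewrite sA // andbT.
    by apply: contraNN jp => /eqP <-.
  have cB : #|B| = size p by rewrite cardsE; apply/card_uniqP.
  have Bk : (#|B| <= k)%N.
    by apply: leq_trans Ak'; apply/subset_leq_card/(subset_trans BA)/subD1set.
  have hB : \bigcup_(j in B) proj X j = hull (proj X) p.
    by apply: eq_bigl => j; rewrite inE.
  have QP j : j \in A -> proj X j \subset P0 by apply: proj_sub fX.
  have sB : \sum_(j in B) lnc (proj X j) = (\sum_(j <- p) sg j) * L.
    rewrite (eq_bigl (mem p)); last by move=> j; rewrite inE.
    by rewrite -big_uniq // -(sum_spreadE X L0).
  have j0B : j0 \in A :\: B by rewrite !inE j0A andbT.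
  have sAB : \sum_(j in (A :\ j0) :\: B) lnc (proj X j) =
      (\sum_(j <- o | j \notin p) sg j - sg j0) * L.
    rewrite mulrBl -(sum_spreadE X L0) -(spreadE X L0) -(sum_outside A P X L).
    rewrite [Z in _ = Z - _](big_setD1 j0) //=.
    rewrite addrAC subrr add0r; apply: eq_bigl => j.
    by rewrite !inE andbCA.
  have lB : l \in B by rewrite inE.
  have injQ j : j \in A :\ j0 -> {in proj X j &, injective pt}.
    by move=> /setD1P[_ jA] u v /(subsetP (QP j jA)) hu /(subsetP (QP j jA)); apply: inj.
  have QL j : j \in A :\ j0 -> lnc (proj X j) <= L.
    by move=> /setD1P[_ jA]; apply/lnc_mono/QP.
  have ndj := nondeg_sub (subD1set A j0) nd.
  have := prefix_bound IH ndj Bk BA (family_proj fX') X0 injQ QL lB.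
  rewrite hB -/(f p) cB sB sAB (spreadE X L0 l) => Hp; apply: (height_le L0).
  move: Hp.
  rewrite (_ : \sum_(j <- p) (1 - b j) = \sum_(j <- p) sg j); last by rewrite sgE.
  rewrite (_ : \sum_(j <- o | j \notin p) (1 - b j) = \sum_(j <- o | j \notin p) sg j);
    last by rewrite sgE.
  rewrite !sgl; move: (\sum_(j <- p) _) (\sum_(j <- o | _) _) (sg l) (sg j0).
  move: (f p) => s1 s2 s3 s4 s5.
  by lra.
have hp p l : suffix p o -> l \in p ->
    h <= 5 / 8 * (f p - (size p)%:R) - 3 / 8 * (1 - b l)
      + 3 / 4 * \sum_(j <- p) (1 - b j) + \sum_(j <- o | j \notin p) (1 - b j).
  move=> sp lp; have := height_prefix IH nd Ak' fX X0 injA PL L0 sp lp.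
  by rewrite sgE.
have Erk : (3 <= rk pt Y <= d.+2)%N by rewrite rY (leq_trans (rk_max _ _)).
pose TT := 5 / 8 * (d%:R - (size o)%:R - 1) + 3 / 4 * ((size o)%:R + 1) : R.
have Ad' := Ad; have dA' := dA; rewrite -so in Ad' dA' rT fo hA hC.
have num := top_list_numeric (hrk0 pt X) onil (greedy_uniq A P X L) osort b0 b1 d4 Ad' Erk erefl
  erefl dA' r8 r1 rT fo fw (hrk_tail nd fX X0) (erefl TT) hp hA hC.
rewrite /rich_bound; case: num => H.
- left; have := ler_wpM2r (ltW L0) H.
  have -> : (h + rho + ((rk pt Y)%:R - 1 + 1) * (1 - rho)) * L =
     lnc X - (C + eps * L) + lnc Y + (rk pt Y)%:R * (L - lnc Y).
    by rewrite /height /rho; field; rewrite gt_eqF.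
  rewrite /TT so; move: (_ * L) (C + eps * L) (_%:R * (_ - _)) => t1 t2 t3; lra.
- right; exists o; split; [exact: greedy_uniq | exact: mo | rewrite cost_greedy //].
  have := ler_wpM2r (ltW L0) H.
  have -> : (h + rho + cost b f o) * L =
     lnc X - (C + eps * L) + lnc Y + L * cost b f o.
    by rewrite /height /rho; field; rewrite gt_eqF.
  rewrite /TT so; move: (cost _ _ _) => t1; lra.
Qed.

End TopRich.

Section Balanced.
Context {R : realType} {d : nat} {I : finType}.

(** The exponent is 5/8 d + 1/8 |J|. The restriction to |J| <= d is harmless, since [drop_vertex]
    reduces a full simplex to a facet. *)
Definition balanced_bound (eps C : R) (k : nat) :=
  forall (T : finType) (pt : T -> 'rV[R]_d) (J : {set I}) (P0 : {set T})
    (D : I -> I -> R) (X : {set {ffun I -> T}}),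
  nondeg J D -> (0 < #|J| <= k)%N -> (#|J| <= d)%N ->
  family_on pt J (fun=> P0) D X -> X != set0 -> {in P0 &, injective pt} ->
  lnc X <= C + eps * lnc P0 + (5 / 8 * (d%:R - #|J|%:R) + 3 / 4 * #|J|%:R) * lnc P0.

Lemma inner_bound_mono (eps C C' : R) k : C <= C' ->
  @inner_bound R d I eps C k -> @inner_bound R d I eps C' k.
Proof.
move=> CC hb T pt J P D X m N i0 h1 h2 h3 h4 h5 h6 h7 h8.
by apply: le_trans (hb T pt J P D X m N i0 h1 h2 h3 h4 h5 h6 h7 h8) _; rewrite !lerD2r.
Qed.

(** A vertex i fails only if some j0 carries the right angle of all triangles i, j0, l. Then j0
    succeeds: otherwise some triangle has two right angles, and two vertices coincide. *)
Lemma good_vertex (T : finType) (pt : T -> 'rV[R]_d) (J : {set I}) (P : I -> {set T})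
    (D : I -> I -> R) (X : {set {ffun I -> T}}) :
  nondeg J D -> family_on pt J P D X -> X != set0 -> (3 <= #|J|)%N ->
  exists2 i, i \in J & forall j, j \in J :\ i ->
    exists l, [/\ l \in J :\ i, l != j & D i l != D i j + D j l].
Proof.
move=> nd [_ hD _] /set0Pn[x hx] J3.
have Dsym j l : j \in J -> l \in J -> D j l = D l j.
  by move=> jJ lJ; rewrite -(hD x) // -(hD x l j) // /dd sqdistC.
have Dpos j l : j \in J -> l \in J -> j != l -> D j l != 0.
  move=> jJ lJ jl; apply/eqP => D0.
  have e : pt (x j) = pt (x l) by apply: sqdist_eq0; rewrite -[RHS]D0 -(hD x).
  have s : [set j; l] \subset J by apply/subsetP => u /set2P[]->.
  have := nondeg_rk (nondeg_sub s nd) (x := x) (pt := pt) _; rewrite cards2 jl.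
  have -> : x @: [set j; l] = [set x j; x l] by rewrite imsetU !imset_set1.
  rewrite rk_U1_in ?rk1 => [H|]; last by rewrite e; apply: mem_aff; rewrite inE.
  suff : (2 <= 1)%N by [].
  by apply: H => u v /(subsetP s) uJ /(subsetP s) vJ; apply: hD.
have [i iJ] : exists i, i \in J by apply/set0Pn; rewrite -card_gt0 (ltn_trans _ J3).
pose bad i := exists2 j, j \in J :\ i & forall l, l \in J :\ i -> l != j -> D i l = D i j + D j l.
have notbad i' : i' \in J -> ~ bad i' -> exists2 i, i \in J & forall j, j \in J :\ i ->
    exists l, [/\ l \in J :\ i, l != j & D i l != D i j + D j l].
  move=> iJ' nb; exists i' => // j hj; apply: contrapT => H; apply: nb; exists j => // l hl lj.
  by apply/eqP; apply: contrapT => /negP ne; apply: H; exists l.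
have [[j0 /setD1P[j0i j0J] h0]|] := pselect (bad i); last exact: notbad.
apply: (notbad j0 j0J) => -[j1 /setD1P[j1j0 j1J] h1].
have [e|j1i] := eqVneq j1 i.
  have [l lJ] : exists l, l \in (J :\ i) :\ j0.
    apply/set0Pn; rewrite -card_gt0.
    have := cardsD1 i J; have := cardsD1 j0 (J :\ i); rewrite iJ !inE j0i j0J /=.
    by move=> e1 e2; move: J3; rewrite e2 e1 !ltnS.
  move: lJ => /setD1P[lj0 /setD1P[li lJ]].
  have := h0 l; rewrite !inE li lJ lj0 => /(_ isT isT).
  have := h1 l; rewrite !inE e li lJ lj0 => /(_ isT isT) -> h2.
  have /eqP := Dpos j0 i j0J iJ j0i; apply.
  by move: h2; rewrite (Dsym i j0) //; lra.
have := h1 i; rewrite !inE eq_sym j0i iJ eq_sym j1i => /(_ isT isT) h2.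
have := h0 j1; rewrite !inE j1i j1J j1j0 => /(_ isT isT) h3.
have /eqP := Dpos j1 j0 j1J j0J j1j0; rewrite (Dsym j1 j0) //; apply.
by move: h2 h3; rewrite (Dsym j0 i) // (Dsym j1 i) //; lra.
Qed.

Lemma balanced_step (eps C : R) (k q : nat) : (4 <= d)%N -> 0 < eps -> 0 <= C ->
  #|I|%:R / q.+1%:R <= eps -> @inner_bound R d I eps C d -> balanced_bound eps C k ->
  balanced_bound (eps + eps) (C + `|ln (@peel_const R d I q)|) k.+1.
Proof.
move=> d4 eps0 C0 hq hin IH T pt J P0 D X nd /andP[J0 Jk] Jd fX X0 inj.
set L : R := lnc P0; have L0 : 0 <= L by apply: lnc_ge0.
set c := `|ln _|; have c0 : 0 <= c by apply: normr_ge0.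
have eL0 : 0 <= eps * L by rewrite mulr_ge0 // ltW.
have triv (J' : {set I}) X' : X' != set0 -> family_on pt J' (fun=> P0) D X' ->
    lnc X' <= #|J'|%:R * L.
  by move=> h1 h2; have := family_trivial h1 h2; rewrite sumr_const mulr_natl.
(* The trivial exponent |J| is good enough as long as it is at most 5/8 d + 1/8 |J|. *)
have [h7|h7] := leqP (7 * #|J|) (5 * d).
  apply: (le_trans (triv J X X0 fX)).
  have : 0 <= (5 * d%:R - 7 * #|J|%:R) * L :> R.
    by rewrite mulr_ge0 // subr_ge0 -!natrM ler_nat.
  by move: (#|J|%:R) (d%:R) => x y; lra.
have J3 : (3 <= #|J|)%N by lia.
have [i iJ hgood] := good_vertex nd fX X0 J3.
pose A := J :\ i.
have JA : #|J| = #|A|.+1 by rewrite (cardsD1 i) iJ.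
have AJ : A \subset J by apply: subD1set.
have iA : i \notin A by rewrite !inE eqxx.
have A0 : A != set0 by rewrite -card_gt0; lia.
have ndA := nondeg_sub AJ nd.
have /set0Pn[x0 hx0] := X0.
pose XA := restr A x0 @: X.
have fXA : family_on pt A (fun=> P0) D XA by apply: family_restr fX.
have XA0 : XA != set0 by apply/set0Pn; exists (restr A x0 x0); apply: imset_f.
have Ad : (#|A| < d)%N by rewrite -JA.
have A7 : (5 * d < 7 * #|A|.+1)%N by rewrite -JA.
pose a : R := #|A|%:R.
pose TT : R := 5 / 8 * (d%:R - a - 1) + 3 / 4 * (a + 1).
(* The entries are the target exponent minus the two bounds for XA: 5/8 d + a/8 by induction, and
   the trivial a. *)
pose t0 := Num.max (1 / 8) ((5 * d%:R - 7 * (a + 1)) / 8 + 1) * L.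
have t00 : 0 <= t0 by rewrite mulr_ge0 // le_max; apply/orP; left; lra.
have t1 : L / 8 <= t0.
  by rewrite mulrC -[8^-1]mul1r ler_wpM2r // le_max lexx.
have t2 : ((5 * d%:R - 7 * (a + 1)) / 8 + 1) * L <= t0.
  by rewrite ler_wpM2r // le_max lexx orbT.
have poor : lnc XA + t0 <= C + eps * L + TT * L.
  rewrite /t0; case: (leP (1 / 8) _) => _.
    have := triv A XA XA0 fXA; rewrite -/a /TT; move: (lnc XA) => u.
    by clear -eL0 C0; lra.
  have Ak : (0 < #|A| <= k)%N by rewrite card_gt0 A0 -ltnS -JA.
  have := IH T pt A P0 D XA ndA Ak (ltnW Ad) fXA XA0 inj; rewrite -/a -/L /TT.
  by move: (lnc XA) => u; clear; lra.
have PLam j : j \in A -> lnc P0 <= L by [].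
have rich : forall (Y : {set T}) (X' : {set {ffun I -> T}}), Y \subset P0 -> X' \subset XA ->
    X' != set0 -> (forall y x j, y \in Y -> x \in X' -> j \in A -> dd pt y (x j) = D i j) ->
    (3 <= rk pt Y)%N -> t0 < lnc Y ->
    rich_bound pt A i (fun=> P0) (C + eps * L + TT * L) Y X'.
  move=> Y X' YP X'A X'0 cpl rY tY.
  have YL := lnc_mono (R := R) YP.
  have Lp : 0 < L by apply: lt_le_trans YL; apply: le_lt_trans tY.
  apply: (top_rich hin ndA Ad A0 iA (family_sub X'A fXA) X'0 inj Lp (ltW eps0) cpl YP rY) => //.
  - by apply: ltW; apply: le_lt_trans tY.
  - by apply: ltW; apply: le_lt_trans tY.
have inji : {in (fun=> P0) i &, injective pt} by [].
have := peel q inji A0 t00 L0 PLam fXA poor rich.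
move=> pb.
have cX : (#|X| <= \sum_(y in XA) #|link pt A i (fun=> P0) D y|)%N.
  apply: (card_restr (F := link pt A i (fun=> P0) D) fX) => x hx; apply/linkP.
  case: fX => h1 h2 _; split; first exact: h1 hx iJ.
  by move=> j jA; rewrite restrE // h2 // (subsetP AJ).
have X1 : 1 <= #|X|%:R :> R by rewrite ler1n card_gt0.
have {}pb : #|X|%:R <= @peel_const R d I q *
    expR (C + eps * L + TT * L + #|I|%:R / q.+1%:R * L).
  by apply: le_trans pb; rewrite ler_nat.
have K0 : 0 < @peel_const R d I q.
  rewrite -(pmulr_lgt0 _ (expR_gt0 (C + eps * L + TT * L + #|I|%:R / q.+1%:R * L))).
  by apply: lt_le_trans pb; apply: lt_le_trans X1.
have : lnc X <= ln (@peel_const R d I q) + (C + eps * L + TT * L + #|I|%:R / q.+1%:R * L).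
  rewrite -[Z in _ + Z]expRK -lnM ?posrE ?expR_gt0 // ler_ln // posrE.
    exact: lt_le_trans ltr01 X1.
  exact: mulr_gt0 K0 (expR_gt0 _).
have := ler_norm (ln (@peel_const R d I q)); rewrite -/c.
have := ler_wpM2r L0 hq; rewrite JA -natr1 -/a /TT.
move: (ln (@peel_const R d I q)) (#|I|%:R / q.+1%:R * L) => z1 z2.
by clear; lra.
Qed.

Lemma balanced k eps : (4 <= d)%N -> 0 < eps ->
  exists2 C : R, 0 <= C & balanced_bound eps C k.
Proof.
move=> d4; elim: k eps => [|k IH] eps eps0.
  by exists 0 => // T pt J P0 D X _ /andP[c1 c2]; have := leq_trans c1 c2.
have e2 : 0 < eps / 2 by rewrite divr_gt0.
have [C1 C10 h1] := IH _ e2.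
have [C2 C20 h2] := @inner R d I d _ e2.
have [q hq] := small_eps I e2.
have h1' : balanced_bound (eps / 2) (C1 + C2) k.
  move=> T pt J P0 D X a1 a2 a3 a4 a5 a6; apply: (le_trans (h1 T pt J P0 D X a1 a2 a3 a4 a5 a6)).
  by rewrite !lerD2r lerDl.
have h2' : @inner_bound R d I (eps / 2) (C1 + C2) d.
  by apply: inner_bound_mono h2; rewrite lerDr.
exists (C1 + C2 + `|ln (@peel_const R d I q)|); first by rewrite !addr_ge0.
have -> : eps = eps / 2 + eps / 2 by lra.
by apply: balanced_step => //; rewrite addr_ge0.
Qed.

End Balanced.

(** * From congruent subsets to tuples with prescribed distances *)

Section Counting.
Context {R : realType} {d k n : nat} (S : 'I_k -> 'rV[R]_d) (P : 'I_n -> 'rV[R]_d).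
Hypotheses (aS : aff_indep S) (injP : injective P).

Definition simplex_dist (j l : 'I_k) : R := sqdist (S j) (S l).

Definition copies : {set {ffun 'I_k -> 'I_n}} :=
  [set x : {ffun 'I_k -> 'I_n} |
    [forall j, forall l, sqdist (P (x j)) (P (x l)) == simplex_dist j l]].

Lemma copies_family : family_on P setT (fun=> setT) simplex_dist copies.
Proof.
split=> [x j|x j l hx _ _|x y _ _ e]; first by rewrite inE.
  by move: hx; rewrite inE => /forallP/(_ j)/forallP/(_ l)/eqP.
by apply/ffunP => j; apply: e.
Qed.

Lemma simplex_nondeg : nondeg [set: 'I_k] simplex_dist.
Proof.
move=> a _ a0 aq; apply: aS => //; apply: dotxx_eq0.
by have := sum_sqdist S a0; rewrite -/simplex_dist aq; lra.
Qed.

(** Ordering its points turns a congruent subset into a tuple with the distances of S, whose image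
    gives the subset back. *)
Lemma num_congruent_copies : (num_congruent S P <= #|copies|)%N.
Proof.
apply: leq_trans (leq_imset_card (fun x : {ffun 'I_k -> 'I_n} => x @: setT) _).
apply/subset_leq_card/subsetP => B; rewrite inE => /andP[_ /asboolP[g [gi [g1 g2]]]].
have /choice[x hx] : forall i, exists j, j \in B /\ g (S i) = P j.
  by move=> i; have [j h1 h2] := g2 i; exists j.
apply/imsetP; exists [ffun i => x i].
  rewrite inE; apply/forallP => j; apply/forallP => l; rewrite !ffunE.
  by rewrite -(hx j).2 -(hx l).2 gi.
apply/setP => j; apply/idP/imsetP => [/g1[i e]|[i _ ->]]; last by rewrite ffunE (hx i).1.
by exists i => //; rewrite ffunE; apply: injP; rewrite e (hx i).2.
Qed.

(* The points completing a [d]-point copy of a facet lie in a hull of rank at most 2. *)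
Lemma drop_vertex (X : {set {ffun 'I_k -> 'I_n}}) (j0 : 'I_k) : (0 < d)%N -> k = d.+1 ->
  family_on P setT (fun=> setT) simplex_dist X -> X != set0 ->
  exists Y, [/\ Y != set0, family_on P (setT :\ j0) (fun=> setT) simplex_dist Y &
    lnc X <= lnc Y + ln 2 :> R].
Proof.
move=> d0 kd fX /set0Pn[x0 hx0]; set J := setT :\ j0.
have fY := family_restr x0 (subD1set setT j0) fX; rewrite -/J in fY.
exists (restr J x0 @: X); split=> //.
  by apply/set0Pn; exists (restr J x0 x0); apply: imset_f.
pose F (y : {ffun 'I_k -> 'I_n}) : {set 'I_n} :=
  [set p | [forall (l | l \in J), dd P p (y l) == simplex_dist j0 l]].
have ndJ := nondeg_sub (subD1set setT j0) simplex_nondeg; rewrite -/J in ndJ.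
have cJ : #|J| = d.
  by have := cardsD1 j0 [set: 'I_k]; rewrite cardsT card_ord inE -/J /=; lia.
apply: lnc_card_mul; apply: (@leq_trans (\sum_(y in restr J x0 @: X) 2)%N); last first.
  by rewrite sum_nat_const.
apply: leq_trans (card_restr (F := F) fX _) _ => [x hx|].
  rewrite inE; apply/forall_inP => l lJ; rewrite restrE; last exact: lJ.
  by case: fX => _ h2 _; rewrite h2 ?inE.
apply: leq_sum => y hy; have [_ hD _] := fY.
have FD p l : p \in F y -> l \in J -> dd P p (y l) = simplex_dist j0 l.
  by rewrite inE => /forall_inP h /h /eqP.
have [->|/set0Pn[p0 hp0]] := eqVneq (F y) set0; first by rewrite cards0.
have rJ : (d <= rk P (y @: J))%N.
  by rewrite -{1}cJ; apply: nondeg_rk ndJ _ => j l; apply: hD.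
have /set0Pn[l0 l0J] : J != set0 by rewrite -card_gt0 cJ.
apply: (sphere_line (x := P (y l0)) (c := simplex_dist j0 l0) (pt := P)).
- by move=> p p' _ _; apply: injP.
- by move=> p hp; apply: FD.
have := rk_orthogonal (pt := P) hp0 (imset_f (fun l => y l) l0J) _ => /(_ _)/leq_trans H.
have : (rk P (F y) + rk P (y @: J) <= d.+2)%N.
  apply: H; last by rewrite ltnS rk_max.
  by move=> p p' _ hp hp' /imsetP[l lJ ->]; rewrite !FD.
by move: rJ; lia.
Qed.

End Counting.

(** For k = d+1 the exponent is that of a facet with d vertices, 5/8 d + 1/8 d. *)
Lemma num_congruent_bound (R : realType) (d k : nat) (eps : R) :
  (4 <= d)%N -> 0 < eps -> (1 <= k <= d.+1)%N ->
  exists C : R, forall (n : nat) (S : 'I_k -> 'rV[R]_d) (P : 'I_n -> 'rV[R]_d),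
    (1 <= n)%N -> aff_indep S -> injective P ->
    (num_congruent S P)%:R <= expR C *
      powR n%:R ((if (k <= d)%N then 5 / 8 * d%:R + 1 / 8 * k%:R else 3 / 4 * d%:R) + eps).
Proof.
move=> d4 eps0 /andP[k1 kd].
have [C C0 hC] := @balanced R d 'I_k k eps d4 eps0.
exists (C + ln 2) => n S P n1 aS injP.
set E := (X in X + eps).
have [X0|X0] := eqVneq (copies S P) set0.
  apply: (@le_trans _ _ 0); last by rewrite mulr_ge0 ?expR_ge0 ?powR_ge0.
  by rewrite (ler_nat R _ 0) (leq_trans (num_congruent_copies S injP)) // X0 cards0.
have fX := copies_family S P; have nd := simplex_nondeg aS.
have ln2 : 0 <= ln 2 :> R by rewrite ln_ge0 // ler1n.
have Ln : lnc [set: 'I_n] = ln n%:R :> R by rewrite /lnc cardsT card_ord.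
have injT : {in [set: 'I_n] &, injective P} by move=> p p' _ _; apply: injP.
suff h : lnc (copies S P) <= C + ln 2 + (E + eps) * ln n%:R.
  rewrite /powR; have -> : (n%:R == 0 :> R) = false by rewrite pnatr_eq0 eqn0Ngt n1.
  rewrite -expRD; apply: (@le_trans _ _ (expR (lnc (copies S P)))); last by rewrite ler_expR.
  by apply: le_trans (nat_le_expR _); rewrite ler_nat num_congruent_copies.
rewrite /E; case: ifP => kd'.
  have cT : #|[set: 'I_k]| = k by rewrite cardsT card_ord.
  have := hC _ P setT setT (simplex_dist S) _ nd _ _ fX X0 injT.
  rewrite cT k1 leqnn kd' Ln => /(_ isT isT); move: (lnc _) (ln n%:R) => u v.
  by move: ln2; clear; lra.
have kE : k = d.+1 by apply/eqP; rewrite eqn_leq kd ltnNge kd'.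
have d0 : (0 < d)%N by apply: leq_trans d4.
have [Y [Y0 fY hY]] := drop_vertex aS injP (Ordinal k1) d0 kE fX X0.
have dk : (d <= k)%N by rewrite kE.
set J := setT :\ _ in fY.
have cJ : #|J| = d.
  by have := cardsD1 (Ordinal k1) [set: 'I_k]; rewrite cardsT card_ord inE -/J /=; lia.
have := hC _ P J setT (simplex_dist S) Y (nondeg_sub (subD1set _ _) nd) _ _ fY Y0 injT.
rewrite cJ d0 dk leqnn Ln => /(_ isT isT); move: hY.
move: (lnc _) (lnc Y) (ln n%:R) => u1 u2 v; move: ln2; clear; lra.
Qed.

(* C(d,k,n) = O_{d,eps}(n^(5d/8 + k/8 + eps)), and in particular
   C(d,k,n) = O_{d,eps}(n^(3d/4 + eps)) for k <= d. The max defining C(d,k,n)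
   is bounded by bounding every instance (S, P). *)
Theorem theorem1p2 (R : realType) (d : nat) (eps : R) :
  (4 <= d)%N -> 0 < eps ->
  exists c : R, 0 < c /\
    forall (k n : nat) (S : 'I_k -> 'rV[R]_d) (P : 'I_n -> 'rV[R]_d),
      (1 <= k <= d.+1)%N -> (1 <= n)%N ->
      aff_indep S -> injective P ->
      (num_congruent S P)%:R
        <= c * powR (n%:R) (5 / 8 * d%:R + 1 / 8 * k%:R + eps)
      /\ ((k <= d)%N ->
          (num_congruent S P)%:R <= c * powR (n%:R) (3 / 4 * d%:R + eps)).
Proof.
move=> d4 eps0.
have /choice[C hC] : forall k : nat, exists C : R, (1 <= k <= d.+1)%N ->
    forall (n : nat) (S : 'I_k -> 'rV[R]_d) (P : 'I_n -> 'rV[R]_d),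
    (1 <= n)%N -> aff_indep S -> injective P ->
    (num_congruent S P)%:R <= expR C *
      powR n%:R ((if (k <= d)%N then 5 / 8 * d%:R + 1 / 8 * k%:R else 3 / 4 * d%:R) + eps).
  move=> k; have [hk|hk] := boolP (1 <= k <= d.+1)%N; last by exists 0.
  by have [C hC] := num_congruent_bound d4 eps0 hk; exists C.
(* One constant for the finitely many k. *)
exists (\sum_(k < d.+2) expR (C k)); split.
  by rewrite big_ord_recl ltr_pwDl ?expR_gt0 // sumr_ge0 // => k _; apply: expR_ge0.
move=> k n S P hk n1 aS injP; have kd : (k < d.+2)%N by case/andP: hk.
have n1' : 1 <= n%:R :> R by rewrite ler1n.
suff key e : (if (k <= d)%N then 5 / 8 * d%:R + 1 / 8 * k%:R else 3 / 4 * d%:R) <= e ->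
    (num_congruent S P)%:R <= (\sum_(k < d.+2) expR (C k)) * powR n%:R (e + eps).
  split=> [|kd']; apply: key; last first.
    rewrite kd'; have : k%:R <= d%:R :> R by rewrite ler_nat.
    by clear; lra.
  case: ifP => // kd'; have : d%:R <= k%:R :> R by rewrite ler_nat ltnW // ltnNge kd'.
  by clear; lra.
move=> he; apply: le_trans (hC k hk n S P n1 aS injP) _.
apply: ler_pM; rewrite ?expR_ge0 ?powR_ge0 //; last by apply: ler_powR; rewrite ?lerD2r.
rewrite (bigD1 (Ordinal kd)) //= lerDl; apply: sumr_ge0 => j _; exact: expR_ge0.
Qed.
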